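(* Let $K$ be a real closed field and let $A\in\mathcal{M}_n(L_K)$ be a singular system. Then there exist a formal gauge transformation $\Psi_P$, with $P\in GL_n(L_K)$, and a ramification $R_r$ ($r\in\mathbb{N}_{\ge1}$) such that the transformed system $F^{\mathbb{R}}=(\Psi_P\circ R_r)[A]$, with Poincaré rank $\tilde q=q(F^{\mathbb R})$, is written as $$Y'=x^{-(\tilde q+1)}\left(D_1(x)\oplus D_2(x)+x^{\tilde q}(C_1\oplus C_2)\right)Y,$$ where: - $D_1(x)=\mathrm{diag}(e_1(x),\dots,e_{n_1}(x))$ with $e_j\in K[x]$ of degree at most $\tilde q-1$ (equal to zero if $\tilde q=0$); - $D_2(x)=\Theta_{n_2}(\mathrm{diag}(d_1(x),\dots,d_{n_2}(x)))$ with $d_j\in\overline K[x]\setminus K[x]$ of degree at most $\tilde q-1$ (equal to zero if $\tilde q=0$); - $C_1,C_2$ are constant matrices with entries in $K$ of sizes $n_1$ and $2n_2$ respectively, and $C_2$ is a $\mathbb{C}$-matrix; - $[D_1(x),C_1]=0$ and $[D_2(x),C_2]=0$; that is, $F^{\mathbb R}$ is in real Turrittin-Ramis-Sibuya form and $F^{\mathbb R}=J_{\tilde q}F^{\mathbb R}$. Moreover, the transformation $\Psi_P$ can be chosen to be equal to $\Psi_P=\Psi_Q\circ\psi$, where $Q\in\mathcal{M}_n(K[[x]])$ satisfies $Q(0)=I_n$ and $\psi$ is a finite composition of regular polynomial or diagonal monomial gauge transformations (with coefficients in $K$).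
   Context: **Fields and systems.** $K$ is a real closed field, i.e. $K\subsetneq K(i)=\overline{K}$ with $i=\sqrt{-1}$ and $\overline K$ the algebraic closure. $L_K=K[[x]][x^{-1}]$ is the field of formal meromorphic (Laurent) series with the derivation $'=d/dx$ and the usual order valuation $\nu:L_K\to\mathbb{Z}\cup\{\infty\}$; $L_{\overline K}$ is defined likewise. $\mathcal{M}_n(R)$ is the ring of $n\times n$ matrices over a ring $R$. A matrix $A\in\mathcal{M}_n(L_K)$ is identified with the formal meromorphic linear system $Y'=AY$. Its order is $\nu(A)=\min_{i,j}\nu(a_{ij})$, and one writes $A=x^{\nu(A)}(A_0+xA_1+\cdots)$ with $A_i\in\mathcal{M}_n(K)$, $A_0\neq 0$. The truncation up to degree $N\ge0$ is $J_NA:=x^{\nu(A)}(A_0+xA_1+\cdots+x^NA_N)$. The system is singular if $\nu(A)<0$. Its Poincaré rank is $q(A):=\max\{-\nu(A)-1,0\}$. **Transformations.** For $P\in GL_n(L_K)$, the gauge transformation $\Psi_P:\mathcal{M}_n(L_K)\to\mathcal{M}_n(L_K)$ is $\Psi_P[A]=P^{-1}AP-P^{-1}P'$. It is called *regular* if $\nu(P)=0$ and $\det P(0)\ne 0$; *polynomial* if every entry of $P$ belongs to $K[x]$; *diagonal monomial* if $P=\mathrm{diag}(x^{k_1},\dots,x^{k_n})$ with $k_j\in\mathbb{N}_{\ge 0}$. For $r\in\mathbb{N}_{\ge1}$, the ramification of order $r$ is $R_r:\mathcal{M}_n(L_K)\to\mathcal{M}_n(L_K)$, $R_r[A]=rx^{r-1}A(x^r)$.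 **Complex matrices over $K$.** For $\lambda=a+bi\in\overline K$ with $a,b\in K$, put $\Lambda_\lambda=\begin{pmatrix}a&-b\\ b&a\end{pmatrix}$. For $m\ge1$, $\Theta_m:\mathcal{M}_m(\overline K)\to\mathcal{M}_{2m}(K)$ is the monomorphism of $K$-algebras sending $(c_{uv})$ to the $2\times2$-block matrix $(\Lambda_{c_{uv}})$; it is extended coefficientwise to $\mathcal{M}_m(L_{\overline K})\to\mathcal{M}_{2m}(L_K)$. A constant matrix in the image of $\Theta_m$ is called a $\mathbb{C}$-matrix. For square matrices $U,V$, $U\oplus V$ is the block-diagonal matrix with diagonal blocks $U,V$. **Real Turrittin-Ramis-Sibuya form.** A system $F\in\mathcal{M}_n(L_K)$ with Poincaré rank $\tilde q$ is in real Turrittin-Ramis-Sibuya form of degree $\mu\in\mathbb{N}_{\ge 0}$ if $F=x^{-(\tilde q+1)}(D_1(x)\oplus D_2(x)+x^{\tilde q}(C_1\oplus C_2)+O(x^{\tilde q+\mu+1}))$ with $D_1,D_2,C_1,C_2$ satisfying the four conditions listed in the claim (with $n_1+2n_2=n$, where $n_1$ or $n_2$ may be $0$). *)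

(* Defs.v *)
From HB Require Import structures.
From mathcomp Require Import all_boot all_order all_algebra.
From mathcomp Require Import complex mxtens zify.
From mathcomp Require Import boolp classical_sets functions cardinality fsbigop.
From mathcomp Require Import constructive_ereal.

Set Implicit Arguments.
Unset Strict Implicit.
Unset Printing Implicit Defensive.

Import Order.TTheory GRing.Theory Num.Theory.

Local Open Scope ring_scope.

Definition vanish_below (K : nmodType) (a : int) (f : int -> K) : Prop :=
  forall n, n < a -> f n = 0.

Record laurent (K : nmodType) : Type := Laurent {
  lcoef :> int -> K;
  lcoefP : exists a, vanish_below a lcoef
}.

Section LaurentField.
Variable K : fieldType.
Implicit Types f g h : laurent K.

HB.instance Definition _ := gen_eqMixin (laurent K).
HB.instance Definition _ := gen_choiceMixin (laurent K).

Lemma laurentP f g : f =1 g -> f = g.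
Proof.
case: f g => [f Pf] [g Pg] /= /funext fg.
by rewrite fg in Pf *; congr Laurent; exact: Prop_irrelevance.
Qed.

Fact lzero_subproof : exists a, vanish_below a (fun _ : int => 0 : K).
Proof. by exists 0. Qed.
Definition lzero : laurent K := Laurent lzero_subproof.

Fact lopp_subproof f : exists a, vanish_below a (fun n => - f n).
Proof. by have [a fa] := lcoefP f; exists a => n /fa->; rewrite oppr0. Qed.
Definition lopp f : laurent K := Laurent (lopp_subproof f).

Fact ladd_subproof f g : exists a, vanish_below a (fun n => f n + g n).
Proof.
have [[a fa] [b gb]] := (lcoefP f, lcoefP g).
by exists (Num.min a b) => n; rewrite lt_min => /andP[/fa-> /gb->]; rewrite addr0.
Qed.
Definition ladd f g : laurent K := Laurent (ladd_subproof f g).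

Fact laddA : associative ladd.
Proof. by move=> f g h; apply: laurentP => n /=; rewrite addrA. Qed.
Fact laddC : commutative ladd.
Proof. by move=> f g; apply: laurentP => n /=; rewrite addrC. Qed.
Fact ladd0 : left_id lzero ladd.
Proof. by move=> f; apply: laurentP => n /=; rewrite add0r. Qed.
Fact laddN : left_inverse lzero lopp ladd.
Proof. by move=> f; apply: laurentP => n /=; rewrite addNr. Qed.

HB.instance Definition _ := GRing.isZmodule.Build (laurent K)
  laddA laddC ladd0 laddN.

(* The Cauchy product: the finitely supported sum of the f_i g_(n - i). *)
Definition lmul_coef (f g : int -> K) (n : int) : K :=
  \sum_(i \in [set: int]) f i * g (n - i).

Definition ltail (f : int -> K) (a : int) (m : nat) : {poly K} :=
  \poly_(k < m) f (a + k%:Z).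

Lemma lmul_coefE (u v : int -> K) a b n m : vanish_below a u ->
    vanish_below b v -> n < a + b + m%:Z ->
  lmul_coef u v n = \sum_(k < m) u (a + k%:Z) * v (n - (a + k%:Z)).
Proof.
move=> ua vb ltn.
have inj : {in iota 0 m &, injective (fun k : nat => a + k%:Z)}.
  by move=> i j _ _; lia.
rewrite /lmul_coef (fsbigE [seq a + k%:Z | k <- iota 0 m]) //.
- rewrite big_map (eq_bigl xpredT) => [|i]; last by rewrite in_setT.
  rewrite -[m in LHS]subn0.
  by rewrite -/(index_iota 0 m) big_mkord.
- by rewrite (map_inj_in_uniq inj) iota_uniq.
- move=> i _ /negP ni; case: (ltP i a) => [/ua->|ai]; first by rewrite mul0r.
  rewrite [v _]vb ?mulr0 //; apply/negbNE/negP; rewrite -leNgt => le.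
  apply: ni; apply/mapP; exists (absz (i - a)%R); last lia.
  rewrite mem_iota; lia.
Qed.

Lemma lmul_ltail (u v : int -> K) a b k m : vanish_below a u ->
    vanish_below b v -> (k < m)%N ->
  lmul_coef u v (a + b + k%:Z) = (ltail u a m * ltail v b m)`_k.
Proof.
move=> ua vb km; rewrite (lmul_coefE (m := k.+1) ua vb); last lia.
rewrite coefM; apply: eq_bigr => j _; rewrite !coef_poly.
have jk := ltn_ord j; rewrite !ifT; try lia.
by congr (_ * v _); lia.
Qed.

Lemma lmul_vanish (u v : int -> K) a b : vanish_below a u ->
  vanish_below b v -> vanish_below (a + b) (lmul_coef u v).
Proof.
move=> ua vb n nab; rewrite (lmul_coefE (m := 0) ua vb) ?big_ord0 //; lia.
Qed.

Fact lmul_subproof f g : exists a, vanish_below a (lmul_coef f g).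
Proof.
have [[a fa] [b gb]] := (lcoefP f, lcoefP g).
by exists (a + b); exact: lmul_vanish.
Qed.
Definition lmul f g : laurent K := Laurent (lmul_subproof f g).

Fact lone_subproof : exists a, vanish_below a (fun n => (n == 0)%:R : K).
Proof. by exists 0 => n; case: eqVneq => // ->. Qed.
Definition lone : laurent K := Laurent lone_subproof.

Fact lmulC : commutative lmul.
Proof.
move=> f g; have [[a fa] [b gb]] := (lcoefP f, lcoefP g).
apply: laurentP => n /=; case: (ltP n (a + b)) => ab.
  by rewrite (lmul_vanish fa gb) // (lmul_vanish gb fa) // addrC.
have [k ->] : exists k : nat, n = a + b + k%:Z by exists (absz (n - (a + b))%R); lia.
rewrite (lmul_ltail fa gb (ltnSn k)) [a + b]addrC.
by rewrite (lmul_ltail gb fa (ltnSn k)) mulrC.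
Qed.

Fact lmulA : associative lmul.
Proof.
move=> f g h.
have [[[a fa] [b gb]] [c hc]] := (lcoefP f, lcoefP g, lcoefP h).
have fg := lmul_vanish fa gb; have gh := lmul_vanish gb hc.
apply: laurentP => n /=; case: (ltP n (a + b + c)) => abc.
  by rewrite (lmul_vanish fg hc) // (lmul_vanish fa gh) // addrA.
have [k ->] : exists k : nat, n = a + b + c + k%:Z.
  by exists (absz (n - (a + b + c))%R); lia.
rewrite (lmul_ltail fg hc (ltnSn k)) -[a + b + c]addrA.
rewrite (lmul_ltail fa gh (ltnSn k)).
transitivity ((ltail f a k.+1 * ltail g b k.+1 * ltail h c k.+1)`_k).
  rewrite -mulrA coefM [RHS]coefM; apply: eq_bigr => j _; congr (_ * _).
  rewrite coef_poly ltnS leq_subr.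
  by apply: lmul_ltail; rewrite ?ltnS ?leq_subr.
rewrite coefM [RHS]coefM; apply: eq_bigr => j _; congr (_ * _).
rewrite [RHS]coef_poly ifT; last exact: ltn_ord.
by apply/esym/lmul_ltail.
Qed.

Fact lmul1 : left_id lone lmul.
Proof.
move=> f; apply: laurentP => n /=; rewrite /lmul_coef.
rewrite (fsbigE [:: 0]) //= ?big_cons ?big_nil; last first.
  by move=> i _; rewrite inE => /negPf->; rewrite mul0r.
by rewrite in_setT eqxx mul1r subr0 addr0.
Qed.

Fact lmulDl : left_distributive lmul +%R.
Proof.
move=> f g h; have [a' fa'] := lcoefP f; have [b' gb'] := lcoefP g.
have [c hc] := lcoefP h; pose a := Num.min a' b'.
have fa : vanish_below a f by move=> n na; apply: fa'; lia.
have gb : vanish_below a g by move=> n na; apply: gb'; lia.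
have fga : vanish_below a (f + g) by move=> n na /=; rewrite fa ?gb ?addr0.
apply: laurentP => n; rewrite -[LHS]/(lmul_coef (f + g) h n).
rewrite -[RHS]/(lmul_coef f h n + lmul_coef g h n).
pose m := (absz (n - (a + c))%R).+1; have nm : n < a + c + m%:Z by rewrite /m; lia.
rewrite (lmul_coefE fga hc nm) (lmul_coefE fa hc nm) (lmul_coefE gb hc nm).
rewrite -big_split.
by apply: eq_bigr => j _; exact: mulrDl.
Qed.

Fact lone_neq0 : lone != 0.
Proof.
by apply/eqP => /(congr1 (fun f : laurent K => f 0)) /eqP; rewrite /= oner_eq0.
Qed.

HB.instance Definition _ := GRing.Zmodule_isComNzRing.Build (laurent K)
  lmulA lmulC lmul1 lmulDl lone_neq0.

Lemma laurent_neq0 f : f != 0 ->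
  exists a, f a != 0 /\ vanish_below a f.
Proof.
move=> f0; have [b fb] := lcoefP f.
have ex : exists k : nat, f (b + k%:Z) != 0.
  apply: contrapT => nex; case/eqP: f0; apply: laurentP => n /=.
  case: (ltP n b) => [/fb//|bn]; apply/eqP; apply: contrapT => /negP fn.
  by apply: nex; exists (absz (n - b)%R); have -> : b + (absz (n - b)%R)%:Z = n by lia.
case: (ex_minnP ex) => k fk kmin; exists (b + k%:Z); split=> // n nk.
case: (ltP n b) => [/fb//|bn]; apply/eqP; apply: contraTT nk => fn.
have := kmin (absz (n - b)%R); have -> : b + (absz (n - b)%R)%:Z = n by lia.
by move=> /(_ fn); lia.
Qed.

Fixpoint linv_coefs (u : nat -> K) (n : nat) : seq K :=
  if n is m.+1 then
    let s := linv_coefs u m in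
    rcons s ((u 0%N)^-1 * ((m == 0%N)%:R - \sum_(k < m) s`_k * u (m - k)%N))
  else [::].

Lemma linv_coefsP (u : nat -> K) : u 0%N != 0 ->
  exists v : nat -> K,
    forall n, \sum_(k < n.+1) v k * u (n - k)%N = (n == 0%N)%:R.
Proof.
move=> u0; have size_s n : size (linv_coefs u n) = n.
  by elim: n => //= n IH; rewrite size_rcons IH.
have nth_s n m k : (k < n)%N -> (n <= m)%N ->
    (linv_coefs u m)`_k = (linv_coefs u n)`_k.
  move=> kn; elim: m => [|m IH]; first by rewrite leqn0 => /eqP n0; lia.
  rewrite leq_eqVlt => /orP[/eqP->//|nm] /=.
  by rewrite nth_rcons size_s ifT ?IH //; lia.
exists (fun k => (linv_coefs u k.+1)`_k) => n.
rewrite big_ord_recr subnn.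
have -> : (linv_coefs u n.+1)`_n = (u 0%N)^-1 *
    ((n == 0%N)%:R - \sum_(k < n) (linv_coefs u n)`_k * u (n - k)%N).
  by rewrite /= nth_rcons size_s ltnn eqxx.
rewrite mulrAC mulVf // mul1r /= addrCA.
rewrite -[RHS]addr0; congr (_ + _); apply/eqP; rewrite subr_eq0; apply/eqP.
by apply: eq_bigr => k _; rewrite (nth_s k.+1 n).
Qed.

Lemma laurent_inv_ex f : f != 0 -> exists g, g * f = 1.
Proof.
move=> /laurent_neq0[a [fa0 fa]].
have [|v vP] := @linv_coefsP (fun k => f (a + k%:Z)); first by rewrite addr0.
pose w (n : int) : K := if 0 <= n + a then v (absz (n + a)%R) else 0.
have wa : vanish_below (- a) w by move=> n na; rewrite /w ifF //; lia.
have w_ex : exists b, vanish_below b w by exists (- a).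
exists (Laurent w_ex); apply: laurentP => n.
rewrite -[LHS]/(lmul_coef w f n) -[RHS]/((n == 0)%:R).
case: (ltP n 0) => n0.
  by rewrite (lmul_vanish wa fa); first case: eqVneq n0 => // ->; lia.
have [m ->] : exists m : nat, n = m%:Z by exists (absz n); lia.
rewrite (lmul_coefE (m := m.+1) wa fa); last lia.
rewrite -[RHS]/((m == 0%N)%:R) -vP; apply: eq_bigr => k _; congr (_ * _).
  by rewrite /w ifT; [congr v|]; lia.
by congr (lcoef f _); have := ltn_ord k; lia.
Qed.

Definition linv f : laurent K :=
  xget 0 [set g : laurent K | f != 0 /\ g * f = 1]%classic.

Fact lmulV f : f != 0 -> linv f * f = 1.
Proof.
move=> f0; have [g gf] := laurent_inv_ex f0; rewrite /linv.
by have [] := xgetI 0 (conj f0 gf : [set h | f != 0 /\ h * f = 1]%classic g).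
Qed.

Fact linv0 : linv 0 = 0.
Proof. by rewrite /linv; case: xgetP => // g _ []; rewrite eqxx. Qed.

HB.instance Definition _ := GRing.ComNzRing_isField.Build (laurent K)
  lmulV linv0.

End LaurentField.

Section LaurentOperations.
Variable K : fieldType.
Implicit Types (f : laurent K) (p : {poly K}).

Fact lpoly_subproof p :
  exists a, vanish_below a (fun n : int => if 0 <= n then p`_(absz n) else 0).
Proof. by exists 0 => n; rewrite ltNge => /negPf->. Qed.
Definition lpoly p : laurent K := Laurent (lpoly_subproof p).

Definition lconst (c : K) : laurent K := lpoly c%:P.
Definition lX : laurent K := lpoly 'X.

Fact lderiv_subproof f :
  exists a, vanish_below a (fun n => (n + 1)%:~R * f (n + 1)).
Proof.
have [a fa] := lcoefP f; exists (a - 1) => n na.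
by rewrite fa ?mulr0 // -ltrBrDr.
Qed.
Definition lderiv f : laurent K := Laurent (lderiv_subproof f).

Fact lsubst_pow_subproof (r : nat) f : exists a,
  vanish_below a (fun n => if (r %| n)%Z then f (n %/ r)%Z else 0).
Proof.
have [a fa] := lcoefP f; exists (Num.min 0 (a * r%:Z)) => n.
rewrite lt_min => /andP[n0 nar]; case: ifP => // /dvdzP[k nk].
case: (posnP r) => [r0|r0]; first by move: n0; rewrite nk r0 mulr0 ltxx.
move: nar; rewrite nk mulzK ?ltr_pM2r ?ltz_nat //; last by lia.
exact: fa.
Qed.
(* f(x^r), for r > 0 *)
Definition lsubst_pow (r : nat) f : laurent K :=
  Laurent (lsubst_pow_subproof r f).

Fact ltrunc_subproof (N : int) f :
  exists a, vanish_below a (fun n => if n <= N then f n else 0).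
Proof. by have [a fa] := lcoefP f; exists a => n /fa->; rewrite if_same. Qed.
Definition ltrunc (N : int) f : laurent K := Laurent (ltrunc_subproof N f).

(* The order valuation; xget picks the unique n with f_n <> 0 below which all
   coefficients vanish, which exists by laurent_neq0. *)
Definition lval f : \bar int :=
  if f == 0 then +oo%E
  else (xget 0 [set n | f n != 0 /\ vanish_below n f]%classic)%:E.

End LaurentOperations.

Arguments lX {K}.

Section Systems.
Variables (K : fieldType) (n : nat).
Implicit Types A P Q : 'M[laurent K]_n.

Definition mxval A : \bar int :=
  \big[Order.min/+oo%E]_(i < n) \big[Order.min/+oo%E]_(j < n) lval (A i j).

Definition mxcoef (k : int) A : 'M[K]_n := map_mx (fun f : laurent K => f k) A.

Definition singular A : Prop := (mxval A < 0%R%:E)%E.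

(* max(- nu(A) - 1, 0), with nu(0) = +oo giving 0 *)
Definition poincare_rank A : nat :=
  if mxval A is v%:E then absz (Num.max (- v - 1) 0) else 0%N.

Definition jet (N : nat) A : 'M[laurent K]_n :=
  if mxval A is v%:E then map_mx (ltrunc (v + N%:Z)) A else 0.

Definition gauge P A : 'M[laurent K]_n :=
  invmx P *m A *m P - invmx P *m map_mx (@lderiv K) P.

Definition ramification (r : nat) A : 'M[laurent K]_n :=
  (r%:R * lX ^+ r.-1) *: map_mx (lsubst_pow r) A.

Definition regular_gauge P : Prop :=
  mxval P = 0%R%:E /\ \det (mxcoef 0 P) != 0.

Definition polynomial_gauge P : Prop :=
  exists M : 'M[{poly K}]_n, P = map_mx (@lpoly K) M.

Definition diagonal_monomial_gauge P : Prop :=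
  exists k : 'I_n -> nat, P = diag_mx (\row_j lX ^+ k j).

Definition power_series_mx P : Prop :=
  forall i j, vanish_below 0 (P i j).

Definition gauge_composition (Ts : seq 'M[laurent K]_n) :
    'M[laurent K]_n -> 'M[laurent K]_n :=
  foldr (fun T psi => gauge T \o psi) id Ts.

End Systems.

Section RealForm.
Variable K : rcfType.

Definition Lambda (z : K[i]) : 'M[K]_2 :=
  \matrix_(a < 2, b < 2)
    if a == b then complex.Re z
    else if (a < b)%N then - complex.Im z else complex.Im z.

(* mxtens_unindex sends an index k < m * 2 to the pair (k %/ 2, k %% 2), i.e.
   to its block and its position inside the block. *)
Definition Theta (m : nat) (C : 'M[K[i]]_m) : 'M[K]_(m * 2) :=
  \matrix_(p, q) Lambda (C (mxtens_unindex p).1 (mxtens_unindex q).1)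
                        (mxtens_unindex p).2 (mxtens_unindex q).2.

Definition C_matrix (m : nat) (B : 'M[K]_(m * 2)) : Prop :=
  exists C : 'M[K[i]]_m, B = Theta C.

Fact lTheta_subproof (m : nat) (C : 'M[laurent K[i]]_m) p q :
  exists a, vanish_below a (fun k => Theta (mxcoef k C) p q).
Proof.
have [a Ca] := lcoefP (C (mxtens_unindex p).1 (mxtens_unindex q).1).
by exists a => k ka; rewrite !mxE Ca //= oppr0 !if_same.
Qed.
(* The coefficientwise extension of Theta. *)
Definition lTheta (m : nat) (C : 'M[laurent K[i]]_m) :
    'M[laurent K]_(m * 2) :=
  \matrix_(p, q) Laurent (lTheta_subproof C p q).

Definition real_poly (d : {poly K[i]}) : Prop :=
  exists p : {poly K}, d = map_poly (real_complex K) p.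

Section Blocks.
Variables (q n1 n2 : nat).
Variables (e : 'I_n1 -> {poly K}) (d : 'I_n2 -> {poly K[i]}).
Variables (C1 : 'M[K]_n1) (C2 : 'M[K]_(n2 * 2)).

Definition D1_mx : 'M[laurent K]_n1 := diag_mx (\row_j lpoly (e j)).

Definition D2_mx : 'M[laurent K]_(n2 * 2) :=
  lTheta (diag_mx (\row_j lpoly (d j))).

Definition TRS_part : 'M[laurent K]_(n1 + n2 * 2) :=
  block_mx D1_mx 0 0 D2_mx
  + lX ^+ q *: block_mx (map_mx (@lconst K) C1) 0 0 (map_mx (@lconst K) C2).

(* "degree at most q - 1, zero if q = 0" reads size <= q; for q = 0 the d_j are
   thus zero, so they are required not to be real only for q > 0. *)
Definition TRS_conditions : Prop :=
  [/\ forall j, (size (e j) <= q)%N,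
      forall j, (size (d j) <= q)%N /\ ((0 < q)%N -> ~ real_poly (d j)),
      C_matrix C2,
      comm_mx D1_mx (map_mx (@lconst K) C1)
    & comm_mx D2_mx (map_mx (@lconst K) C2)].

End Blocks.

(* Real Turrittin-Ramis-Sibuya form of degree mu; R is the O(x^(q+mu+1)). *)
Definition real_TRS_form (n mu : nat) (F : 'M[laurent K]_n) : Prop :=
  let q := poincare_rank F in
  exists (n1 n2 : nat) (eqn : (n1 + n2 * 2)%N = n)
         (e : 'I_n1 -> {poly K}) (d : 'I_n2 -> {poly K[i]})
         (C1 : 'M[K]_n1) (C2 : 'M[K]_(n2 * 2))
         (R : 'M[laurent K]_(n1 + n2 * 2)),
    [/\ TRS_conditions q e d C1 C2,
        ((q + mu).+1%:Z%:E <= mxval R)%E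
      & F = castmx (eqn, eqn) (lX ^- q.+1 *: (TRS_part q e d C1 C2 + R))].

End RealForm.

(* Main.v *)
Require Import Defs.
From HB Require Import structures.
From mathcomp Require Import all_boot all_order all_algebra.
From mathcomp Require Import perm complex mxtens zify ring.
From mathcomp Require Import boolp classical_sets fsbigop constructive_ereal.

Set Implicit Arguments.
Unset Strict Implicit.
Unset Printing Implicit Defensive.

Import Order.TTheory GRing.Theory Num.Theory.

Local Open Scope ring_scope.

(** Over the algebraic closure C = K(i) the theorem is that of Hukuhara, Levelt and
    Turrittin. Its core is eigenrow_exists: after ramification every system has an
    invariant submodule of rank one. In a module of minimal rank any nonzero vector is
    cyclic, so the system is a companion one, of trace zero after a twist. Ramification
    and a diagonal shearing read off its Newton polygon: either it is regular singular
    and Frobenius' method applies, or its leading matrix has two different eigenvalues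
    and splits the module (splitting_submodule). Iterating, the system becomes
    triangular, and solving scalar equations of rank one reduces it to D + R/x, where
    the diagonal matrix D of exponents commutes with the constant matrix R
    (complex_normal_form).

    The descent to K uses that the residues can be chosen with real parts in a fixed
    set of representatives modulo the integers. If P reduces a real system to this
    form, so does its conjugate, up to conjugating the form, and conj(P) P^-1 solves a
    system without integral resonances. Hence it is a constant matrix U, which matches
    each exponent with its conjugate (conj_cocycle). The map w |-> conj(w) U is a
    semilinear involution on constant rows; its fixed vectors give real solutions for
    the real exponents, and the real and imaginary parts of the solutions for one
    exponent out of each conjugate pair give the blocks of the form Theta
    (real_structure, real_normal_form).

    The shape of the transformation need not be followed through this reduction. A
    power of x, which shifts the residues by an integer, clears the denominators of P;
    and every invertible matrix over K((x)) with power series entries is a product of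
    regular polynomial and diagonal monomial matrices, up to a last factor Q with
    Q(0) = 1 (elementary_factorization). *)

(** * Laurent series *)

Section LaurentCoefficients.
Variable K : fieldType.
Implicit Types (f g h : laurent K) (c : K).

Lemma lcoefD f g n : (f + g) n = f n + g n. Proof. by []. Qed.
Lemma lcoefN f n : (- f) n = - f n. Proof. by []. Qed.
Lemma lcoefB f g n : (f - g) n = f n - g n. Proof. by []. Qed.
Lemma lcoef0 n : (0 : laurent K) n = 0. Proof. by []. Qed.
Lemma lcoef1 n : (1 : laurent K) n = (n == 0)%:R. Proof. by []. Qed.
Lemma lcoefM f g n : (f * g) n = lmul_coef f g n. Proof. by []. Qed.

Lemma lcoef_sum I (r : seq I) (P : pred I) (F : I -> laurent K) n :
  (\sum_(i <- r | P i) F i) n = \sum_(i <- r | P i) F i n.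
Proof. by elim/big_rec2: _ => // i x y _ <-. Qed.

Lemma lpolyE (p : {poly K}) n :
  lpoly p n = if 0 <= n then p`_(absz n) else 0.
Proof. by []. Qed.

Lemma lconstE (c : K) n : lconst c n = c *+ (n == 0).
Proof.
rewrite lpolyE coefC; case: (ltrgt0P n) => // n0.
  by rewrite absz_eq0; case: eqVneq n0 => // ->; rewrite ltxx.
by rewrite n0.
Qed.

(** Any finite list containing the support computes a coefficient of a product;
    this serves the substitution x |-> x^r, whose support is sparse. *)
Lemma lmul_coef_seq (u v : int -> K) n (s : seq int) : uniq s ->
    (forall i, u i * v (n - i) != 0 -> i \in s) ->
  lmul_coef u v n = \sum_(i <- s) u i * v (n - i).
Proof.
move=> us sP; rewrite /lmul_coef (fsbigE s) //.
  by apply: eq_bigl => i; rewrite in_setT.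
by move=> i _ /negP ni; apply: contraTeq isT => /sP.
Qed.

Lemma lcoefCM c f n : (lconst c * f) n = c * f n.
Proof.
rewrite lcoefM (lmul_coef_seq (s := [:: 0])) ?big_seq1 ?lconstE ?subr0 //.
by move=> i; rewrite lconstE inE; apply: contraNT => /negPf->; rewrite mulr0n mul0r.
Qed.

Lemma lcoefX n : (lX : laurent K) n = (n == 1)%:R.
Proof.
rewrite /lX lpolyE coefX; case: (ltP n 0) => n0; first by case: eqP => //; lia.
by congr (_ %:R); apply/eqP/eqP; lia.
Qed.

Lemma lcoefXM f n : (lX * f) n = f (n - 1).
Proof.
rewrite lcoefM (lmul_coef_seq (s := [:: 1])) ?big_seq1 ?lcoefX ?mul1r //.
by move=> i; rewrite lcoefX inE; apply: contraNT => /negPf->; rewrite mul0r.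
Qed.

Lemma lX_neq0 : (lX : laurent K) != 0.
Proof.
apply/eqP => /(congr1 (fun f : laurent K => f 1)).
by rewrite lcoefX => /eqP; rewrite oner_eq0.
Qed.

Lemma lcoefXzM f (k n : int) : (lX ^ k * f) n = f (n - k).
Proof.
have nat_case (i : nat) g m : (lX ^+ i * g) m = g (m - i%:Z).
  elim: i m => [|i IH] m; first by rewrite mul1r subr0.
  by rewrite exprS -mulrA lcoefXM IH; congr (lcoef g); lia.
case: k => k; first exact: nat_case.
have -> : n - Negz k = n + k.+1%:Z by lia.
rewrite -[LHS](_ : (lX ^+ k.+1 * (lX ^ (Negz k) * f)) (n + k.+1%:Z) = _).
  by rewrite mulrA divff ?mul1r // expf_neq0 ?lX_neq0.
by rewrite nat_case addrK.
Qed.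

Lemma lcoefXz (k n : int) : (lX ^ k : laurent K) n = (n == k)%:R.
Proof. by rewrite -[_ ^ _]mulr1 lcoefXzM lcoef1 subr_eq0. Qed.

Lemma lX_mulVz (k : int) : (lX ^ k * lX ^ (- k) : laurent K) = 1.
Proof. by rewrite -expfzDr ?lX_neq0 // subrr. Qed.

Fact lconst_is_zmod_morphism : zmod_morphism (@lconst K).
Proof.
by move=> a b; apply: laurentP => n; rewrite lcoefB !lconstE mulrnBl.
Qed.
Fact lconst_is_monoid_morphism : monoid_morphism (@lconst K).
Proof.
split=> [|a b]; apply: laurentP => n; first by rewrite lconstE.
by rewrite lcoefCM !lconstE mulrnAr.
Qed.
HB.instance Definition _ :=
  GRing.isZmodMorphism.Build K (laurent K) (@lconst K) lconst_is_zmod_morphism.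
HB.instance Definition _ := GRing.isMonoidMorphism.Build K (laurent K)
  (@lconst K) lconst_is_monoid_morphism.

Fact lderiv_is_zmod_morphism : zmod_morphism (@lderiv K).
Proof. by move=> f g; apply: laurentP => n /=; rewrite mulrBr. Qed.
HB.instance Definition _ := GRing.isZmodMorphism.Build (laurent K) (laurent K)
  (@lderiv K) lderiv_is_zmod_morphism.

Lemma lderivE f n : lderiv f n = (n + 1)%:~R * f (n + 1).
Proof. by []. Qed.

Lemma lderivM f g : lderiv (f * g) = lderiv f * g + f * lderiv g.
Proof.
have [[a fa] [b gb]] := (lcoefP f, lcoefP g).
have f'a : vanish_below (a - 1) (lderiv f).
  by move=> i ia; rewrite lderivE fa ?mulr0 //; lia.
have g'b : vanish_below (b - 1) (lderiv g).
  by move=> i ia; rewrite lderivE gb ?mulr0 //; lia.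
apply: laurentP => n; rewrite lderivE lcoefD !lcoefM.
pose m := (absz (n + 1 - (a + b))%R).+1.
rewrite (lmul_coefE (m := m) fa gb) ?(lmul_coefE (m := m) f'a gb)
        ?(lmul_coefE (m := m) fa g'b); try by rewrite /m; lia.
rewrite mulr_sumr -big_split /=; apply: eq_bigr => k _.
have -> : n + 1 - (a + k%:Z) = n - (a - 1 + k%:Z) by lia.
have -> : a - 1 + k%:Z + 1 = a + k%:Z by lia.
have -> : n - (a + k%:Z) + 1 = n - (a - 1 + k%:Z) by lia.
have -> : n + 1 = (a + k%:Z) + (n - (a - 1 + k%:Z)) by lia.
by rewrite intrD; ring.
Qed.

Lemma lderiv_const c : lderiv (lconst c) = 0.
Proof.
apply: laurentP => n; rewrite lderivE lconstE.
by case: eqP => [->|_]; rewrite ?mul0r ?mulr0.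
Qed.

Lemma lderivCM c f : lderiv (lconst c * f) = lconst c * lderiv f.
Proof. by rewrite lderivM lderiv_const mul0r add0r. Qed.

Lemma lderiv1 : lderiv (1 : laurent K) = 0.
Proof. by rewrite -(rmorph1 (@lconst K)) lderiv_const. Qed.

Lemma lderivXz (k : int) : lderiv (lX ^ k : laurent K) = k%:~R * lX ^ (k - 1).
Proof.
have -> : (k%:~R : laurent K) = lconst k%:~R by rewrite rmorph_int.
apply: laurentP => n; rewrite lderivE lcoefCM !lcoefXz.
by rewrite -subr_eq0 -[in RHS]subr_eq0 opprB addrA;
  case: eqP => [e|]; rewrite ?mulr0 //; congr (_%:~R * _); lia.
Qed.

Variables (r : nat) (r_gt0 : (0 < r)%N).

Lemma lsubst_powE f n : lsubst_pow r f (r%:Z * n) = f n.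
Proof. by rewrite /= dvdz_mulr // mulKz //; lia. Qed.

Lemma lsubst_pow_ndvd f n : ~~ (r %| n)%Z -> lsubst_pow r f n = 0.
Proof. by rewrite /= => /negPf->. Qed.

Fact lsubst_pow_is_zmod_morphism : zmod_morphism (@lsubst_pow K r).
Proof.
move=> f g; apply: laurentP => n; rewrite lcoefB /=.
by case: ifP => // _; rewrite subr0.
Qed.

Fact lsubst_pow_is_monoid_morphism : monoid_morphism (@lsubst_pow K r).
Proof.
split=> [|f g]; apply: laurentP => n.
  have [/dvdzP[k ->]|nr] := boolP (r %| n)%Z.
    rewrite [k * _]mulrC lsubst_powE !lcoef1 mulf_eq0 orb_idl //.
    by case/eqP; lia.
  rewrite lsubst_pow_ndvd // lcoef1; case: eqP nr => // ->.
  by rewrite dvdz0.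
rewrite [RHS]lcoefM.
have [/dvdzP[k ->]|nr] := boolP (r %| n)%Z; last first.
  rewrite lsubst_pow_ndvd // (lmul_coef_seq (s := [::])) ?big_nil // => i nz.
  have [ri|ri] := boolP (r %| i)%Z; last first.
    by move: nz; rewrite lsubst_pow_ndvd // mul0r eqxx.
  move: nz; rewrite [X in _ * X]lsubst_pow_ndvd ?mulr0 ?eqxx //.
  by apply: contraNN nr => h; rewrite -(subrK i n) rpredD.
have [[a fa] [b gb]] := (lcoefP f, lcoefP g).
pose m := (absz (k - (a + b))%R).+1.
rewrite [k * _]mulrC lsubst_powE lcoefM.
rewrite [RHS](lmul_coef_seq (s := [seq r%:Z * (a + i%:Z) | i <- iota 0 m]));
  first last.
- move=> i nz; have [ri|ri] := boolP (r %| i)%Z; last first.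
    by move: nz; rewrite lsubst_pow_ndvd // mul0r eqxx.
  move: ri nz => /dvdzP[j ->]; rewrite [j * _]mulrC -mulrBr !lsubst_powE => nz.
  have ja : a <= j by rewrite leNgt; apply: contraNN nz => /fa->; rewrite mul0r.
  have lb : b <= k - j.
    by rewrite leNgt; apply: contraNN nz => /gb->; rewrite mulr0.
  apply/mapP; exists (absz (j - a)%R); last by congr (_ * _); lia.
  by rewrite mem_iota /m; lia.
- by rewrite map_inj_uniq ?iota_uniq // => i j; nia.
rewrite big_map (lmul_coefE (m := m) fa gb); last by rewrite /m; lia.
rewrite -(big_mkord predT (fun i => f (a + i%:Z) * g (k - (a + i%:Z)))).
rewrite /index_iota subn0.
by apply: eq_bigr => i _; rewrite -mulrBr !lsubst_powE.
Qed.

End LaurentCoefficients.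

Section LaurentSubstitution.
Variables (K : fieldType) (r : nat) (r_gt0 : (0 < r)%N).
Implicit Types f g h : laurent K.

HB.instance Definition _ := GRing.isZmodMorphism.Build (laurent K) (laurent K)
  (@lsubst_pow K r) (@lsubst_pow_is_zmod_morphism K r).

Lemma lsubst_powM f g :
  lsubst_pow r (f * g) = lsubst_pow r f * lsubst_pow r g.
Proof. by case: (lsubst_pow_is_monoid_morphism K r_gt0) => _ ->. Qed.

Lemma lsubst_pow1 : lsubst_pow r (1 : laurent K) = 1.
Proof. by case: (lsubst_pow_is_monoid_morphism K r_gt0). Qed.

Lemma lsubst_powXz (k : int) : lsubst_pow r (lX ^ k) = lX ^ (r%:Z * k) :> laurent K.
Proof.
apply: laurentP => n; have [/dvdzP[l ->]|nr] := boolP (r %| n)%Z.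
  rewrite [l * _]mulrC lsubst_powE // !lcoefXz; congr (_ %:R).
  by apply/eqP/eqP; nia.
rewrite lsubst_pow_ndvd // lcoefXz; case: eqP => // e.
by move: nr; rewrite e dvdz_mulr.
Qed.

Lemma lsubst_pow_const (c : K) : lsubst_pow r (lconst c) = lconst c.
Proof.
apply: laurentP => n; have [/dvdzP[l ->]|nr] := boolP (r %| n)%Z.
  rewrite [l * _]mulrC lsubst_powE // !lconstE; congr (_ *+ _).
  by apply/eqP/eqP; nia.
by rewrite lsubst_pow_ndvd // lconstE; case: eqP nr => // ->; rewrite dvdz0.
Qed.

Lemma lderiv_subst_pow f :
  lderiv (lsubst_pow r f) = r%:R * lX ^+ r.-1 * lsubst_pow r (lderiv f).
Proof.
have -> : (r%:R : laurent K) = lconst r%:R by rewrite rmorph_nat.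
apply: laurentP => n.
rewrite lderivE -mulrA lcoefCM exprnP lcoefXzM.
have [/dvdzP[k nk]|nr] := boolP (r %| n + 1)%Z.
  rewrite nk [k * _]mulrC lsubst_powE //.
  have -> : n - r.-1%:Z = r%:Z * (k - 1) by nia.
  by rewrite lsubst_powE // lderivE subrK intrM mulrA.
rewrite !lsubst_pow_ndvd ?mulr0 //.
have -> : n - r.-1%:Z = n + 1 - r%:Z * 1 by lia.
by apply: contraNN nr => h; rewrite -(subrK (r%:Z * 1) (n + 1)) rpredD ?dvdz_mulr.
Qed.

End LaurentSubstitution.

Lemma lsubst_pow_comp (K : fieldType) r s (f : laurent K) :
  (0 < r)%N -> (0 < s)%N ->
  lsubst_pow r (lsubst_pow s f) = lsubst_pow (r * s) f.
Proof.
move=> r0 s0; apply: laurentP => n.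
have [/dvdzP[k ->]|nr] := boolP (r %| n)%Z; last first.
  rewrite lsubst_pow_ndvd // lsubst_pow_ndvd //.
  by apply: contraNN nr; apply: dvdz_trans; rewrite PoszM dvdz_mulr.
rewrite [k * _]mulrC lsubst_powE //.
have [/dvdzP[l ->]|nr] := boolP (s %| k)%Z.
  by rewrite [l * _]mulrC lsubst_powE // mulrA -PoszM lsubst_powE // muln_gt0 r0.
by rewrite !lsubst_pow_ndvd // PoszM dvdz_mul2l //; lia.
Qed.

Section LaurentMap.
Variables (K K' : fieldType) (phi : {rmorphism K -> K'}).
Implicit Types f g h : laurent K.

Fact lmap_subproof f : exists a, vanish_below a (fun n => phi (f n)).
Proof. by have [a fa] := lcoefP f; exists a => n /fa->; rewrite rmorph0. Qed.
Definition lmap f : laurent K' := Laurent (lmap_subproof f).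

Lemma lmapE f n : lmap f n = phi (f n). Proof. by []. Qed.

Fact lmap_is_zmod_morphism : zmod_morphism lmap.
Proof. by move=> f g; apply: laurentP => n; rewrite lcoefB !lmapE rmorphB. Qed.
Fact lmap_is_monoid_morphism : monoid_morphism lmap.
Proof.
split=> [|f g]; apply: laurentP => n; first by rewrite lmapE !lcoef1 rmorph_nat.
have [[a fa] [b gb]] := (lcoefP f, lcoefP g).
have fa' : vanish_below a (lmap f) by move=> i /fa; rewrite lmapE => ->;
  exact: rmorph0.
have gb' : vanish_below b (lmap g) by move=> i /gb; rewrite lmapE => ->;
  exact: rmorph0.
rewrite lmapE !lcoefM; pose m := (absz (n - (a + b))%R).+1.
rewrite (lmul_coefE (m := m) fa gb) ?(lmul_coefE (m := m) fa' gb'); try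
  by rewrite /m; lia.
by rewrite rmorph_sum; apply: eq_bigr => i _; rewrite rmorphM.
Qed.
HB.instance Definition _ := GRing.isZmodMorphism.Build (laurent K) (laurent K')
  lmap lmap_is_zmod_morphism.
HB.instance Definition _ := GRing.isMonoidMorphism.Build (laurent K) (laurent K')
  lmap lmap_is_monoid_morphism.

Lemma lmap_const c : lmap (lconst c) = lconst (phi c).
Proof. by apply: laurentP => n; rewrite lmapE !lconstE rmorphMn. Qed.

Lemma lmapX : lmap lX = lX.
Proof. by apply: laurentP => n; rewrite lmapE !lcoefX rmorph_nat. Qed.

Lemma lmapXz (k : int) : lmap (lX ^ k) = lX ^ k.
Proof. by apply: laurentP => n; rewrite lmapE !lcoefXz rmorph_nat. Qed.

Lemma lmap_deriv f : lmap (lderiv f) = lderiv (lmap f).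
Proof. by apply: laurentP => n; rewrite lmapE !lderivE rmorphM rmorph_int. Qed.

Lemma lmap_subst_pow r f : lmap (lsubst_pow r f) = lsubst_pow r (lmap f).
Proof. by apply: laurentP => n; rewrite lmapE /=; case: ifP; rewrite ?rmorph0. Qed.

End LaurentMap.

(** * The x-adic filtration *)

Section Filtration.
Variable K : fieldType.
Local Notation L := (laurent K).
Implicit Types (f g : L) (a b : int).

Lemma vanish_le a b f : b <= a -> vanish_below a f -> vanish_below b f.
Proof. by move=> ba fa n nb; apply: fa; apply: lt_le_trans ba. Qed.

Lemma vanishD a f g : vanish_below a f -> vanish_below a g -> vanish_below a (f + g).
Proof. by move=> fa ga n na; rewrite lcoefD fa ?ga ?addr0. Qed.

Lemma vanishN a f : vanish_below a f -> vanish_below a (- f).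
Proof. by move=> fa n na; rewrite lcoefN fa ?oppr0. Qed.

Lemma vanish_sum I (r : seq I) (P : pred I) (F : I -> L) a :
  (forall i, P i -> vanish_below a (F i)) ->
  vanish_below a (\sum_(i <- r | P i) F i).
Proof. by move=> Fa n na; rewrite lcoef_sum big1 // => i Pi; apply: Fa. Qed.

Lemma vanishM a b f g :
  vanish_below a f -> vanish_below b g -> vanish_below (a + b) (f * g).
Proof. exact: lmul_vanish. Qed.

Lemma vanishXz (k : int) : vanish_below k (lX ^ k : L).
Proof. by move=> n nk; rewrite lcoefXz; case: eqP => // e; move: nk;
  rewrite e ltxx. Qed.

Lemma vanish_const c : vanish_below 0 (@lconst K c).
Proof. by move=> n n0; rewrite lconstE; case: eqP => // e; move: n0;
  rewrite e ltxx. Qed.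

Lemma vanish_deriv a f : vanish_below a f -> vanish_below (a - 1) (lderiv f).
Proof. by move=> fa n na; rewrite lderivE fa ?mulr0 //; lia. Qed.

Lemma vanish_int a f : (forall k : nat, vanish_below (a + k%:Z) f) -> f = 0.
Proof.
move=> fa; apply: laurentP => n; rewrite lcoef0.
by apply: (fa (absz (n - a)%R).+1); lia.
Qed.

Lemma lcoefM_lead a b f g : vanish_below a f -> vanish_below b g ->
  (f * g) (a + b) = f a * g b.
Proof.
move=> fa gb; rewrite lcoefM (lmul_coefE (m := 1) fa gb); last lia.
by rewrite big_ord1 addr0; congr (_ * g _); lia.
Qed.

Definition mxvanish (m n : nat) a (X : 'M[L]_(m, n)) : Prop :=
  forall i j, vanish_below a (X i j).

Section Matrices.
Variables m n p : nat.
Implicit Types X Y : 'M[L]_(m, n).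

Lemma mxvanish_le a b X : b <= a -> mxvanish a X -> mxvanish b X.
Proof. by move=> ba Xa i j; apply: vanish_le (Xa i j). Qed.

Lemma mxvanish0 a : mxvanish a (0 : 'M[L]_(m, n)).
Proof. by move=> i j; rewrite mxE. Qed.

Lemma mxvanishD a X Y : mxvanish a X -> mxvanish a Y -> mxvanish a (X + Y).
Proof. by move=> Xa Ya i j; rewrite mxE; apply: vanishD. Qed.

Lemma mxvanishN a X : mxvanish a X -> mxvanish a (- X).
Proof. by move=> Xa i j; rewrite mxE; apply: vanishN. Qed.

Lemma mxvanishB a X Y : mxvanish a X -> mxvanish a Y -> mxvanish a (X - Y).
Proof. by move=> Xa Ya; apply/mxvanishD/mxvanishN. Qed.

Lemma mxvanishM a b X (Y : 'M[L]_(n, p)) :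
  mxvanish a X -> mxvanish b Y -> mxvanish (a + b) (X *m Y).
Proof. by move=> Xa Yb i j; rewrite mxE; apply: vanish_sum => k _;
  apply: vanishM. Qed.

Lemma mxvanishZ a b f X :
  vanish_below a f -> mxvanish b X -> mxvanish (a + b) (f *: X).
Proof. by move=> fa Xb i j; rewrite mxE; apply: vanishM. Qed.

Lemma mxvanish_const (M : 'M[K]_(m, n)) : mxvanish 0 (map_mx (@lconst K) M).
Proof. by move=> i j; rewrite mxE; apply: vanish_const. Qed.

Lemma mxvanish_deriv a X : mxvanish a X -> mxvanish (a - 1) (map_mx (@lderiv K) X).
Proof. by move=> Xa i j; rewrite mxE; apply: vanish_deriv. Qed.

Lemma mxvanish_int a X : (forall k : nat, mxvanish (a + k%:Z) X) -> X = 0.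
Proof.
by move=> Xa; apply/matrixP => i j; rewrite mxE; apply: (@vanish_int a) => k;
  apply: Xa.
Qed.

(** The iterates of Phi from 0 stabilise coefficient by coefficient. Most
    formal recursions below, linear or not, are instances of this. *)
Lemma contraction_fixpoint a (Phi : 'M[L]_(m, n) -> 'M[L]_(m, n)) :
    (forall X, mxvanish a X -> mxvanish a (Phi X)) ->
    (forall X Y N, a <= N -> mxvanish a X -> mxvanish a Y ->
       mxvanish N (X - Y) -> mxvanish (N + 1) (Phi X - Phi Y)) ->
  exists X, mxvanish a X /\ Phi X = X.
Proof.
move=> Phia Phi_contr; pose S k := iter k Phi 0.
have Sa k : mxvanish a (S k) by elim: k => [|k IH]; [exact: mxvanish0 | exact: Phia].
have Sstep k : mxvanish (a + k%:Z) (S k.+1 - S k).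
  elim: k => [|k IH]; first by rewrite addr0; apply: mxvanishB.
  by apply: mxvanish_le (Phi_contr _ _ _ _ _ _ IH); rewrite ?lerDl //; lia.
have Sadd k l : mxvanish (a + k%:Z) (S (k + l)%N - S k).
  elim: l => [|l IH]; first by rewrite addn0 subrr; apply: mxvanish0.
  rewrite addnS -(subrK (S (k + l)%N) (S _.+1)) -addrA; apply: mxvanishD => //.
  by apply: mxvanish_le (Sstep _); lia.
(* the coefficient of x^l is final after l - a + 1 iterations *)
pose x i j (l : int) : K := if l < a then 0 else S (absz (l - a)%R).+1 i j l.
have x_ok i j : exists b, vanish_below b (x i j) by exists a => l la; rewrite /x la.
pose X : 'M[L]_(m, n) := \matrix_(i, j) Laurent (x_ok i j).
have Xa : mxvanish a X by move=> i j l la; rewrite mxE /= /x la.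
have XS k : mxvanish (a + k%:Z) (X - S k).
  move=> i j l lk; rewrite !mxE lcoefB /= /x; case: ifP => la.
    by rewrite Sa ?subr0.
  rewrite -[LHS]opprB.
  have := Sadd (absz (l - a)%R).+1 (k - (absz (l - a)%R).+1)%N i j l.
  rewrite subnKC; last by lia.
  rewrite !mxE lcoefB => -> //; first exact: oppr0.
  by lia.
exists X; split=> //; apply/eqP; rewrite -subr_eq0; apply/eqP.
apply: (@mxvanish_int (a + 1)) => k.
have -> : Phi X - X = (Phi X - S k.+1) - (X - S k.+1) by rewrite opprB addrA subrK.
have aN : a <= a + k%:Z by lia.
apply: mxvanishB; first by rewrite addrAC; exact: Phi_contr aN Xa (Sa k) (XS k).
by apply: mxvanish_le (XS k.+1); lia.
Qed.

End Matrices.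

Lemma mxvanish1 n : mxvanish 0 (1%:M : 'M[L]_n).
Proof. by move=> i j; rewrite mxE; case: eqP => _ //; rewrite -(rmorph1 (@lconst K));
  apply: vanish_const. Qed.

End Filtration.

(** * Connections and gauge transformations *)

Section Connection.
Variable K : fieldType.
Local Notation L := (laurent K).

Notation mxderiv := (map_mx (@lderiv K)).

Lemma mxderivM m n p (X : 'M[L]_(m, n)) (Y : 'M[L]_(n, p)) :
  mxderiv (X *m Y) = mxderiv X *m Y + X *m mxderiv Y.
Proof.
apply/matrixP => i j; rewrite !mxE raddf_sum -big_split /=.
by apply: eq_bigr => k _; rewrite !mxE lderivM.
Qed.

Lemma mxderiv_const m n (M : 'M[K]_(m, n)) : mxderiv (map_mx (@lconst K) M) = 0.
Proof. by apply/matrixP => i j; rewrite !mxE lderiv_const. Qed.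

Lemma mxderiv1 n : mxderiv (1%:M : 'M[L]_n) = 0.
Proof. by rewrite -(map_mx1 (@lconst K)) mxderiv_const. Qed.

Lemma mxderivZ m n (f : L) (X : 'M[L]_(m, n)) :
  mxderiv (f *: X) = lderiv f *: X + f *: mxderiv X.
Proof. by apply/matrixP => i j; rewrite !mxE lderivM. Qed.

Lemma mxderivV n (P : 'M[L]_n) : P \in unitmx ->
  mxderiv (invmx P) = - (invmx P *m mxderiv P *m invmx P).
Proof.
move=> Pu; have := mxderivM (invmx P) P; rewrite mulVmx // mxderiv1.
move=> /esym/eqP; rewrite addrC addr_eq0 => /eqP e.
by rewrite e mulNmx opprK mulmxK.
Qed.

(** Systems act on rows here: nabla G v = 0 says that v^T solves Y' = G^T Y. This
    is the convention of the row spaces of matrices. *)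
Definition nabla m n (G : 'M[L]_n) (X : 'M[L]_(m, n)) : 'M[L]_(m, n) :=
  X *m G - mxderiv X.

(** For square invertible X this is gauge equivalence, see gauge_intertwines; a
    row free X with fewer rows than columns parametrises a submodule. Keeping both
    under one notion makes them compose. *)
Definition intertwines m n (B : 'M[L]_m) (G : 'M[L]_n) (X : 'M[L]_(m, n)) :=
  nabla G X = B *m X.

Lemma nablaM m n p (G : 'M[L]_n) (X : 'M[L]_(m, n)) (Y : 'M[L]_(p, m)) :
  nabla G (Y *m X) = Y *m nabla G X - mxderiv Y *m X.
Proof. by rewrite /nabla mxderivM mulmxBr mulmxA opprD addrA addrAC. Qed.

Lemma nablaZ m n (G : 'M[L]_n) (f : L) (X : 'M[L]_(m, n)) :
  nabla G (f *: X) = f *: nabla G X - lderiv f *: X.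
Proof. by rewrite /nabla mxderivZ scalerBr -scalemxAl opprD addrA addrAC. Qed.

Lemma nabla_const m n p (G : 'M[L]_n) (X : 'M[L]_(m, n)) (Y : 'M[K]_(p, m)) :
  nabla G (map_mx (@lconst K) Y *m X) = map_mx (@lconst K) Y *m nabla G X.
Proof. by rewrite nablaM mxderiv_const mul0mx subr0. Qed.

Lemma intertwines_comp m n p (G : 'M[L]_n) (B : 'M[L]_m) (C : 'M[L]_p) X Y :
  intertwines B G X -> intertwines C B Y -> intertwines C G (Y *m X).
Proof.
by rewrite /intertwines => GX BY; rewrite nablaM GX !mulmxA -mulmxBl -/(nabla B Y) BY.
Qed.

Lemma intertwines_twist m n (G : 'M[L]_n) (B : 'M[L]_m) X (h : L) :
  intertwines B G X -> intertwines (B + h%:M) (G + h%:M) X.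
Proof.
rewrite /intertwines /nabla mulmxDl mulmxDr => <-.
by rewrite mul_mx_scalar mul_scalar_mx addrAC.
Qed.

Lemma intertwines_unit n (G P : 'M[L]_n) : P \in unitmx ->
  intertwines (nabla G P *m invmx P) G P.
Proof. by move=> Pu; rewrite /intertwines mulmxKV. Qed.

Lemma intertwines_uniq n (G B P : 'M[L]_n) : P \in unitmx ->
  intertwines B G P -> B = nabla G P *m invmx P.
Proof. by move=> Pu ->; rewrite mulmxK. Qed.

Lemma intertwines_inv n (B G P : 'M[L]_n) : P \in unitmx ->
  intertwines B G P -> intertwines G B (invmx P).
Proof.
move=> Pu e; rewrite /intertwines /nabla mxderivV // opprK.
apply: (can_inj (mulmxK Pu)); rewrite mulmxDl (mulmxKV Pu) (mulmxKV Pu G).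
by rewrite -mulmxA -mulmxDr -e /nabla subrK (mulKmx Pu).
Qed.

Lemma mulmx_gauge n (A P : 'M[L]_n) : P \in unitmx ->
  P *m gauge P A = A *m P - mxderiv P.
Proof.
by move=> Pu; rewrite /gauge -mulmxA mulmxBr (mulKVmx Pu) (mulKVmx Pu).
Qed.

Lemma gauge_intertwines n (A P : 'M[L]_n) : P \in unitmx ->
  intertwines (gauge P A)^T A^T P^T.
Proof.
move=> Pu; rewrite /intertwines /nabla -[RHS]trmx_mul (mulmx_gauge A Pu).
by rewrite [RHS]linearB /= trmx_mul map_trmx.
Qed.

Lemma gauge_comp n (A P Q : 'M[L]_n) : P \in unitmx -> Q \in unitmx ->
  gauge Q (gauge P A) = gauge (P *m Q) A.
Proof.
move=> Pu Qu; have PQu : P *m Q \in unitmx by rewrite unitmx_mul Pu.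
apply: trmx_inj; apply: (can_inj (mulmxK (_ : (P *m Q)^T \in unitmx))).
  by rewrite unitmx_tr.
rewrite -[RHS](gauge_intertwines A PQu) trmx_mul.
by rewrite -(intertwines_comp (gauge_intertwines A Pu) (gauge_intertwines _ Qu)).
Qed.

Lemma gauge_uniq n (A B P : 'M[L]_n) : P \in unitmx ->
  intertwines B A^T P^T -> gauge P A = B^T.
Proof.
move=> Pu e; apply: trmx_inj; rewrite trmxK.
apply: (can_inj (mulmxK (_ : P^T \in unitmx))); first by rewrite unitmx_tr.
by rewrite -(gauge_intertwines A Pu) e.
Qed.

Section Ramification.
Variables (r : nat) (r_gt0 : (0 < r)%N).
Notation subst := (map_mx (@lsubst_pow K r)).

Lemma subst_mxM m n p (X : 'M[L]_(m, n)) (Y : 'M[L]_(n, p)) :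
  subst (X *m Y) = subst X *m subst Y.
Proof.
apply/matrixP => i j; rewrite !mxE raddf_sum /=.
by apply: eq_bigr => k _; rewrite !mxE lsubst_powM.
Qed.

Lemma subst_mx1 n : subst (1%:M : 'M[L]_n) = 1%:M.
Proof. by apply/matrixP => i j; rewrite !mxE; case: eqP => _;
  rewrite ?raddf0 ?lsubst_pow1. Qed.

Lemma subst_unitmx n (P : 'M[L]_n) : P \in unitmx -> subst P \in unitmx.
Proof.
by move=> Pu; have/mulmx1_unit[] : subst P *m subst (invmx P) = 1%:M
  by rewrite -subst_mxM mulmxV // subst_mx1.
Qed.

Lemma ramificationE n (G : 'M[L]_n) :
  ramification r G = (r%:R * lX ^+ r.-1) *: subst G.
Proof. by []. Qed.

Lemma nabla_ramification m n (G : 'M[L]_n) (X : 'M[L]_(m, n)) :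
  nabla (ramification r G) (subst X) = (r%:R * lX ^+ r.-1) *: subst (nabla G X).
Proof.
rewrite /nabla ramificationE -scalemxAr -subst_mxM raddfB /= scalerBr.
by congr (_ - _); apply/matrixP => i j; rewrite !mxE lderiv_subst_pow.
Qed.

Lemma intertwines_ramification m n (G : 'M[L]_n) (B : 'M[L]_m) X :
  intertwines B G X ->
  intertwines (ramification r B) (ramification r G) (subst X).
Proof.
by rewrite /intertwines nabla_ramification ramificationE => ->;
  rewrite subst_mxM scalemxAl.
Qed.

Lemma ramificationD n (G H : 'M[L]_n) :
  ramification r (G + H) = ramification r G + ramification r H.
Proof. by rewrite !ramificationE raddfD scalerDr. Qed.

Lemma ramification_scalar n (h : L) :
  ramification r (h%:M : 'M[L]_n) = (r%:R * lX ^+ r.-1 * lsubst_pow r h)%:M.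
Proof.
apply/matrixP => i j; rewrite !mxE; case: eqP => _; rewrite ?mulr1n //.
by rewrite raddf0 mulr0.
Qed.

End Ramification.

Lemma ramification_comp n r s (G : 'M[L]_n) : (0 < r)%N -> (0 < s)%N ->
  ramification r (ramification s G) = ramification (s * r) G.
Proof.
move=> r0 s0; apply/matrixP => i j; rewrite !mxE !lsubst_powM // lsubst_pow_comp //.
rewrite [(s * r)%N]mulnC !mulrA; congr (_ * _).
have -> : lsubst_pow r (s%:R : L) = s%:R.
  by rewrite -(rmorph_nat (@lconst K)) lsubst_pow_const.
rewrite !exprnP lsubst_powXz //.
transitivity ((r%:R * s%:R : L) * (lX ^ r.-1%:Z * lX ^ (r%:Z * s.-1%:Z))).
  by rewrite !mulrA; congr (_ * _); rewrite mulrAC.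
rewrite -natrM; congr (_ * _); rewrite -expfzDr ?lX_neq0 //; congr (_ ^ _).
by nia.
Qed.

Lemma ramification1 n (G : 'M[L]_n) : ramification 1 G = G.
Proof.
apply/matrixP => i j; rewrite !mxE expr0 mulr1 mul1r.
by apply: laurentP => k; have := lsubst_powE (ltn0Sn 0) (G i j) k; rewrite mul1r.
Qed.

End Connection.

Notation mxderiv := (map_mx (@lderiv _)).

(** * Linear algebra over a field *)

Lemma mxexpS (R : pzRingType) n (M : 'M[R]_n) k : M ^+ k.+1 = M *m M ^+ k.
Proof. exact: exprS. Qed.

Lemma mxexpSr (R : pzRingType) n (M : 'M[R]_n) k : M ^+ k.+1 = M ^+ k *m M.
Proof. exact: exprSr. Qed.

Lemma mxexp0 (R : pzRingType) n (M : 'M[R]_n) : M ^+ 0 = 1%:M.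
Proof. exact: expr0. Qed.

Section LinearAlgebra.
Variable F : fieldType.

(** The Gaussian elimination of X already contains the missing rows. *)
Lemma complete_row_free m p (X : 'M[F]_(m, m + p)) : row_free X ->
  exists Y : 'M[F]_(p, m + p), col_mx X Y \in unitmx.
Proof.
move=> /eqP rX; pose P := block_mx (col_ebase X) 0 0 1%:M *m row_ebase X.
exists (dsubmx P); suff -> : X = usubmx P.
  rewrite vsubmxK unitmx_mul row_ebase_unit andbT unitmxE det_ublock.
  by rewrite det1 mulr1 -unitmxE col_ebase_unit.
rewrite -[LHS]mulmx_ebase rX /P -[row_ebase X]vsubmxK mul_block_col.
rewrite col_mxKu mul0mx addr0.
have -> : pid_mx m = row_mx 1%:M 0 :> 'M[F]_(m, m + p).
  by rewrite pid_mx_row.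
by rewrite -mulmxA mul_row_col mul1mx mul0mx addr0.
Qed.

Lemma row_free_split m n (X : 'M[F]_(m, n)) : row_free X ->
  exists (Y : 'M[F]_(n - m, n)) (W : 'M[F]_(n, m + (n - m))),
    col_mx X Y *m W = 1%:M /\ W *m col_mx X Y = 1%:M.
Proof.
move=> rX; have mn : (m <= n)%N by rewrite -(eqP rX) rank_leq_col.
have := subnKC mn; move: (n - m)%N => p en; move: X rX.
rewrite -en => X /complete_row_free[Y XY].
by exists Y, (invmx (col_mx X Y)); rewrite mulmxV ?mulVmx.
Qed.

Lemma unitmx_inj n (M : 'M[F]_n) :
  (forall v : 'rV_n, v *m M = 0 -> v = 0) -> M \in unitmx.
Proof. by move=> /inj_row_free; rewrite row_free_unit. Qed.

Lemma unitmx_not_eigenvalue n (M : 'M[F]_n) c :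
  ~~ eigenvalue M c -> M - c%:M \in unitmx.
Proof.
move=> nev; apply: unitmx_inj => v; rewrite mulmxBr mul_mx_scalar.
move=> /eqP; rewrite subr_eq0 => /eqP vM; apply: contraNeq nev => v0.
by apply/eigenvalueP; exists v.
Qed.

Lemma mulmx_exp m n (X : 'M[F]_(m, n)) (B : 'M[F]_m) (M : 'M[F]_n) k :
  X *m M = B *m X -> X *m (M ^+ k) = (B ^+ k) *m X.
Proof.
move=> e; elim: k => [|k IH]; first by rewrite !mxexp0 mulmx1 mul1mx.
by rewrite mxexpSr mxexpS mulmxA IH -mulmxA e mulmxA -mxexpSr -mxexpS.
Qed.

(** Fitting's decomposition: once the ranks of the powers of M are stable, M is
    nilpotent on the kernel of such a power and invertible modulo that kernel. *)
Lemma fitting n (M : 'M[F]_n) : M \notin unitmx ->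
    (forall k, M ^+ k != 0) ->
  exists m p (Z : 'M[F]_(m + p, n)) (W : 'M[F]_(n, m + p))
         (B : 'M[F]_m) (E : 'M[F]_(p, m)) (C : 'M[F]_p) (N : nat),
    [/\ (m + p = n)%N, (0 < m < n)%N,
        Z *m W = 1%:M /\ W *m Z = 1%:M,
        Z *m M *m W = block_mx B 0 E C
      & B ^+ N = 0 /\ C \in unitmx].
Proof.
move=> Msing Mnil.
have [N Nstab] : exists N, forall w : 'rV_n, w *m M ^+ N.+1 = 0 -> w *m M ^+ N = 0.
  have ex : exists r, `[< exists k, \rank (M ^+ k) = r >].
    by exists (\rank (M ^+ 0)); apply/asboolP; exists 0%N.
  case: (ex_minnP ex) => r /asboolP[N rN] rmin; exists N => w.
  have sub : (kermx (M ^+ N) <= kermx (M ^+ N.+1))%MS.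
    by apply/sub_kermxP; rewrite mxexpSr mulmxA mulmx_ker mul0mx.
  have : (kermx (M ^+ N.+1) <= kermx (M ^+ N))%MS.
    have := mxrank_leqif_sup sub; rewrite !mxrank_ker rN => /geq_leqif <-.
    apply: leq_sub2l; apply: rmin; apply/asboolP; by exists N.+1.
  by move=> ker_le /sub_kermxP wk; apply/sub_kermxP; apply: submx_trans ker_le.
pose K := kermx (M ^+ N.+1).
have rX : row_free (row_base K) := row_base_free K.
have [Y [W [ZW WZ]]] := row_free_split rX.
set X := row_base K in rX Y W ZW WZ; set m := \rank K in X rX Y W ZW WZ *.
have XK : X *m M ^+ N.+1 = 0 by apply/sub_kermxP; rewrite eq_row_base.
have KX (w : 'rV_n) : w *m M ^+ N.+1 = 0 -> exists u, w = u *m X.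
  by move=> /sub_kermxP wK; apply/submxP; rewrite eq_row_base.
have [B XM] : exists B, X *m M = B *m X.
  apply/submxP; rewrite eq_row_base; apply/sub_kermxP.
  by rewrite -mulmxA -mxexpS mxexpSr mulmxA XK mul0mx.
have mn : (m <= n)%N by apply: rank_leq_col.
pose T := col_mx X Y *m M *m W.
have ZM : col_mx X Y *m M = T *m col_mx X Y by rewrite -mulmxA WZ mulmx1.
have uT : usubmx T = row_mx B 0.
  have : row_mx B 0 *m col_mx X Y = usubmx T *m col_mx X Y.
    by rewrite mul_row_col mul0mx addr0 -XM mul_usub_mx -ZM mul_col_mx col_mxKu.
  by move=> /(congr1 (mulmx^~ W)); rewrite -!mulmxA ZW !mulmx1.
exists m, (n - m)%N, (col_mx X Y), W, B, (dlsubmx T), (drsubmx T), N.+1; split=> //.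
- by rewrite subnKC.
- apply/andP; split.
    rewrite lt0n mxrank_eq0; apply: contraNneq Msing => K0.
    apply: unitmx_inj => w wM.
    have [|u] := KX w; first by rewrite mxexpS mulmxA wM mul0mx.
    move=> ->; apply/eqP; rewrite -submx0; apply: submx_trans (submxMl _ _) _.
    by rewrite eq_row_base K0 submx_refl.
  rewrite ltn_neqAle mn andbT; apply: contraNneq (Mnil N.+1) => mfull.
  apply/eqP; rewrite -[LHS]mul1mx; apply/sub_kermxP; rewrite -/K.
  by apply: submx_full; rewrite /row_full -/m mfull.
- have : T = block_mx B 0 (dlsubmx T) (drsubmx T)
  by rewrite -{1}(vsubmxK T) uT -[dsubmx T]hsubmxK.
  by [].
split.
  apply: (row_free_inj rX); rewrite mul0mx.
  by rewrite -(mulmx_exp _ XM).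
apply: unitmx_inj => w wC.
pose y := row_mx 0 w *m col_mx X Y.
have yM : y *m M ^+ N.+1 = 0.
  rewrite mxexpS mulmxA; apply: Nstab; rewrite -mulmxA -mxexpS (mxexpS M N.+1) mulmxA
    /y -(mulmxA (row_mx _ _)) ZM.
  rewrite mulmxA -[T]submxK mul_row_block !mul0mx !add0r wC mul_row_col.
  by rewrite mul0mx addr0 -mulmxA XK mulmx0.
have [u yu] := KX _ yM.
have : row_mx 0 w = row_mx u 0.
  have : row_mx 0 w *m col_mx X Y = row_mx u 0 *m col_mx X Y.
    by rewrite -/y yu mul_row_col mul0mx addr0.
  by move=> /(congr1 (mulmx^~ W)); rewrite -!mulmxA ZW !mulmx1.
by case/eq_row_mx.
Qed.

End LinearAlgebra.

(** All eigenvalues are 0. *)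
Lemma nilpotent_char_poly (F : closedFieldType) n (M : 'M[F]_n) k :
  M ^+ k = 0 -> char_poly M = 'X^n.
Proof.
move=> Mk; have [r er] := closed_field_poly_normal (char_poly M).
have /eqP lc := char_poly_monic M; rewrite lc scale1r in er.
have r0 z : z \in r -> z = 0.
  move=> zr; have : eigenvalue M z by rewrite eigenvalue_root_char er root_prod_XsubC.
  case/eigenvalueP => v vM v0.
  have := mulmx_exp k (etrans vM (esym (mul_scalar_mx z v))).
  rewrite Mk mulmx0 -rmorphXn /= mul_scalar_mx => /esym/eqP.
  by rewrite scalemx_eq0 (negPf v0) orbF expf_eq0 => /andP[_ /eqP].
have sr : size r = n by have := size_char_poly M; rewrite er size_prod_XsubC => -[].
rewrite er (eq_big_seq (fun=> 'X)) => [|z /r0->]; last by rewrite subr0.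
by rewrite big_const_seq count_predT sr -Monoid.iteropE.
Qed.

Lemma nilpotent_trace (F : closedFieldType) n (M : 'M[F]_n) k :
  M ^+ k = 0 -> \tr M = 0.
Proof.
move=> /nilpotent_char_poly chM; case: n M chM => [|n] M chM.
  by rewrite /mxtrace big_ord0.
apply/eqP; rewrite -oppr_eq0 -char_poly_trace // chM coefXn.
by rewrite ltn_eqF.
Qed.

Lemma nilpotent_exp (F : closedFieldType) n (M : 'M[F]_n) k :
  M ^+ k = 0 -> M ^+ n = 0.
Proof.
case: n M => [|n] M; first by move=> _; apply/matrixP => - [].
move=> /nilpotent_char_poly chM; have := Cayley_Hamilton M.
by rewrite chM rmorphXn /= horner_mx_X.
Qed.

Lemma seq_maximal d (T : porderType d) (s : seq T) : s != [::] ->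
  exists2 c, c \in s & {in s, forall y, ~~ (c < y)%O}.
Proof.
elim: s => // x s IH _; have [->|s0] := eqVneq s [::].
  by exists x; rewrite ?mem_head // => y; rewrite inE => /eqP->; rewrite ltxx.
have [c cs cmax] := IH s0; have [cx|ncx] := boolP (c < x)%O.
  exists x; rewrite ?mem_head // => y; rewrite inE => /predU1P[->|ys].
    by rewrite ltxx.
  by apply: contra (cmax y ys); apply: lt_trans.
exists c; rewrite ?inE ?cs ?orbT // => y; rewrite inE => /predU1P[->//|].
exact: cmax.
Qed.

Definition lcoefmx (K : fieldType) m n (i : int) (X : 'M[laurent K]_(m, n)) :
  'M[K]_(m, n) := map_mx (fun f : laurent K => f i) X.

Notation "M ^lc" := (map_mx (@lconst _) M) (at level 2, format "M ^lc").

(** * Regular singular systems *)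

Section CoefficientMatrices.
Variable K : fieldType.
Local Notation L := (laurent K).

Lemma lcoefmxP m n (X Y : 'M[L]_(m, n)) :
  (forall i, lcoefmx i X = lcoefmx i Y) -> X = Y.
Proof.
move=> XY; apply/matrixP => a b; apply: laurentP => i.
by have /matrixP/(_ a b) := XY i; rewrite !mxE.
Qed.

Lemma lcoefmxD m n i (X Y : 'M[L]_(m, n)) :
  lcoefmx i (X + Y) = lcoefmx i X + lcoefmx i Y.
Proof. by apply/matrixP => a b; rewrite !mxE. Qed.

Lemma lcoefmxN m n i (X : 'M[L]_(m, n)) : lcoefmx i (- X) = - lcoefmx i X.
Proof. by apply/matrixP => a b; rewrite !mxE. Qed.

Lemma lcoefmxB m n i (X Y : 'M[L]_(m, n)) :
  lcoefmx i (X - Y) = lcoefmx i X - lcoefmx i Y.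
Proof. by rewrite lcoefmxD lcoefmxN. Qed.

Lemma lcoefmx_const m n (M : 'M[K]_(m, n)) i : lcoefmx i M^lc = M *+ (i == 0).
Proof.
apply/matrixP => a b; rewrite !mxE lconstE.
by case: (i == 0); rewrite ?mulr1n // mulr0n mxE.
Qed.

Lemma lcoefmx_constr m n p (X : 'M[L]_(m, n)) (M : 'M[K]_(n, p)) i :
  lcoefmx i (X *m M^lc) = lcoefmx i X *m M.
Proof.
apply/matrixP => a b; rewrite !mxE lcoef_sum; apply: eq_bigr => k _.
by rewrite !mxE mulrC lcoefCM mulrC.
Qed.

Lemma lcoefmx_constl m n p (M : 'M[K]_(m, n)) (X : 'M[L]_(n, p)) i :
  lcoefmx i (M^lc *m X) = M *m lcoefmx i X.
Proof.
apply/matrixP => a b; rewrite !mxE lcoef_sum; apply: eq_bigr => k _.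
by rewrite !mxE lcoefCM.
Qed.

Lemma lcoefmxCZ m n (c : K) (X : 'M[L]_(m, n)) i :
  lcoefmx i (lconst c *: X) = c *: lcoefmx i X.
Proof. by apply/matrixP => a b; rewrite !mxE lcoefCM. Qed.

Lemma lcoefmxXz m n k (X : 'M[L]_(m, n)) i :
  lcoefmx i (lX ^ k *: X) = lcoefmx (i - k) X.
Proof. by apply/matrixP => a b; rewrite !mxE lcoefXzM. Qed.

Lemma lcoefmx_deriv m n (X : 'M[L]_(m, n)) i :
  lcoefmx i (mxderiv X) = (i + 1)%:~R *: lcoefmx (i + 1) X.
Proof. by apply/matrixP => a b; rewrite !mxE. Qed.

Lemma mxvanishP m n a (X : 'M[L]_(m, n)) :
  mxvanish a X <-> forall i, i < a -> lcoefmx i X = 0.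
Proof.
split=> [Xa i ia|Xa u v i ia].
  by apply/matrixP => u v; rewrite !mxE Xa.
by have /matrixP/(_ u v) := Xa i ia; rewrite !mxE.
Qed.

Lemma mxvanish_sub_lead m n (X : 'M[L]_(m, n)) :
  mxvanish 0 X -> mxvanish 1 (X - (lcoefmx 0 X)^lc).
Proof.
move=> X0; apply/mxvanishP => i i1; rewrite lcoefmxB lcoefmx_const.
case: eqP => [->|/eqP i0]; first by rewrite mulr1n subrr.
by rewrite subr0; move/mxvanishP: X0; apply; lia.
Qed.

End CoefficientMatrices.

Section RegularSolution.
Variable C : numClosedFieldType.
Local Notation L := (laurent C).

(** The eigenvalues are finitely many, and c < c + j. *)
Lemma eigenvalue_max n (M : 'M[C]_n) : (0 < n)%N ->
  exists2 c, eigenvalue M c & forall j : nat, ~~ eigenvalue M (c + j.+1%:R).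
Proof.
move=> n0; have [r er] := closed_field_poly_normal (char_poly M).
have /eqP lc := char_poly_monic M; rewrite lc scale1r in er.
have rP z : (z \in r) = eigenvalue M z by rewrite eigenvalue_root_char er
  root_prod_XsubC.
have sr : size r = n by have := size_char_poly M; rewrite er size_prod_XsubC => -[].
have [|c cr cmax] := @seq_maximal _ _ r; first by rewrite -size_eq0 sr -lt0n.
exists c; first by rewrite -rP.
by move=> j; apply/negP; rewrite -rP => /cmax; rewrite ltrDl ltr0n.
Qed.

(** Frobenius' method: as c + l is not an eigenvalue for l > 0, the recursion for
    the coefficient of x^l is never obstructed. *)
Lemma frobenius_solution n (M : 'M[L]_n) : (0 < n)%N -> mxvanish 0 M ->
  exists (v : 'rV[L]_n) (c : C),
    [/\ mxvanish 0 v, lcoefmx 0 v != 0, eigenvalue (lcoefmx 0 M) c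
      & intertwines ((lX ^ (-1) * lconst c)%:M) (lX ^ (-1) *: M) v].
Proof.
move=> n0 M0; set N := lcoefmx 0 M.
have [c Nc cmax] := eigenvalue_max N n0.
have /eigenvalueP[v0 v0N v0n0] := Nc.
have Nu (j : nat) : N - (c + j.+1%:R)%:M \in unitmx by apply: unitmx_not_eigenvalue.
pose s (y : 'rV[L]_n) i (l : int) : C :=
  if 1 <= l then (lcoefmx l y *m invmx (N - (c + l%:~R)%:M)) 0 i else 0.
have s_ok y i : exists b, vanish_below b (s y i).
  by exists 1 => l l1; rewrite /s leNgt l1.
(* S inverts v |-> v N - c v - x v' on the rows that vanish at x = 0 *)
pose S y : 'rV[L]_n := \row_i Laurent (s_ok y i).
have SE y l : lcoefmx l (S y) =
    if 1 <= l then lcoefmx l y *m invmx (N - (c + l%:~R)%:M) else 0.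
  by apply/rowP => i; rewrite !mxE /= /s; case: ifP; rewrite ?mxE.
pose R := M - N^lc; have R1 : mxvanish 1 R by apply: mxvanish_sub_lead.
pose Phi w := S (- ((v0^lc + w) *m R)).
have S1 y : mxvanish 1 (S y).
  by apply/mxvanishP => i i1; rewrite SE leNgt i1.
have [|w [w1 wPhi]] := @contraction_fixpoint _ _ _ 1 Phi (fun X _ => S1 _).
  move=> X Y k k1 X1 Y1 XY; apply/mxvanishP => l lk; rewrite lcoefmxB !SE.
  case: (1 <= l); last exact: subr0.
  rewrite -mulmxBl -lcoefmxB.
  have -> : - ((v0^lc + X) *m R) - - ((v0^lc + Y) *m R) = - ((X - Y) *m R).
    by rewrite opprK addrC -opprB -mulmxBl [v0^lc + X]addrC addrKA.
  have /mxvanishP -> // : mxvanish (k + 1) (- ((X - Y) *m R)).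
    by apply: mxvanishN; apply: mxvanishM.
  by rewrite mul0mx.
exists (v0^lc + w), c; split=> //.
- apply: mxvanishD; first exact: mxvanish_const.
  by apply: mxvanish_le w1.
- rewrite lcoefmxD lcoefmx_const mulr1n.
  by have /mxvanishP -> := w1; rewrite ?addr0.
suff eqv : (v0^lc + w) *m M - lX ^ 1 *: mxderiv (v0^lc + w) = lconst c *: (v0^lc + w).
  rewrite /intertwines mul_scalar_mx -scalerA -eqv /nabla -scalemxAr scalerBr.
  by congr (_ - _); rewrite scalerA mulrC lX_mulVz scale1r.
have -> : M = R + N^lc by rewrite subrK.
apply: lcoefmxP => l.
rewrite lcoefmxB mulmxDr lcoefmxD lcoefmx_constr lcoefmxCZ lcoefmxXz lcoefmx_deriv
  subrK.
have [l1|l1] := ltP l 1.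
  have /mxvanishP -> // : mxvanish 1 ((v0^lc + w) *m R).
    rewrite -[1]add0r; apply: mxvanishM => //; apply: mxvanishD;
      first exact: mxvanish_const.
    by apply: mxvanish_le w1.
  rewrite add0r lcoefmxD; have /mxvanishP -> // := w1; rewrite addr0 lcoefmx_const.
  by case: eqP => [->|_]; rewrite ?mulr0n ?mul0mx ?scaler0 ?subr0 // mulr1n v0N
    scale0r subr0.
have e : lcoefmx l w *m (N - (c + l%:~R)%:M) = - lcoefmx l ((v0^lc + w) *m R).
  rewrite -{1}wPhi SE l1 mulmxKV ?lcoefmxN //.
  by case: l l1 => // -[//|j] _; exact: Nu.
have -> : lcoefmx l ((v0^lc + w) *m R) =
  - (lcoefmx l w *m (N - (c + l%:~R)%:M)) by rewrite e opprK.
have l0 : (l == 0) = false by apply/eqP => l0; rewrite l0 in l1.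
rewrite lcoefmxD lcoefmx_const l0 mulr0n add0r mulmxBr mul_mx_scalar scalerDl.
by rewrite opprB subrK addrK.
Qed.

End RegularSolution.

(** * Splitting by the leading matrix *)

Section Splitting.
Variable K : fieldType.
Local Notation L := (laurent K).

Lemma mxvanish_congrD m n a (X Y X' Y' : 'M[L]_(m, n)) :
  mxvanish a (X - Y) -> mxvanish a (X' - Y') ->
  mxvanish a (X + X' - (Y + Y')).
Proof. by move=> h h'; rewrite opprD addrACA; apply: mxvanishD. Qed.

Lemma mxvanish_congrN m n a (X Y : 'M[L]_(m, n)) :
  mxvanish a (X - Y) -> mxvanish a (- X - - Y).
Proof. by move=> h; rewrite -opprD; apply: mxvanishN. Qed.

(** The rows (1 T) span a submodule when T solves a quadratic differential
    equation with linear part T C - B T. As B is nilpotent and C invertible, a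
    finite geometric sum inverts this linear part, and then the equation is the
    fixed point of a contraction; the derivative has weight x^(k+1) with k > 0. *)
Lemma splitting_submodule m p (M : 'M[L]_(m + p)) (B : 'M[K]_m) (E : 'M[K]_(p, m))
    (C : 'M[K]_p) (N k : nat) :
    (0 < k)%N -> mxvanish 0 M -> lcoefmx 0 M = block_mx B 0 E C ->
    B ^+ N = 0 -> C \in unitmx ->
  exists (T : 'M[L]_(m, p)) (B' : 'M[L]_m),
    intertwines B' (lX ^ (- k.+1%:Z) *: M) (row_mx 1%:M T).
Proof.
move=> k0 M0 lM BN Cu.
pose A1 := ulsubmx M - B^lc; pose A2 := drsubmx M - C^lc.
have block0 (X : 'M[L]_(m + p)) : mxvanish 0 X ->
  [/\ mxvanish 0 (ulsubmx X), mxvanish 0 (ursubmx X), mxvanish 0 (dlsubmx X)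
    & mxvanish 0 (drsubmx X)].
  by move=> X0; split=> i j; rewrite !mxE.
have [M11 M12 M21 M22] := block0 _ M0.
have lead : [/\ lcoefmx 0 (ulsubmx M) = B, lcoefmx 0 (ursubmx M) = 0
    & lcoefmx 0 (drsubmx M) = C].
  by rewrite /lcoefmx map_ulsubmx map_ursubmx map_drsubmx -/(lcoefmx 0 M) lM
       block_mxKul block_mxKur block_mxKdr.
have [lM11 lM12 lM22] := lead.
have A1v : mxvanish 1 A1 by rewrite /A1 -lM11; apply: mxvanish_sub_lead.
have A2v : mxvanish 1 A2 by rewrite /A2 -lM22; apply: mxvanish_sub_lead.
have M12v : mxvanish 1 (ursubmx M).
  have := mxvanish_sub_lead M12; rewrite lM12.
  by rewrite (_ : 0^lc = 0) ?subr0 //; apply/matrixP => i j; rewrite !mxE raddf0.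
pose a (Y : 'M[L]_(m, p)) l := (B ^+ l)^lc *m Y *m ((invmx C) ^+ l)^lc.
pose S (Y : 'M[L]_(m, p)) := \sum_(l < N) a Y l *m (invmx C)^lc.
have av Y b l : mxvanish b Y -> mxvanish b (a Y l).
  move=> Yb; rewrite -[b]addr0 -[b]add0r; apply: mxvanishM (mxvanish_const _).
  by apply: mxvanishM Yb; apply: mxvanish_const.
have Sv Y b : mxvanish b Y -> mxvanish b (S Y).
  move=> Yb i j; rewrite summxE; apply: vanish_sum => l _.
  by rewrite -[b]addr0; apply: mxvanishM (mxvanish_const _) _ _; apply: av.
have SB X Y : S X - S Y = S (X - Y).
  rewrite /S -sumrB; apply: eq_bigr => l _.
  by rewrite -mulmxBl /a -mulmxBl -mulmxBr.
have SP Y : S Y *m C^lc - B^lc *m S Y = Y.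
  rewrite /S mulmx_suml mulmx_sumr -sumrB.
  rewrite (eq_bigr (fun l : 'I_N => - (a Y l.+1 - a Y l))) => [|l _]; last first.
    rewrite opprB; congr (_ - _).
      by rewrite -mulmxA -map_mxM mulVmx // map_mx1 mulmx1.
    by rewrite /a !mulmxA -map_mxM -mxexpS -!mulmxA -map_mxM -mxexpSr.
  rewrite sumrN -(big_mkord predT (fun l => a Y l.+1 - a Y l)) telescope_sumr //.
  rewrite /a BN !mxexp0 !map_mx1 mul1mx mulmx1 opprB.
  by rewrite (_ : 0^lc = 0) ?mul0mx ?subr0 //; apply/matrixP => i j;
    rewrite !mxE raddf0.
pose R (T : 'M[L]_(m, p)) := A1 *m T + - (T *m A2) + T *m dlsubmx M *m T
  + - ursubmx M + lX ^ (k.+1%:Z) *: mxderiv T.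
have Dv (T : 'M[L]_(m, p)) b : mxvanish b T ->
    mxvanish (b + 1) (lX ^ (k.+1%:Z) *: mxderiv T).
  move=> Tb; apply: (@mxvanish_le _ _ _ (k.+1%:Z + (b - 1))); first by lia.
  by apply: mxvanishZ; [exact: vanishXz | exact: mxvanish_deriv].
have [||T [T1 fixT]] := @contraction_fixpoint _ _ _ 1 (fun T => S (R T)).
- move=> T T1; apply: Sv; have T0 : mxvanish 0 T by apply: mxvanish_le T1.
  apply: mxvanishD; last by apply: mxvanish_le (Dv _ _ T1).
  apply: mxvanishD; last exact: mxvanishN.
  apply: mxvanishD; last first.
    by rewrite -[1]add0r; apply: mxvanishM => //; rewrite -[0]addr0; apply: mxvanishM.
  apply: mxvanishD; last apply: mxvanishN.
    by rewrite -[1]addr0; apply: mxvanishM.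
  by rewrite -[1]add0r; apply: mxvanishM.
- move=> X Y b b1 X1 Y1 XY; rewrite SB; apply: Sv.
  apply: mxvanish_congrD; last first.
    rewrite -scalerBr -raddfB /=; exact: Dv.
  apply: mxvanish_congrD; last by rewrite subrr; apply: mxvanish0.
  apply: mxvanish_congrD; last first.
    have -> : X *m dlsubmx M *m X - Y *m dlsubmx M *m Y =
        X *m dlsubmx M *m (X - Y) + (X - Y) *m dlsubmx M *m Y.
      by rewrite mulmxBr !mulmxBl addrA subrK.
    apply: mxvanishD.
      by rewrite addrC; apply: mxvanishM => //; rewrite -[1]addr0; apply: mxvanishM.
    by apply: mxvanishM => //; rewrite -[b]addr0; apply: mxvanishM.
  apply: mxvanish_congrD; last apply: mxvanish_congrN.
    by rewrite -mulmxBr addrC; apply: mxvanishM.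
  by rewrite -mulmxBl; apply: mxvanishM.
exists T, (lX ^ (- k.+1%:Z) *: (ulsubmx M + T *m dlsubmx M)).
have eqT := SP (R T); rewrite fixT in eqT.
have key : ursubmx M + T *m drsubmx M - lX ^ (k.+1%:Z) *: mxderiv T
         = (ulsubmx M + T *m dlsubmx M) *m T.
  move: eqT; rewrite /R /A1 /A2 mulmxBl mulmxBr mulmxDl; set D := _ *: _.
  move=> e; apply/eqP; rewrite -subr_eq0; apply/eqP.
  move/eqP: e; rewrite -subr_eq0 => /eqP <-.
  set x1 := T *m C^lc; set x2 := B^lc *m T; set x3 := ulsubmx M *m T.
  set x4 := T *m drsubmx M; set x5 := T *m _ *m T; set x6 := ursubmx M.
  by apply/matrixP => i j; rewrite !mxE; ring.
rewrite /intertwines /nabla map_row_mx mxderiv1 -scalemxAr mul_mx_row mulmx1.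
rewrite -[M in row_mx _ _ *m M]submxK mul_row_block !mul1mx scale_row_mx -scalemxAl
  -key.
have sXK (X : 'M[L]_(m, p)) : lX ^ (- k.+1%:Z) *: (lX ^ (k.+1%:Z) *: X) = X.
  by rewrite scalerA mulrC lX_mulVz scale1r.
by rewrite opp_row_mx add_row_mx oppr0 addr0 scalerBr sXK.
Qed.

End Splitting.

(** * Traces of connections *)

Section Trace.
Variable K : fieldType.
Local Notation L := (laurent K).

Lemma lderiv_prod (I : finType) (F : I -> L) :
  lderiv (\prod_i F i) =
  \sum_i \prod_j (if j == i then lderiv (F j) else F j).
Proof.
have gen (r : seq I) : uniq r -> lderiv (\prod_(i <- r) F i) =
    \sum_(i <- r) \prod_(j <- r) (if j == i then lderiv (F j) else F j).
  elim: r => [|i r IH] /=; first by rewrite !big_nil lderiv1.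
  case/andP => ir ur; rewrite !big_cons lderivM eqxx IH //; congr (_ * _ + _).
    by apply: eq_big_seq => j jr; case: eqP => // ji; rewrite -ji jr in ir.
  rewrite mulr_sumr; apply: eq_big_seq => j jr; rewrite big_cons.
  by case: eqP => // ij; rewrite ij jr in ir.
by have := gen _ (index_enum_uniq I).
Qed.

(** Jacobi's formula: differentiate one row at a time and expand along it. *)
Lemma lderiv_det n (P : 'M[L]_n) :
  lderiv (\det P) = \tr (mxderiv P *m \adj P).
Proof.
pose Q i := \matrix_(a, b) if a == i then lderiv (P a b) else P a b.
transitivity (\sum_i \det (Q i)).
  rewrite /determinant raddf_sum exchange_big /=; apply: eq_bigr => s _.
  rewrite -mulr_sumr.
  have -> : ((-1) ^+ perm.odd_perm s : L) =
    lconst ((-1) ^+ perm.odd_perm s) by rewrite rmorphXn rmorphN1.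
  rewrite lderivCM lderiv_prod; congr (_ * _); apply: eq_bigr => i _.
  by apply: eq_bigr => j _; rewrite mxE.
rewrite /mxtrace; apply: eq_bigr => i _.
rewrite (expand_det_row _ i) mxE; apply: eq_bigr => j _.
rewrite !mxE eqxx; congr (_ * _); rewrite /cofactor; congr (_ * \det _).
by apply/matrixP => a b; rewrite !mxE eq_sym (negPf (neq_lift _ _)).
Qed.

Lemma vanish_inv (f : L) a : vanish_below a f -> f a != 0 ->
  vanish_below (- a) f^-1.
Proof.
move=> fa fa0; have f0 : f != 0 by apply: contraNneq fa0 => ->.
have [b [gb0 gb]] := laurent_neq0 (invr_neq0 f0).
suff -> : - a = b by [].
have := lcoefM_lead fa gb; rewrite divff // lcoef1 => e.
have : f a * f^-1 b != 0 by rewrite mulf_neq0.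
rewrite -e; have [ab _|ab] := eqVneq (a + b) 0; last by rewrite eqxx.
by apply/esym/eqP; rewrite -addr_eq0 addrC ab.
Qed.

Lemma vanish_log_deriv (f : L) : f != 0 -> vanish_below (-1) (lderiv f / f).
Proof.
move=> /laurent_neq0[a [fa0 fa]]; have -> : -1 = (a - 1) + - a by lia.
by apply: vanishM; [exact: vanish_deriv | exact: vanish_inv].
Qed.

(** The traces differ by the logarithmic derivative of det P, which has at most a
    simple pole. *)
Lemma trace_intertwines n (B G P : 'M[L]_n) : P \in unitmx ->
  intertwines B G P -> vanish_below (-1) (\tr G - \tr B).
Proof.
move=> Pu /(intertwines_uniq Pu) ->.
have -> : \tr G - \tr (nabla G P *m invmx P) = lderiv (\det P) / \det P.
  rewrite /nabla mulmxBl raddfB /= (mxtrace_mulC (P *m G)) (mulKmx Pu) opprB addrC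
    subrK.
  by rewrite /invmx Pu -scalemxAr mxtraceZ lderiv_det mulrC.
by apply: vanish_log_deriv; rewrite -unitfE -unitmxE.
Qed.

End Trace.

(** * Companion systems and their slopes *)

Section Companion.
Variable K : fieldType.
Local Notation L := (laurent K).

Definition companion n (b : 'rV[L]_n) : 'M[L]_n :=
  \matrix_(i, j) if i.+1 == n then b 0 j else (i.+1 == j)%:R.

(** The rows w, theta w, theta^2 w, ... for theta = x nabla and any nonzero w, up to
    the first linear dependency. A cyclic vector is not asked for: when the rows do
    not span, they give a proper submodule, which suits an induction as well. *)
Lemma companion_submodule n (G : 'M[L]_n) : (0 < n)%N ->
  exists m (X : 'M[L]_(m, n)) (b : 'rV[L]_m),
    [/\ (0 < m <= n)%N, row_free X
      & intertwines (lX ^ (-1) *: companion b) G X].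
Proof.
move=> n0; pose e0 : 'rV[L]_n := delta_mx 0 (Ordinal n0).
pose w k := iter k (fun v => lX ^ 1 *: nabla G v) e0.
pose W m := \matrix_(k < m) w k.
have Wmul m (u : 'rV_m) : u *m W m = \sum_(k < m) u 0 k *: w k.
  by rewrite mulmx_sum_row; apply: eq_bigr => k _; rewrite rowK.
have W1 : row_free (W 1%N).
  apply: inj_row_free => v; rewrite Wmul big_ord1 => /rowP/(_ (Ordinal n0)).
  rewrite !mxE !eqxx mulr1 => v0; apply/rowP => i.
  by rewrite ord1 v0 mxE.
have Wle m : row_free (W m) -> (m <= n)%N by move=> /eqP<-; apply: rank_leq_col.
case: (ex_maxnP (ex_intro (fun m => row_free (W m)) 1%N W1) Wle) => m Wm mmax.
have m0 : (0 < m)%N by apply: mmax.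
have Wm1 : ~ row_free (W m.+1) by move=> /mmax; rewrite ltnn.
have [[b wb]|nb] := pselect (exists b, w m = b *m W m); last first.
  case: Wm1.
  apply: inj_row_free => v; rewrite Wmul big_ord_recr /= => e.
  have vm : v 0 ord_max = 0.
    apply/eqP; apply: contra_notT nb => vm.
    exists (- (v 0 ord_max)^-1 *: \row_(k < m) v 0 (widen_ord (leqnSn m) k)).
    rewrite -scalemxAl Wmul (eq_bigr (fun k : 'I_m =>
      v 0 (widen_ord (leqnSn m) k) *: w k)).
      by rewrite scaleNr -scalerN (addr0_eq e) scalerA mulVf ?scale1r.
    by move=> k _; rewrite mxE.
  move: e; rewrite vm scale0r addr0 => e.
  have : (\row_(k < m) v 0 (widen_ord (leqnSn m) k)) *m W m = 0 *m W m.
    rewrite mul0mx Wmul -[RHS]e; apply: eq_bigr => k _; by rewrite mxE.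
  move=> /(row_free_inj Wm)/rowP v0; apply/rowP => i; rewrite mxE.
  have [im|] := ltnP i m; last first.
    by move=> mi; rewrite -vm; congr (v 0 _); apply: val_inj => /=;
      have := ltn_ord i; lia.
  have := v0 (Ordinal im); rewrite !mxE => <-; congr (v 0 _); exact: val_inj.
exists m, (W m), b; split=> //; first by rewrite m0 Wle.
rewrite /intertwines -scalemxAl.
suff -> : companion b *m W m = lX ^ 1 *: nabla G (W m).
  by rewrite scalerA mulrC lX_mulVz scale1r.
apply/row_matrixP => i; rewrite row_mul Wmul.
have -> : row i (lX ^ 1 *: nabla G (W m)) = w i.+1.
  by rewrite /nabla linearZ /= linearB /= row_mul rowK -map_row rowK.
case: (eqVneq i.+1 m) => im.
  rewrite im wb Wmul; apply: eq_bigr => k _; by rewrite !mxE im eqxx.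
have im' : (i.+1 < m)%N by rewrite ltn_neqAle im ltn_ord.
rewrite (bigD1 (Ordinal im')) //= big1 => [|k ki]; rewrite !mxE (negPf im).
  by rewrite eqxx scale1r addr0.
case: eqP => [ik|]; last by rewrite scale0r.
by case/eqP: ki; apply: val_inj.
Qed.

Lemma vanish_subst_pow r a (f : L) : (0 < r)%N -> vanish_below a f ->
  vanish_below (r%:Z * a) (lsubst_pow r f).
Proof.
move=> r0 fa l la; have [/dvdzP[k lk]|nr] := boolP (r %| l)%Z;
  last exact: lsubst_pow_ndvd.
by rewrite lk mulrC lsubst_powE // fa //; nia.
Qed.

(** The number k is the largest slope of the Newton polygon. Its denominator is
    one of the n - j, so ramifying by n! makes it an integer. *)
Lemma newton_slope n (b : 'rV[L]_n) :
  (exists j, ~ vanish_below 0 (b 0 j)) ->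
  exists k : nat,
    [/\ (0 < k)%N,
        forall j : 'I_n, vanish_below (- (k * (n - j))%N%:Z) (lsubst_pow n`! (b 0 j))
      & exists j : 'I_n, lsubst_pow n`! (b 0 j) (- (k * (n - j))%N%:Z) != 0].
Proof.
move=> [j0 bj0].
have /boolp.choice[nu nuP] : forall j, exists a, b 0 j != 0 ->
    b 0 j a != 0 /\ vanish_below a (b 0 j).
  move=> j; have [->|/laurent_neq0[a aP]] := eqVneq (b 0 j) 0; last by exists a.
  by exists 0.
have b0 : b 0 j0 != 0 by apply: contra_notN bj0 => /eqP->.
pose t (j : 'I_n) : int := - nu j * (n`! %/ (n - j))%N%:Z.
have fact_div (j : 'I_n) : n`! = ((n`! %/ (n - j)) * (n - j))%N.
  have := ltn_ord j => jn; rewrite divnK // dvdn_fact //; lia.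
case: (@Order.TotalTheory.arg_maxP _ int 'I_n j0 (fun j => b 0 j != 0) t b0) =>
  j bj jmax.
have tpos : 0 < t j.
  apply: lt_le_trans (jmax _ b0); rewrite /t.
  have nuneg : nu j0 < 0.
    by rewrite ltNge; apply: contra_notN bj0 => nu0; apply: vanish_le nu0 _;
      case: (nuP _ b0).
  have := fact_div j0; have := fact_gt0 n; nia.
exists (absz (t j)); split; first lia.
  move=> i; have [->|bi] := eqVneq (b 0 i) 0; first by rewrite raddf0.
  apply: vanish_le (vanish_subst_pow (fact_gt0 n) (proj2 (nuP _ bi))).
  have /= := jmax _ bi; have := fact_div i; rewrite /t in tpos *; nia.
exists j; have -> : - (`|t j| * (n - j))%N%:Z = n`!%:Z * nu j.
  by have := fact_div j; rewrite /t in tpos *; nia.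
by rewrite lsubst_powE ?fact_gt0 //; case: (nuP _ bj).
Qed.

End Companion.

(** * Submodules of rank one *)

Section EigenRow.
Variable C : numClosedFieldType.
Local Notation L := (laurent C).

Definition has_eigenrow n (G : 'M[L]_n) : Prop :=
  exists (r : nat) (v : 'rV[L]_n) (f : L),
    [/\ (0 < r)%N, v != 0 & intertwines f%:M (ramification r G) v].

Lemma eigenrow_sub m n (G : 'M[L]_n) (B : 'M[L]_m) (X : 'M[L]_(m, n)) :
  row_free X -> intertwines B G X -> has_eigenrow B -> has_eigenrow G.
Proof.
move=> /row_freeP[Y XY] BX [r [v [f [r0 v0 fv]]]].
exists r, (v *m map_mx (@lsubst_pow C r) X), f; split=> //.
  apply: contraNneq v0 => vX; apply/eqP.
  rewrite -[v]mulmx1 -(subst_mx1 C r0) -XY subst_mxM // mulmxA vX.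
  by rewrite mul0mx.
exact: intertwines_comp (intertwines_ramification r0 BX) fv.
Qed.

Lemma eigenrow_twist n (G : 'M[L]_n) h :
  has_eigenrow (G + h%:M) -> has_eigenrow G.
Proof.
move=> [r [v [f [r0 v0 fv]]]]; set g := r%:R * lX ^+ r.-1 * lsubst_pow r h.
have sD m (a b : L) : (a + b)%:M = a%:M + b%:M :> 'M_m by rewrite raddfD.
exists r, v, (f - g); split=> //; have := intertwines_twist (- g) fv.
by rewrite ramificationD ramification_scalar // -/g -addrA -!sD subrr raddf0 addr0.
Qed.

Lemma eigenrow_ramification n (G : 'M[L]_n) s : (0 < s)%N ->
  has_eigenrow (ramification s G) -> has_eigenrow G.
Proof.
move=> s0 [r [v [f [r0 v0 fv]]]]; exists (s * r)%N, v, f.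
split; [by rewrite muln_gt0 s0 | exact: v0 |].
by rewrite -(ramification_comp G r0 s0).
Qed.

Lemma eigenrow_regular n (M : 'M[L]_n) : (0 < n)%N -> mxvanish 0 M ->
  has_eigenrow (lX ^ (-1) *: M).
Proof.
move=> n0 /(frobenius_solution n0)[v [c [_ v0 _ cv]]].
exists 1%N, v, (lX ^ (-1) * lconst c); rewrite ramification1; split=> //.
by apply: contraNneq v0 => ->; apply/eqP/matrixP => i j; rewrite !mxE.
Qed.

(** After a twist c is 0, and then the Fitting decomposition of the leading matrix
    is not trivial, so that it lifts to a proper submodule. *)
Lemma eigenrow_split n (M : 'M[L]_n) k c : (0 < k)%N -> mxvanish 0 M ->
    eigenvalue (lcoefmx 0 M) c ->
    (forall N, (lcoefmx 0 M - c%:M) ^+ N != 0) ->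
    (forall m (B : 'M[L]_m), (0 < m < n)%N -> has_eigenrow B) ->
  has_eigenrow (lX ^ (- k.+1%:Z) *: M).
Proof.
move=> k0 M0 ev nonnil IH.
pose M1 := M - (lconst c)%:M.
have lM1 : lcoefmx 0 M1 = lcoefmx 0 M - c%:M.
  rewrite lcoefmxB -map_scalar_mx /=; congr (_ - _).
  by rewrite lcoefmx_const mulr1n.
have M1v : mxvanish 0 M1.
  by apply: mxvanishB => //; rewrite -map_scalar_mx; apply: mxvanish_const.
have sing : lcoefmx 0 M - c%:M \notin unitmx.
  case/eigenvalueP: ev => v vM v0; apply: contraNN v0 => Mu.
  rewrite -(mulmxK Mu v) mulmxBr vM mul_mx_scalar subrr.
  by rewrite mul0mx.
have [m [p [Z [W [B [E [D [N [mpn mn [ZW WZ] ZMW [BN Du]]]]]]]]]] := fitting sing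
  nonnil.
pose M2 := Z^lc *m M1 *m W^lc.
have M2v : mxvanish 0 M2.
  rewrite -[0]addr0; apply: mxvanishM (mxvanish_const _).
  by rewrite -[0]addr0; apply: mxvanishM M1v; apply: mxvanish_const.
have lM2 : lcoefmx 0 M2 = block_mx B 0 E D.
  by rewrite lcoefmx_constr lcoefmx_constl lM1.
have Zint : intertwines (lX ^ (- k.+1%:Z) *: M2) (lX ^ (- k.+1%:Z) *: M1) Z^lc.
  rewrite /intertwines /nabla mxderiv_const subr0 -scalemxAl -scalemxAr.
  by rewrite -!mulmxA -map_mxM WZ map_mx1 mulmx1.
have [T [B' TB']] := splitting_submodule k0 M2v lM2 BN Du.
apply: (@eigenrow_twist _ _ (- (lX ^ (- k.+1%:Z) * lconst c))).
have -> : lX ^ (- k.+1%:Z) *: M + (- (lX ^ (- k.+1%:Z) * lconst c))%:M =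
          lX ^ (- k.+1%:Z) *: M1.
  by rewrite scalerBr scale_scalar_mx raddfN.
apply: eigenrow_sub (intertwines_comp Zint TB') (IH _ _ mn).
apply/row_freeP; exists (W^lc *m col_mx 1%:M 0).
rewrite mulmxA -(mulmxA _ Z^lc) -map_mxM ZW map_mx1 mulmx1.
by rewrite mul_row_col mulmx1 mulmx0 addr0.
Qed.

(** By induction on the rank. A twist makes the trace of G zero. If the rows of
    companion_submodule do not span, the induction applies to their span. Otherwise
    the system is a companion system. With power series coefficients it is regular
    singular. With a positive slope k, made integral by ramification, the shearing
    diag(x^(k i)) gives a leading matrix M0 which is not nilpotent and has trace
    zero; so M0 is not a scalar plus a nilpotent matrix either, and it splits off a
    proper submodule. *)
Theorem eigenrow_exists n (G : 'M[L]_n) : (0 < n)%N -> has_eigenrow G.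
Proof.
elim/ltn_ind: n G => n IH G n0.
pose h : L := - (\tr G / n%:R); apply: (@eigenrow_twist _ _ h).
have charL : n%:R != 0 :> L.
  rewrite -(rmorph_nat (@lconst C)) fmorph_eq0 pnatr_eq0; lia.
have trG : \tr (G + h%:M) = 0.
  by rewrite mxtraceD mxtrace_scalar -[_ *+ n]mulr_natr /h mulNr divfK // subrr.
move: (G + h%:M) trG => {h charL}G trG.
have [m [X [b [/andP[m0]]]]] := companion_submodule G n0.
rewrite leq_eqVlt => /predU1P[mn|mn] Xfree Xint; last first.
  by apply: eigenrow_sub Xfree Xint _; apply: IH.
move: m0 X b Xfree Xint; rewrite mn => {m mn} _ X b.
rewrite row_free_unit => Xu Xint.
have Xfree : row_free X by rewrite row_free_unit.
have [b0|/existsNP nb0] := pselect (forall j, vanish_below 0 (b 0 j)).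
  apply: eigenrow_sub Xfree Xint _; apply: eigenrow_regular => // i j.
  rewrite mxE; case: ifP => _ //.
  by case: eqP => _; rewrite // -(rmorph1 (@lconst C)); apply: vanish_const.
have [k [k0 bk [j1 bj1]]] := newton_slope nb0.
pose s := n`!; have s0 : (0 < s)%N := fact_gt0 n.
apply: (eigenrow_ramification s0).
pose Y : 'M[L]_n := diag_mx (\row_i lX ^ (k * i)%N%:Z).
(* x^(-k-1) M is the sheared system; the subtracted term comes from Y' *)
pose M : 'M[L]_n := \matrix_(i, j)
  ((if i.+1 == n then lX ^ (k * (n - j))%N%:Z * (s%:R * lsubst_pow s (b 0 j))
    else lconst (s%:R *+ (i.+1 == j)))
   - lconst ((k * i)%:R *+ (i == j)) * lX ^ k%:Z).
have Yu : Y \in unitmx.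
  rewrite unitmxE det_diag unitfE; apply/prodf_neq0 => i _.
  by rewrite mxE expfz_neq0 ?lX_neq0.
have Yint : intertwines (lX ^ (- k.+1%:Z) *: M)
    (ramification s (lX ^ (-1) *: companion b)) Y.
  rewrite /intertwines /nabla mul_diag_mx -scalemxAl mul_mx_diag.
  apply/matrixP => i j; rewrite !mxE.
  rewrite lsubst_powM // lsubst_powXz //.
  have sX (f : L) : s%:R * lX ^+ s.-1 * (lX ^ (s%:Z * -1) * f) =
      lX ^ (-1) * (s%:R * f).
    have -> : lX ^ (-1) = lX ^+ s.-1 * lX ^ (s%:Z * -1) :> L.
      by rewrite exprnP -expfzDr ?lX_neq0 //; congr (_ ^ _); lia.
    by ring.
  have XD u u' : lX ^ u * lX ^ u' = lX ^ (u + u') :> L by rewrite expfzDr ?lX_neq0.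
  have XXf u u' w w' (f : L) : u + u' = w + w' + (k * j)%N%:Z ->
      lX ^ u * (lX ^ u' * f) = lX ^ w * (lX ^ w' * f * lX ^ (k * j)%N%:Z).
    by move=> e; rewrite mulrA XD e -!XD; ring.
  rewrite sX [in RHS]mulrBl [in RHS]mulrBr; congr (_ - _); last first.
    case: (eqVneq i j) => [->|_]; last first.
      by rewrite !mulr0n !raddf0 !mul0r mulr0.
    rewrite !mulr1n lderivXz -(rmorph_int (@lconst C)) -pmulrn.
    have -> : (k * j)%N%:Z - 1 = - k.+1%:Z + k%:Z + (k * j)%N%:Z by lia.
    by rewrite -!XD; ring.
  case: eqP => [in1|_].
    by apply: XXf; have := ltn_ord j; nia.
  case: eqP => [ij|_]; last first.
    by rewrite mulr0n !raddf0 !(mulr0, mul0r).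
  rewrite mulr1n (rmorph_nat (@lconst C)) lsubst_pow1 // mulr1.
  rewrite -[s%:R in RHS]mul1r -[1 in RHS](expr0z lX); apply: XXf.
  by rewrite -ij; lia.
have Pu : Y *m map_mx (@lsubst_pow C s) X \in unitmx.
  by rewrite unitmx_mul Yu subst_unitmx.
have Pint := intertwines_comp (intertwines_ramification s0 Xint) Yint.
apply: (eigenrow_sub _ Pint); first by rewrite row_free_unit.
have M0 : mxvanish 0 M.
  move=> i j; rewrite mxE; apply: vanishD; last first.
    apply: vanishN; apply: (@vanish_le _ (0 + k%:Z)) => //.
    by apply: vanishM; [exact: vanish_const | exact: vanishXz].
  case: ifP => _; last exact: vanish_const.
  have -> : 0 = (k * (n - j))%N%:Z + (0 - (k * (n - j))%N%:Z) by lia.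
  apply: vanishM; first exact: vanishXz.
  apply: vanishM; last exact: bk.
  rewrite -(rmorph_nat (@lconst C)); exact: vanish_const.
have M0E : forall i j, lcoefmx 0 M i j =
    if i.+1 == n then s%:R * lsubst_pow s (b 0 j) (- (k * (n - j))%N%:Z)
    else s%:R *+ (i.+1 == j).
  move=> i j; rewrite !mxE lcoefB lcoefCM lcoefXz.
  have -> : (0 == k%:Z) = false by apply/eqP; lia.
  rewrite mulr0 subr0; case: ifP => _; last by rewrite lconstE.
  by rewrite lcoefXzM sub0r -(rmorph_nat (@lconst C)) lcoefCM.
(* the trace of the sheared system has at most a simple pole, and k > 0 *)
have trM : \tr (lcoefmx 0 M) = 0.
  have := trace_intertwines Pu Pint.
  rewrite ramificationE mxtraceZ.
  have -> : \tr (map_mx (@lsubst_pow C s) G) = lsubst_pow s (\tr G).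
    by rewrite /mxtrace raddf_sum; apply: eq_bigr => i _; rewrite mxE.
  rewrite trG raddf0 mulr0 sub0r mxtraceZ => /(_ (- k.+1%:Z)).
  rewrite lcoefN lcoefXzM subrr => /(_ _)/eqP; rewrite oppr_eq0 => /(_ _)/eqP e.
  rewrite -[RHS]e; last lia.
  by rewrite /mxtrace lcoef_sum; apply: eq_bigr => i _; rewrite mxE.
have [c ev _] := eigenvalue_max (lcoefmx 0 M) n0.
apply: (eigenrow_split (c := c)) => //; last first.
  by move=> m B /andP[m0 mn]; apply: IH.
move=> N; apply/eqP => nil.
have c0 : c = 0.
  have /eqP := nilpotent_trace nil; rewrite raddfB /= trM mxtrace_scalar sub0r.
  by rewrite oppr_eq0 mulrn_eq0 => /orP[/eqP n0'|/eqP//]; move: n0; rewrite n0'.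
move: nil; rewrite c0 raddf0 subr0 => /nilpotent_exp nil.
(* the first row of M0^l is s^l e_l for l < n; one more step gives s^(n-1) times the
   last row of M0, which the slope makes nonzero *)
have pow : forall l (ln : (l < n)%N),
    row (Ordinal n0) (lcoefmx 0 M ^+ l) = (s%:R ^+ l) *: delta_mx 0 (Ordinal ln).
  elim=> [|l IHl] ln.
    rewrite mxexp0 row1 expr0 scale1r; congr delta_mx; exact: val_inj.
  rewrite mxexpSr row_mul (IHl (ltnW ln)) -scalemxAl -rowE.
  apply/rowP => j; rewrite [LHS]mxE [X in _ * X]mxE M0E /= ltn_eqF // exprSr.
  by rewrite -scalerA !mxE eqxx [in RHS]eq_sym mulr_natr.
have n1 : (n.-1 < n)%N by lia.
have /rowP/(_ j1) : row (Ordinal n0) (lcoefmx 0 M ^+ n) = 0 by rewrite nil row0.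
have -> : lcoefmx 0 M ^+ n = lcoefmx 0 M ^+ n.-1 *m lcoefmx 0 M.
  by rewrite -mxexpSr prednK.
rewrite row_mul (pow _ n1) -scalemxAl -rowE [LHS]mxE [X in _ * X]mxE M0E mxE /=
  prednK // eqxx => /eqP.
by rewrite !mulf_eq0 expf_eq0 pnatr_eq0 (negPf bj1) orbF -/s gtn_eqF // andbF.
Qed.

End EigenRow.

(** * Triangular form and its diagonal *)

(** What is asked at i depends on the values already chosen at smaller measure. The
    entries of a triangular matrix will be solved for in this way. *)
Lemma measured_choice (I T : Type) (f0 : I -> T) (mu : I -> nat)
    (R : I -> (I -> T) -> T -> Prop) :
    (forall i f, exists t, R i f t) ->
    (forall i f g t, (forall j, (mu j < mu i)%N -> f j = g j) ->
       R i f t -> R i g t) ->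
  exists f, forall i, R i f (f i).
Proof.
move=> Rex Rext.
have /boolp.choice[F FP] : forall p : I * (I -> T), exists t, R p.1 p.2 t.
  by move=> [i f]; apply: Rex.
pose f := fix f k i :=
  if k is k'.+1 then if (mu i < k')%N then f k' i else F (i, f k') else f0 i.
have stable k j : (mu j < k)%N -> f k j = f (mu j).+1 j.
  elim: k => // k IH; rewrite ltnS leq_eqVlt => /predU1P[<-//|jk].
  by rewrite -IH //= jk.
exists (fun i => f (mu i).+1 i) => i.
have -> : f (mu i).+1 i = F (i, f (mu i)) by rewrite /= ltnn.
by apply: Rext (FP (i, f (mu i))) => j ji; exact: stable.
Qed.

(** The exponents are kept as Laurent polynomials in degrees at most -2; the residue
    in degree -1 belongs to the constant matrix. *)
Definition polar (K : fieldType) (d : laurent K) : Prop :=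
  forall l, -1 <= l -> d l = 0.

Section TriangularForm.
Variable C : numClosedFieldType.
Local Notation L := (laurent C).

Lemma row_free_rV (F : fieldType) n (v : 'rV[F]_n) : v != 0 -> row_free v.
Proof.
move=> v0; apply: inj_row_free => u.
rewrite [u]mx11_scalar mul_scalar_mx => /eqP; rewrite scalemx_eq0 (negPf v0) orbF.
by move=> /eqP->; rewrite raddf0.
Qed.

(** A submodule of rank one gives the first row; the quotient by it has smaller
    rank. *)
Lemma triangular_form n (G : 'M[L]_n) :
  exists (r : nat) (T P : 'M[L]_n),
    [/\ (0 < r)%N, P \in unitmx, is_trig_mx T & intertwines T (ramification r G) P].
Proof.
elim: n G => [|n IH]; last rewrite -[n.+1]/(1 + n)%N; move=> G.
  exists 1%N, G, 1%:M; rewrite ramification1 unitmx1; split=> //.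
    by apply/is_trig_mxP => -[].
  by apply/matrixP => -[].
have [r [v [f [r0 v0 fv]]]] := eigenrow_exists G (ltn0Sn n).
have [Y Pu] := complete_row_free (p := n) (row_free_rV v0).
set P := col_mx v Y in Pu; set H := ramification r G in fv.
have Bint := intertwines_unit H Pu; set B := _ *m invmx P in Bint.
have uB : usubmx B = row_mx f%:M 0.
  apply: (can_inj (mulmxK Pu)); rewrite mul_usub_mx -Bint mul_row_col mul0mx addr0
    -fv.
  by rewrite /nabla mul_col_mx map_col_mx opp_col_mx add_col_mx col_mxKu.
have eB : B = block_mx f%:M 0 (dlsubmx B) (drsubmx B).
  by rewrite -{1}(vsubmxK B) uB -[dsubmx B]hsubmxK.
have [s [T [Q [s0 Qu Ttrig Qint]]]] := IH (drsubmx B).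
pose T' : 'M[L]_(1 + n) := block_mx (ramification s f%:M) 0
  (Q *m ((s%:R * lX ^+ s.-1) *: map_mx (@lsubst_pow C s) (dlsubmx B))) T.
have Q'int : intertwines T' (ramification s B) (block_mx 1%:M 0 0 Q).
  rewrite eB /T' /intertwines /nabla !ramificationE !map_block_mx raddf0
    scale_block_mx.
  rewrite scaler0 mxderiv1 !raddf0 !mulmx_block !(mul0mx, mulmx0, mul1mx, mulmx1,
    addr0, add0r).
  rewrite opp_block_mx add_block_mx !(addr0, oppr0, subr0); congr block_mx.
  exact: Qint.
exists (r * s)%N, T', (block_mx 1%:M 0 0 Q *m map_mx (@lsubst_pow C s) P); split.
- by rewrite muln_gt0 r0.
- by rewrite unitmx_mul subst_unitmx // andbT unitmxE det_ublock det1 mul1r -unitmxE.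
- rewrite is_trig_block_mx // eqxx Ttrig !andbT; apply/is_trig_mxP => i j.
  by rewrite !ord1.
rewrite -ramification_comp //; apply: intertwines_comp Q'int.
exact: intertwines_ramification.
Qed.

Lemma mxvanish_ex (K : fieldType) m n (X : 'M[laurent K]_(m, n)) :
  exists k : nat, mxvanish (- k%:Z) X.
Proof.
have /boolp.choice[a aP] : forall p : 'I_m * 'I_n, exists a : nat,
    vanish_below (- a%:Z) (X p.1 p.2).
  move=> p; have [a fa] := lcoefP (X p.1 p.2); exists (absz a).
  by move=> l la; apply: fa; lia.
exists (\max_p a p)%N => i j; apply: vanish_le (aP (i, j)).
by have := leq_bigmax (F := a) (i, j); lia.
Qed.

(** A representative of a modulo the integers. It is chosen, as the field need not be
    archimedean and then has no integer part. *)
Definition zrep (a : C) : C :=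
  xget 0 [set b | exists m : int, b = a + m%:~R]%classic.

Lemma zrep_ex a : exists m : int, zrep a = a + m%:~R.
Proof.
have aa : [set b | exists m : int, b = a + m%:~R]%classic a by exists 0;
  rewrite addr0.
exact: (xgetI 0 aa).
Qed.

Lemma zrepD a (m : int) : zrep (a + m%:~R) = zrep a.
Proof.
congr (xget 0 _); apply/seteqP; split=> b [k ->].
  by exists (m + k); rewrite intrD addrA.
by exists (k - m); rewrite intrB addrACA subrr addr0.
Qed.

Lemma Re_int (m : int) : 'Re (m%:~R : C) = m%:~R.
Proof. by apply/Creal_ReP; rewrite realz. Qed.

(** Only the real part is prescribed: this makes both s - t and s - conj(t) free of
    nonzero integers, the latter being needed to compare with conjugates. *)
Definition normalized (s : C) : Prop := 'Re s = zrep ('Re s).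

Lemma normalizedP s t (m : int) : normalized s -> normalized t ->
  'Re s = 'Re t + m%:~R -> m = 0.
Proof.
move=> ns nt e; have : 'Re s = 'Re t by rewrite ns e zrepD.
by move/eqP; rewrite e -subr_eq0 addrAC subrr add0r intr_eq0 => /eqP.
Qed.

Lemma normalized_sub s t (m : int) : normalized s -> normalized t ->
  s - t = m%:~R -> m = 0.
Proof.
move=> ns nt e; apply: normalizedP ns nt _.
have -> : s = t + m%:~R by rewrite -e addrC subrK.
by rewrite raddfD /= Re_int.
Qed.

Lemma normalized_conj s t (m : int) : normalized s -> normalized t ->
  s - t^* = m%:~R -> m = 0.
Proof.
move=> ns nt e; apply: normalizedP ns nt _.
have -> : s = t^* + m%:~R by rewrite -e addrC subrK.
by rewrite raddfD /= Re_int Re_conj.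
Qed.

(** The power series part of f is integrated by a regular solution of rank one, and
    a power of x shifts the residue by an integer. *)
Lemma rank_one_normal (f : L) : exists u d s,
  [/\ u != 0, polar d, normalized s
    & u * f - lderiv u = (d + lX ^ (-1) * lconst s) * u].
Proof.
have d_ok : exists a, vanish_below a (fun l => if l < -1 then f l else 0).
  by have [a fa] := lcoefP f; exists a => l /fa->; rewrite if_same.
pose d := Laurent d_ok.
have e1 : mxvanish 0 ((lX * (f - d))%:M : 'M[L]_1).
  move=> i j l l0; rewrite !ord1 mxE eqxx mulr1n lcoefXM lcoefB /=.
  by rewrite ifT ?subrr //; lia.
have [v [c [_ v0 _ cv]]] := frobenius_solution (ltn0Sn 0) e1.
set w := v 0 0.
have w0 : w != 0.
  apply: contraNneq v0 => w0; apply/eqP/matrixP => i j; rewrite !ord1 !mxE.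
  by rewrite -/w w0.
have [m em] := zrep_ex ('Re c).
exists (lX ^ (- m) * w), d, (c + m%:~R); split.
- by rewrite mulf_neq0 // expfz_neq0 // lX_neq0.
- by move=> l l1; rewrite /= ltNge l1.
- rewrite /normalized raddfD /= Re_int.
  by rewrite zrepD em.
have /matrixP/(_ 0 0) := cv; rewrite /nabla !mxE !big_ord1 !mxE eqxx !mulr1n -/w =>
  cw.
have eX : lX ^ (-1) * (lX * (f - d)) = f - d.
  by rewrite mulrA -[X in _ * X * _](expr1z lX) mulrC lX_mulVz mulr1.
rewrite eX in cw.
have {cw}w' : lderiv w = w * (f - d) - lX ^ (-1) * lconst c * w
  by rewrite -cw opprB addrC subrK.
rewrite lderivM lderivXz w' rmorphD rmorph_int.
have -> : lX ^ (- m - 1) = lX ^ (- m) * lX ^ (-1) :> L by rewrite expfzDr ?lX_neq0.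
rewrite mulrNz; ring.
Qed.

(** The coefficient of x^(l+1) in p is found by dividing by s - (l + 1). This can
    only vanish for l = -1, where g absorbs the obstruction. *)
Lemma solve_regular (s : C) (h : L) : (forall m : int, s = m%:~R -> m = 0) ->
  exists p g, p * (lX ^ (-1) * lconst s) - lderiv p = lX ^ (-1) * lconst g + h.
Proof.
move=> sP; pose q (l : int) : C := if l == 0 then 0 else h (l - 1) / (s - l%:~R).
have q_ok : exists a, vanish_below a q.
  have [a ha] := lcoefP h; exists (a + 1) => l la; rewrite /q ha ?mul0r ?if_same //;
    lia.
set p := Laurent q_ok; exists p, (- h (-1)); apply: laurentP => l.
have eL : (p * (lX ^ (-1) * lconst s)) l = s * q (l + 1).
  by rewrite mulrCA lcoefXzM mulrC lcoefCM opprK.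
have eR : (lX ^ (-1) * lconst (- h (-1))) l = - h (-1) *+ (l + 1 == 0).
  by rewrite lcoefXzM lconstE opprK.
rewrite lcoefB lcoefD eL eR lderivE -[p (l + 1)]/(q (l + 1)) -mulrBl /q addrK.
case: (eqVneq (l + 1) 0) => [l0|l0].
  have -> : l = -1 by lia.
  by rewrite mulr0 mulr1n addNr.
rewrite mulr0n add0r mulrC divfK //.
by apply: contraNneq l0 => /eqP; rewrite subr_eq0 => /eqP/sP ->.
Qed.

(** The pole of d has order at least 2, so that dividing by d outweighs the
    derivative: the equation is the fixed point of a contraction. *)
Lemma solve_irregular (d : L) (s : C) (h : L) : polar d -> d != 0 ->
  exists p, p * (d + lX ^ (-1) * lconst s) - lderiv p = h.
Proof.
move=> dpol d0; set g := d + _; have [a [da0 da]] := laurent_neq0 d0.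
have a2 : a <= -2.
  by rewrite leNgt; apply: contraNN da0 => a2; apply/eqP/dpol; lia.
have gE l : l < -1 -> g l = d l.
  move=> l1; rewrite lcoefD lcoefXzM lconstE; case: eqP => [e|_]; first by lia.
  by rewrite mulr0n addr0.
have ga : vanish_below a g by move=> l la; rewrite gE ?da //; lia.
have ga0 : g a != 0 by rewrite gE //; lia.
have g0 : g != 0 by apply: contraNneq ga0 => ->.
have gV := vanish_inv ga ga0.
have [b hb] := lcoefP h.
pose Phi (X : 'M[L]_1) : 'M[L]_1 := g^-1 *: (h%:M + mxderiv X).
have [||X [_ fixX]] := @contraction_fixpoint _ _ _ (b - a) Phi.
- move=> X Xv; rewrite [b - a]addrC; apply: mxvanishZ => //; apply: mxvanishD.
    by move=> i j; rewrite !ord1 mxE eqxx mulr1n.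
  by apply: mxvanish_le (mxvanish_deriv Xv); lia.
- move=> X Y N bN Xv Yv XY; rewrite /Phi -scalerBr opprD addrACA subrr add0r -raddfB.
  apply: (@mxvanish_le _ _ _ (- a + (N - 1))); first lia.
  by apply: mxvanishZ => //; exact: mxvanish_deriv.
exists (X 0 0); rewrite -{1}fixX !mxE eqxx mulr1n mulrAC mulVf // mul1r.
by rewrite addrK.
Qed.

End TriangularForm.

(** * The normal form over an algebraically closed field *)

Section ComplexNormalForm.
Variable C : numClosedFieldType.
Local Notation L := (laurent C).

Lemma diagonal_normal n (T : 'M[L]_n) : is_trig_mx T ->
  exists (U T' : 'M[L]_n) (d : 'I_n -> L) (s : 'I_n -> C),
    [/\ U \in unitmx, is_trig_mx T', intertwines T' T U,
        forall i, T' i i = d i + lX ^ (-1) * lconst (s i)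
      & forall i, polar (d i) /\ normalized (s i)].
Proof.
move=> /is_trig_mxP trT.
have /boolp.choice[x xP] : forall i, exists x : L * L * C,
    [/\ x.1.1 != 0, polar x.1.2, normalized x.2 &
      x.1.1 * T i i - lderiv x.1.1 = (x.1.2 + lX ^ (-1) * lconst x.2) * x.1.1].
  by move=> i; have [u [d [s P]]] := rank_one_normal (T i i); exists (u, d, s).
pose u i := (x i).1.1; have u0 i : u i != 0 by case: (xP i).
pose d i := (x i).1.2; pose s i := (x i).2.
pose T' : 'M[L]_n := \matrix_(i, j)
  (if i == j then d i + lX ^ (-1) * lconst (s i) else u i * T i j / u j).
exists (diag_mx (\row_i u i)), T', d, s; split.
- rewrite unitmxE det_diag unitfE; apply/prodf_neq0 => i _; by rewrite mxE.
- apply/is_trig_mxP => i j ij; rewrite mxE trT // mulr0 mul0r ifF //.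
  by apply: contraTF ij => /eqP->; rewrite ltnn.
- rewrite /intertwines /nabla mul_diag_mx mul_mx_diag.
  apply/matrixP => i j; rewrite !mxE; case: (eqVneq i j) => [->|ij].
    by rewrite mulr1n; case: (xP j).
  by rewrite mulr0n raddf0 subr0 divfK.
- by move=> i; rewrite mxE eqxx.
- by move=> i; case: (xP i).
Qed.

(** The off-diagonal entries are treated one by one, by increasing distance to the
    diagonal. The equation for the entry (i, j) has exponent d_j - d_i: it is solvable
    if this is not zero, and otherwise solvable up to a constant R_ij. *)
Lemma triangular_normal n (T : 'M[L]_n) : is_trig_mx T ->
  exists (P : 'M[L]_n) (d : 'I_n -> L) (R : 'M[C]_n),
    [/\ P \in unitmx, is_trig_mx R,
        intertwines (diag_mx (\row_i d i) + lX ^ (-1) *: R^lc) T P,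
        forall i, polar (d i) /\ normalized (R i i)
      & forall i j, R i j != 0 -> d i = d j].
Proof.
move=> /diagonal_normal[U [T' [d [s [Uu /is_trig_mxP trT' T'T Tii ds]]]]].
pose g i j := d j - d i + lX ^ (-1) * lconst (s j - s i).
(* the part of the equation for (i, j) that is already known *)
pose h (f : 'I_n * 'I_n -> L * C) (i j : 'I_n) : L :=
  lX ^ (-1) * (\sum_(k < n | (j < k < i)%N) lconst (f (i, k)).2 * (f (k, j)).1)
  - \sum_(k < n | (j < k <= i)%N) (f (i, k)).1 * T' k j.
pose Rel (p : 'I_n * 'I_n) f (t : L * C) :=
  let: (i, j) := p in
  if (i < j)%N then t = (0, 0) else if i == j then t = (1, s i) else
    t.1 * g i j - lderiv t.1 = lX ^ (-1) * lconst t.2 + h f i j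
    /\ (t.2 != 0 -> d i = d j).
pose mu (p : 'I_n * 'I_n) := (p.1 - p.2)%N.
have [||f fP] := @measured_choice _ _ (fun=> (0, 0)) mu Rel.
- move=> [i j] f /=; case: (i < j)%N; first by exists (0, 0).
  case: (i == j); first by exists (1, s i).
  have [[di ni] [dj nj]] := (ds i, ds j).
  have [dij|dij] := eqVneq (d i) (d j).
    have [|p [c pc]] := @solve_regular _ (s j - s i) (h f i j).
      by move=> m; apply: normalized_sub.
    by exists (p, c); split=> //=; rewrite /g dij subrr add0r.
  have [||p pP] := @solve_irregular _ (d j - d i) (s j - s i) (h f i j).
  - by move=> l l1; rewrite lcoefB di ?dj ?subrr.
  - by rewrite subr_eq0 eq_sym.
  by exists (p, 0); rewrite /= eqxx raddf0 mulr0 add0r.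
- move=> [i j] f f' t ff' /=; case: ifP => // /negbT; rewrite -leqNgt => ji.
  case: eqP => // /eqP ij [e e']; split=> //; rewrite e; congr (_ + _).
  have ltij : (j < i)%N by rewrite ltn_neqAle ji andbT eq_sym.
  congr (_ * _ - _); apply: eq_bigr => k /andP[jk ki].
    by rewrite !ff' //= /mu /=; lia.
  by rewrite ff' //= /mu /=; lia.
pose P : 'M[L]_n := \matrix_(i, j) (f (i, j)).1.
pose R : 'M[C]_n := \matrix_(i, j) (f (i, j)).2.
have fu (i j : 'I_n) : (i < j)%N -> f (i, j) = (0, 0) by move=> ij;
  have := fP (i, j); rewrite /= ij.
have fd (i : 'I_n) : f (i, i) = (1, s i) by have := fP (i, i); rewrite /= ltnn eqxx.
have fl (i j : 'I_n) : (j < i)%N ->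
    P i j * g i j - lderiv (P i j) = lX ^ (-1) * lconst (R i j) + h f i j
    /\ (R i j != 0 -> d i = d j).
  move=> ij; have := fP (i, j); rewrite /= ltnNge (ltnW ij) /=.
  by rewrite ifF ?mxE //; apply: contraTF ij => /eqP->; rewrite ltnn.
have trP : is_trig_mx P by apply/is_trig_mxP => i j ij; rewrite mxE fu.
have trR : is_trig_mx R by apply/is_trig_mxP => i j ij; rewrite mxE fu.
have Pu : P \in unitmx.
  rewrite unitmxE det_trig // big1 ?unitr1 // => i _; by rewrite mxE fd.
exists (P *m U), d, R; split=> //.
- by rewrite unitmx_mul Pu.
- apply: intertwines_comp T'T _; rewrite /intertwines /nabla mulmxDl mul_diag_mx
  -scalemxAl.
  apply/matrixP => i j; rewrite !mxE.
  rewrite (eq_bigr (fun k => (f (i, k)).1 * T' k j)) => [|k _]; last by rewrite mxE.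
  rewrite (eq_bigr (F1 := fun k => _ i k * _ k j)
    (fun k => lconst (f (i, k)).2 * (f (k, j)).1)) => [|k _]; last by rewrite !mxE.
  case: (ltngtP i j) => [ij|ji|/val_inj ij].
  + rewrite fu // raddf0 subr0 mulr0 add0r !big1 ?mulr0 // => k _.
      have [kj|jk] := ltnP k j; first by rewrite [f (k, j)]fu ?mulr0.
      by rewrite fu ?raddf0 ?mul0r //=; lia.
    have [kj|jk] := ltnP k j; first by rewrite trT' ?mulr0.
    by rewrite fu ?mul0r //; lia.
  + have [e _] := fl _ _ ji; rewrite !mxE in e.
    have nij : i != j by apply: contraTneq ji => ->; rewrite ltnn.
    have -> : \sum_k (f (i, k)).1 * T' k j = (f (i, j)).1 * T' j j +
        \sum_(k < n | (j < k <= i)%N) (f (i, k)).1 * T' k j.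
      rewrite (bigD1 j) //=; congr (_ + _); rewrite big_mkcond [RHS]big_mkcond.
      apply: eq_bigr => k _; case: (ltngtP k j) => [kj|jk|/val_inj->].
      * by rewrite trT' // mulr0 if_same.
      * have -> : k != j by apply: contraTneq jk => ->; rewrite ltnn.
        by case: leqP => // ik; rewrite fu ?mul0r.
      by rewrite eqxx.
    have -> : \sum_k lconst (f (i, k)).2 * (f (k, j)).1 = lconst (f (i, j)).2
        + lconst (s i) * (f (i, j)).1 +
        \sum_(k < n | (j < k < i)%N) lconst (f (i, k)).2 * (f (k, j)).1.
      rewrite (bigD1 j) //= (bigD1 i) //= !fd mulr1 addrA; congr (_ + _).
      rewrite big_mkcond [RHS]big_mkcond.
      apply: eq_bigr => k _; case: (ltngtP k j) => [kj|jk|/val_inj->].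
      * by rewrite [f (k, j)]fu // mulr0 if_same.
      * have -> : k != j by apply: contraTneq jk => ->; rewrite ltnn.
        case: (ltngtP k i) => [ki|ik|/val_inj->]; rewrite ?eqxx //=.
          by rewrite ifT //; apply: contraTneq ki => ->; rewrite ltnn.
        by rewrite fu // raddf0 mul0r if_same.
      by rewrite eqxx.
    have -> : lderiv (f (i, j)).1 = (f (i, j)).1 * g i j
        - (lX ^ (-1) * lconst (f (i, j)).2 + h f i j) by rewrite -e; ring.
    rewrite Tii /g /h rmorphB; ring.
  rewrite -{j}ij fd lderiv1 subr0 mulr1 (bigD1 i) //= big1 => [|k ki]; last first.
    case: (ltngtP k i) => [lt|gt|/val_inj e]; last by rewrite e eqxx in ki.
      by rewrite trT' // mulr0.
    by rewrite fu // mul0r.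
  rewrite (bigD1 i) //= big1 => [|k ki]; last first.
    case: (ltngtP k i) => [lt|gt|/val_inj e]; last by rewrite e eqxx in ki.
      by rewrite [f (k, i)]fu // mulr0.
    by rewrite fu // raddf0 mul0r.
  by rewrite fd mul1r mulr1 !addr0 Tii.
- by move=> i; rewrite mxE fd; apply: ds.
move=> i j; have [ij|ji] := ltnP i j; first by rewrite mxE fu // eqxx.
have [->//|ij] := eqVneq i j.
by apply: (proj2 (fl _ _ _)); rewrite ltn_neqAle ji andbT eq_sym.
Qed.

(** The theorem of Hukuhara, Levelt and Turrittin, with residues normalised so that P
    can be compared with its conjugate. Multiplying P by a power of x clears its
    denominators at the price of shifting all residues by the same integer. *)
Theorem complex_normal_form n (G : 'M[L]_n) :
  exists (r : nat) (P : 'M[L]_n) (d : 'I_n -> L) (R : 'M[C]_n),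
    [/\ [/\ (0 < r)%N, P \in unitmx & mxvanish 0 P],
        intertwines (diag_mx (\row_i d i) + lX ^ (-1) *: R^lc) (ramification r G) P,
        (forall i, polar (d i)) /\ (forall i j, R i j != 0 -> d i = d j),
        is_trig_mx R
      & forall i j (m : int), R i i - (R j j)^* = m%:~R -> m = 0].
Proof.
have [r [T [P1 [r0 P1u trT P1int]]]] := triangular_form G.
have [P2 [d [R [P2u trR P2int dR Rd]]]] := triangular_normal trT.
have Pint := intertwines_comp P1int P2int.
have Pu : P2 *m P1 \in unitmx by rewrite unitmx_mul P2u.
move: (P2 *m P1) Pu Pint => P Pu Pint; have [k Pk] := mxvanish_ex P.
have Ru i : (R - k%:R%:M) i i = R i i - k%:R by rewrite !mxE eqxx.
exists r, (lX ^ k%:Z *: P), d, (R - k%:R%:M); split.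
- split=> //; first by rewrite unitmxZ // unitfE expfz_neq0 // lX_neq0.
  by rewrite -(subrr k%:Z); apply: mxvanishZ Pk; exact: vanishXz.
- rewrite /intertwines nablaZ Pint lderivXz map_mxB map_scalar_mx -scalemxAr.
  rewrite scalerBr addrA mulmxBl scalerBr; congr (_ - _).
  rewrite scale_scalar_mx mul_scalar_mx !scalerA; congr (_ *: _).
  rewrite expfzDr ?lX_neq0 // (rmorph_nat (@lconst C)) -pmulrn; ring.
- split=> [i|i j]; first by case: (dR i).
  rewrite !mxE; case: (eqVneq i j) => [->//|_]; rewrite subr0; exact: Rd.
- apply/is_trig_mxP => i j ij; rewrite !mxE (is_trig_mxP trR) // sub0r.
  by rewrite (_ : (i == j) = false) ?oppr0 //; apply: contraTF ij => /eqP->;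
    rewrite ltnn.
- move=> i j m; rewrite !Ru rmorphB rmorph_nat opprB addrA subrK.
  by apply: normalized_conj; [case: (dR i) | case: (dR j)].
Qed.

End ComplexNormalForm.

(** * Descent to the real field *)

Section Descent.
Variable C : numClosedFieldType.
Local Notation L := (laurent C).
Local Notation conjl := (lmap (@Num.conj C)).
Local Notation "X ^cj" := (map_mx Num.conj X) (at level 2, format "X ^cj").
Local Notation "X ^bar" := (map_mx conjl X) (at level 2, format "X ^bar").

Lemma lmapK : involutive conjl.
Proof. by move=> f; apply: laurentP => l; rewrite !lmapE; exact: conjCK. Qed.

Lemma barK m n (X : 'M[L]_(m, n)) : X^bar^bar = X.
Proof. by apply/matrixP => i j; rewrite !mxE lmapK. Qed.

Lemma bar_const m n (X : 'M[C]_(m, n)) : X^lc^bar = X^cj^lc.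
Proof. by apply/matrixP => i j; rewrite !mxE lmap_const. Qed.

Lemma bar_deriv m n (X : 'M[L]_(m, n)) : (mxderiv X)^bar = mxderiv X^bar.
Proof. by apply/matrixP => i j; rewrite !mxE lmap_deriv. Qed.

Lemma nabla_bar m n (G : 'M[L]_n) (X : 'M[L]_(m, n)) :
  (nabla G X)^bar = nabla G^bar X^bar.
Proof. by rewrite /nabla map_mxB map_mxM bar_deriv. Qed.

(** The leading terms of p and d multiply to a term of lower degree than any term of
    the derivative of p. *)
Lemma irregular_uniq (p d : L) (s : C) : polar d -> d != 0 ->
  p * (d + lX ^ (-1) * lconst s) - lderiv p = 0 -> p = 0.
Proof.
move=> dpol d0 e; apply/eqP; apply/negP => /negP p0.
have [a [da0 da]] := laurent_neq0 d0; have [b [pb0 pb]] := laurent_neq0 p0.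
have a2 : a <= -2.
  by rewrite leNgt; apply: contraNN da0 => a2; apply/eqP/dpol; lia.
have gv : vanish_below (-1) (lX ^ (-1) * lconst s).
  by rewrite -[-1]addr0; apply: vanishM; [exact: vanishXz | exact: vanish_const].
have ga : vanish_below a (d + lX ^ (-1) * lconst s).
  by apply: vanishD => //; apply: vanish_le gv; lia.
have := lcoefM_lead pb ga; move/eqP: e; rewrite subr_eq0 => /eqP ->.
rewrite lcoefD (gv a); last lia.
rewrite addr0 lderivE pb ?mulr0; last lia.
by move/esym/eqP; rewrite mulf_eq0 (negPf pb0) (negPf da0).
Qed.

Variables (n : nat) (G P : 'M[L]_n) (d : 'I_n -> L) (R : 'M[C]_n).
Hypothesis (G_real : G^bar = G) (Pu : P \in unitmx).
Hypothesis Pint : intertwines (diag_mx (\row_i d i) + lX ^ (-1) *: R^lc) G P.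
Hypothesis dpol : forall i, polar (d i).
Hypothesis Rd : forall i j, R i j != 0 -> d i = d j.
Hypothesis Rtrig : is_trig_mx R.
Hypothesis Rnorm : forall i j (m : int), R i i - (R j j)^* = m%:~R -> m = 0.

(** The matrix U = conj(P) P^-1 solves a linear system between the normal form and
    its conjugate. Where the exponents differ the entry is 0; where they agree the
    coefficient of x^m in it is multiplied by R_jj - conj(R_ii) - m, which is not
    zero for m other than 0. The entries come in the triangular order of R. *)
Lemma conj_cocycle : exists U : 'M[C]_n,
  P^bar = U^lc *m P /\ (forall i j, U i j != 0 -> conjl (d i) = d j).
Proof.
pose D := diag_mx (\row_i d i).
have PintD : intertwines (D + lX ^ (-1) *: R^lc) G P := Pint.
have Pbu : P^bar \in unitmx by rewrite map_unitmx.
have Pbint : intertwines (D^bar + lX ^ (-1) *: R^cj^lc) G P^bar.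
  have e : nabla G P^bar = (nabla G P)^bar by rewrite nabla_bar G_real.
  rewrite /intertwines e PintD map_mxM map_mxD map_mxZ bar_const.
  by rewrite /= lmapXz.
have Uint := intertwines_comp (intertwines_inv Pu PintD) Pbint.
set U := _ *m _ in Uint.
have DRE i j (U' : 'M[L]_n) : (U' *m (D + lX ^ (-1) *: R^lc)) i j =
    U' i j * d j + lX ^ (-1) * \sum_k U' i k * lconst (R k j).
  rewrite mulmxDr mul_mx_diag -scalemxAr !mxE; congr (_ + _ * _).
  by apply: eq_bigr => k _; rewrite mxE.
have DRbE i j (U' : 'M[L]_n) : ((D^bar + lX ^ (-1) *: R^cj^lc) *m U') i j =
    conjl (d i) * U' i j + lX ^ (-1) * \sum_k lconst (R i k)^* * U' k j.
  rewrite mulmxDl map_diag_mx mul_diag_mx -scalemxAl !mxE; congr (_ + _ * _).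
  by apply: eq_bigr => k _; rewrite !mxE.
have UE i j :
    U i j * d j + lX ^ (-1) * (\sum_k U i k * lconst (R k j)) - lderiv (U i j)
    = conjl (d i) * U i j + lX ^ (-1) * \sum_k lconst (R i k)^* * U k j.
  by rewrite -DRE -DRbE -Uint !mxE.
have {}UE i j :
    U i j * (d j - conjl (d i) + lX ^ (-1) * lconst (R j j - (R i i)^*))
    - lderiv (U i j)
    = lX ^ (-1) * (\sum_(k | k != i) lconst (R i k)^* * U k j
                   - \sum_(k | k != j) U i k * lconst (R k j)).
  have := UE i j; rewrite (bigD1 j) //= [in RHS](bigD1 i) //= rmorphB => e.
  apply/eqP; rewrite -subr_eq0; move/eqP: e; rewrite -subr_eq0 => /eqP e.
  by apply/eqP; rewrite -[RHS]e; ring.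
have main N (i j : 'I_n) : (i + (n - j) < N)%N ->
    (exists c, U i j = lconst c) /\ (U i j != 0 -> conjl (d i) = d j).
  elim: N i j => // N IH i j ijN.
  have RU (k : 'I_n) : k != i -> R i k != 0 -> (k + (n - j) < N)%N.
    move=> ki; have [ik|] := ltnP i k; last first.
      by rewrite leq_eqVlt => /predU1P[/val_inj e|]; [rewrite e eqxx in ki | lia].
    by rewrite (is_trig_mxP Rtrig) // eqxx.
  have UR (k : 'I_n) : k != j -> R k j != 0 -> (i + (n - k) < N)%N.
    move=> kj; have [jk|] := ltnP j k; first by have := ltn_ord k; lia.
    rewrite leq_eqVlt => /predU1P[/val_inj e|lt]; first by rewrite e eqxx in kj.
    by rewrite (is_trig_mxP Rtrig) // eqxx.
  have [dij|dij] := eqVneq (conjl (d i)) (d j); last first.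
    suff -> : U i j = 0 by split=> [|/eqP//]; exists 0; rewrite raddf0.
    apply: (irregular_uniq (d := d j - conjl (d i)) (s := R j j - (R i i)^*)).
    - by move=> l l1; rewrite lcoefB dpol // lmapE dpol // rmorph0 subr0.
    - by rewrite subr_eq0 eq_sym.
    rewrite UE !big1 ?subrr ?mulr0 // => k kn.
      have [->|Rk] := eqVneq (R k j) 0; first by rewrite raddf0 mulr0.
      have [_ Uk] := IH _ _ (UR _ kn Rk); have [->|/Uk e] := eqVneq (U i k) 0;
        rewrite ?mul0r //.
      by rewrite e (Rd Rk) eqxx in dij.
    have [->|Rk] := eqVneq (R i k) 0; first by rewrite conjC0 raddf0 mul0r.
    have [_ Uk] := IH _ _ (RU _ kn Rk); have [->|/Uk e] := eqVneq (U k j) 0;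
      rewrite ?mulr0 //.
    by rewrite (Rd Rk) e eqxx in dij.
  split=> //; have := UE i j; rewrite dij subrr add0r.
  have [c ->] : exists c, \sum_(k | k != i) lconst (R i k)^* * U k j
                   - \sum_(k | k != j) U i k * lconst (R k j) = lconst c.
    have H1 k : exists c, k != i -> lconst (R i k)^* * U k j = lconst c.
      have [Rk|Rk] := eqVneq (R i k) 0; first by exists 0;
        rewrite Rk conjC0 raddf0 mul0r.
      have [->|kn] := eqVneq k i; first by exists 0.
      by have [[c ->] _] := IH _ _ (RU _ kn Rk); exists ((R i k)^* * c);
        rewrite rmorphM.
    have H2 k : exists c, k != j -> U i k * lconst (R k j) = lconst c.
      have [Rk|Rk] := eqVneq (R k j) 0; first by exists 0; rewrite Rk raddf0 mulr0.
      have [->|kn] := eqVneq k j; first by exists 0.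
      by have [[c ->] _] := IH _ _ (UR _ kn Rk); exists (c * R k j); rewrite rmorphM.
    have [/boolp.choice[c1 c1P] /boolp.choice[c2 c2P]] := (H1, H2).
    exists (\sum_(k | k != i) c1 k - \sum_(k | k != j) c2 k).
    by rewrite rmorphB !rmorph_sum; congr (_ - _); apply: eq_bigr => k /[dup] kn;
      [move/c1P | move/c2P].
  move=> e; exists (U i j 0); apply: laurentP => l; rewrite lconstE.
  have [->|l0] := eqVneq l 0; first by rewrite mulr1n.
  have := congr1 (fun f : L => f (l - 1)) e.
  rewrite lcoefB mulrCA lcoefXzM mulrC lcoefCM lcoefXzM lconstE lderivE opprK subrK
    (negPf l0) mulr0n.
  rewrite -mulrBl => /eqP; rewrite mulf_eq0 => /orP[|/eqP//].
  by rewrite subr_eq0 => /eqP/Rnorm => e0; rewrite e0 eqxx in l0.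
exists (lcoefmx 0 U); have Uc : (lcoefmx 0 U)^lc = U.
  apply/matrixP => i j; rewrite [LHS]mxE [X in lconst X]mxE.
  by have [[c ->] _] := main _ i j (ltnSn _); rewrite lconstE.
split; first by rewrite Uc /U mulmxKV.
move=> i j; rewrite [X in X != 0]mxE => Uij; have [_] := main _ i j (ltnSn _); apply.
by apply: contraNneq Uij => ->.
Qed.

(** The semilinear map w |-> conj(w) U on constant rows is an involution, since
    conj(U) U = 1, and w P is real when w is fixed by it. It maps the rows supported on
    an exponent to those supported on the conjugate exponent. Real exponents thus have
    a basis of fixed rows, which gives X; Y takes one exponent from each conjugate
    pair. *)
Lemma real_structure : mxvanish 0 P ->
  exists n1 n2 (X : 'M[L]_(n1, n)) (Y : 'M[L]_(n2, n))
    (e : 'I_n1 -> L) (h : 'I_n2 -> L) (C1 : 'M[C]_n1) (C2 : 'M[C]_n2),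
  [/\ [/\ (n1 + (n2 + n2))%N = n, row_full (col_mx X (col_mx Y Y^bar)),
          mxvanish 0 X & mxvanish 0 Y],
      X^bar = X /\ C1^cj = C1,
      nabla G X = (diag_mx (\row_i e i) + lX ^ (-1) *: C1^lc) *m X
      /\ nabla G Y = (diag_mx (\row_i h i) + lX ^ (-1) *: C2^lc) *m Y,
      (forall i, polar (e i) /\ conjl (e i) = e i)
      /\ (forall i, polar (h i) /\ conjl (h i) <> h i)
    & comm_mx (diag_mx (\row_i e i)) C1^lc /\ comm_mx (diag_mx (\row_i h i)) C2^lc].
Proof.
move=> P0; have [U [PU Ud]] := conj_cocycle; pose D := diag_mx (\row_i d i).
have PintD : nabla G P = (D + lX ^ (-1) *: R^lc) *m P := Pint.
have lc_inj m p (M N : 'M[C]_(m, p)) : M^lc = N^lc -> M = N.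
  by move=> /(congr1 (lcoefmx 0)); rewrite !lcoefmx_const !mulr1n.
have UU : U^cj *m U = 1%:M.
  apply: lc_inj; rewrite map_mxM map_mx1; apply: (can_inj (mulmxK Pu)).
  by rewrite mul1mx -mulmxA -PU -bar_const -map_mxM -PU barK.
have Uu : U \in unitmx by have/mulmx1_unit[] := UU.
have UR : U *m R = R^cj *m U.
  have e : U^lc *m (D + lX ^ (-1) *: R^lc) = (D^bar + lX ^ (-1) *: R^cj^lc) *m U^lc.
    apply: (can_inj (mulmxK Pu)); rewrite -!mulmxA -PintD -PU -nabla_const -PU.
    have -> : nabla G P^bar = (nabla G P)^bar by rewrite nabla_bar G_real.
    by rewrite PintD map_mxM map_mxD map_mxZ bar_const /= lmapXz.
  have := congr1 (lcoefmx (-1)) e.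
  rewrite lcoefmx_constl lcoefmx_constr !lcoefmxD !lcoefmxXz subrr !lcoefmx_const
    !mulr1n.
  have -> : lcoefmx (-1) D = 0.
    by apply/matrixP => i j; rewrite !mxE; case: eqP => // _; rewrite mulr1n dpol.
  have -> : lcoefmx (-1) D^bar = 0.
    apply/matrixP => i j; rewrite !mxE; case: eqP => [_|]; last
      by rewrite mulr0n raddf0.
    by rewrite mulr1n lmapE dpol // rmorph0.
  by rewrite !add0r.
have DR : D *m R^lc = R^lc *m D.
  rewrite mul_diag_mx mul_mx_diag; apply/matrixP => i j; rewrite !mxE.
  have [->|/Rd->] := eqVneq (R i j) 0; first by rewrite raddf0 mulr0 mul0r.
  by rewrite mulrC.
pose re (x : L) := conjl x == x.
(* rep chooses one member of each pair of conjugate exponents, up recognises it *)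
pose rep (x : L) := xget 0 [set y | y = x \/ y = conjl x]%classic.
pose up (x : L) := ~~ re x && (x == rep x).
have repJ x : rep (conjl x) = rep x.
  by congr (xget 0 _); apply/seteqP; split=> y [->|->]; rewrite ?lmapK;
    [right|left|right|left].
have repP x : rep x = x \/ rep x = conjl x.
  have xx : [set y | y = x \/ y = conjl x]%classic x by left.
  exact: (xgetI 0 xx).
have reJ x : re (conjl x) = re x by rewrite /re lmapK eq_sym.
have upJ x : ~~ re x -> up (conjl x) = ~~ up x.
  move=> nre; rewrite /up reJ nre repJ /=; have nre' : (conjl x == x) =
    false by apply/negbTE.
  by have [->|->] := repP x; rewrite ?eqxx ?nre' // eq_sym nre'.
(* The rows of Fam are fixed, and span the rows supported on real exponents: they are
   w + conj(w) U and i (w - conj(w) U) for the unit rows w. Each of them is supported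
   on a single exponent, and so are the rows of the basis f extracted from Fam. *)
pose IR : 'M[C]_n := diag_mx (\row_i (re (d i))%:R).
have IRE (m : nat) (w : 'M[C]_(m, n)) : (forall i j, w i j != 0 -> re (d j)) -> w *m
  IR = w.
  move=> wre; rewrite mul_mx_diag; apply/matrixP => i j; rewrite !mxE.
  by have [->|/wre->] := eqVneq (w i j) 0; rewrite ?mul0r ?mulr1.
have IRcj : IR^cj = IR.
  by rewrite map_diag_mx; congr diag_mx; apply/rowP => i; rewrite !mxE rmorph_nat.
pose Fam : 'M[C]_(n + n, n) := col_mx (IR + IR *m U) ('i *: (IR - IR *m U)).
have FamU : Fam^cj *m U = Fam.
  rewrite map_col_mx mul_col_mx map_mxZ map_mxB map_mxD map_mxM IRcj /= conjCi.
  rewrite -scalemxAl mulmxDl mulmxBl -mulmxA UU mulmx1.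
  by rewrite [IR *m U + IR]addrC scaleNr -scalerN opprB.
pose idx (a : 'I_(n + n)) := match split a with inl j => j | inr j => j end.
have FamP a j : Fam a j != 0 -> re (d (idx a)) /\ d j = d (idx a).
  have base i : (IR + IR *m U) i j != 0 \/ (IR - IR *m U) i j != 0 -> re (d i) /\ d j
    = d i.
    rewrite /IR mul_diag_mx !mxE => nz; have rei : re (d i).
      by apply: contraT => /negPf nre; move: nz;
        rewrite nre !mul0r mul0rn !(addr0, subr0) eqxx; case.
    split=> //; have [->//|ij] := eqVneq i j; have /eqP <- := rei.
    symmetry; apply: Ud; move: nz; rewrite (negPf ij) mulr0n rei !mul1r add0r sub0r
      oppr_eq0.
    by case.
  rewrite /idx mxE; case: (split a) => i nz; apply: base; first by left.
  by right; apply: contraNneq nz => z; rewrite mxE z mulr0.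
pose n1 := \rank Fam; pose mf := maxrankfun Fam.
pose f : 'M[C]_(n1, n) := rowsub mf Fam.
have f_free : row_free f := maxrowsub_free Fam.
have fE l j : f l j = Fam (mf l) j by rewrite mxE.
have fU : f^cj *m U = f.
  apply/matrixP => l j; rewrite fE.
  transitivity ((Fam^cj *m U) (mf l) j); last by rewrite FamU.
  by rewrite ![(_ *m U) _ _]mxE; apply: eq_bigr => k _; congr (_ * _); rewrite !mxE.
pose e l := if re (d (idx (mf l))) then d (idx (mf l)) else 0.
have fP l j : f l j != 0 -> re (d j) /\ d j = e l.
  by rewrite fE => /FamP[rei dj]; rewrite /e rei dj.
have f_span m (w : 'M[C]_(m, n)) : (forall i j, w i j != 0 -> re (d j)) -> (w <=
  f)%MS.
  move=> /IRE <-; apply: submx_trans (submxMl _ _) _; rewrite eq_maxrowsub.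
  have -> : IR = row_mx (2^-1)%:M (- (2^-1 * 'i))%:M *m Fam.
    rewrite mul_row_col !mul_scalar_mx scalerA mulNr -mulrA -expr2 sqrCi mulrN1 opprK.
    rewrite -scalerDr addrACA subrr addr0 -mulr2n -scaler_nat scalerA mulVf ?scale1r
      //.
    by rewrite pnatr_eq0.
  exact: submxMl.
have mulR_supp m (w : 'M[C]_(m, n)) (S : L -> Prop) :
    (forall i j, w i j != 0 -> S (d j)) -> forall i j, (w *m R) i j != 0 -> S (d j).
  move=> wS i j; rewrite mxE => nz; have [k] : exists k, w i k * R k j != 0.
    apply: contrapT => nk; case/eqP: nz; apply: big1 => k _; apply/eqP;
      apply: contrapT => /negP nz.
    by apply: nk; exists k.
  by rewrite mulf_eq0 negb_or => /andP[/wS Sk /Rd <-].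
have [C1 fR] : exists C1, f *m R = C1 *m f.
  by apply/submxP/f_span/(@mulR_supp _ _ re) => i j /fP[].
have C1_real : C1^cj = C1.
  apply: (row_free_inj f_free); rewrite /= -fR -{2}fU -mulmxA UR mulmxA -map_mxM.
  by rewrite fR map_mxM -mulmxA fU.
have lc_free m p (M : 'M[C]_(m, p)) : row_free M -> row_free M^lc
  by rewrite row_free_map.
have fD : f^lc *m D = diag_mx (\row_i e i) *m f^lc.
  rewrite mul_diag_mx mul_mx_diag; apply/matrixP => i j; rewrite [LHS]mxE [RHS]mxE.
  rewrite [X in _ * X = _]mxE [X in _ = X * _]mxE [X in X * _]mxE [X in _ = _ * X]mxE.
  have [->|/fP[_ ->]] := eqVneq (f i j) 0; last by rewrite mulrC.
  by rewrite raddf0 mulr0 mul0r.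
pose H := [set i | up (d i)]; pose n2 := #|H|.
pose g : 'M[C]_(n2, n) := \matrix_(l, j) (enum_val l == j)%:R.
pose h (l : 'I_n2) : L := d (enum_val l).
have hP (l : 'I_n2) : up (h l) by have := enum_valP l; rewrite inE.
have gP l j : g l j != 0 -> d j = h l /\ up (d j).
  rewrite mxE; have [<- _|_] := eqVneq (enum_val l) j; last by rewrite eqxx.
  by split=> //; apply: hP.
have mulg m (b : 'M[C]_(m, n2)) i (l : 'I_n2) : (b *m g) i (enum_val l) = b i l.
  rewrite mxE (bigD1 l) //= mxE eqxx mulr1 big1 ?addr0 // => k kl.
  by rewrite mxE (inj_eq enum_val_inj) (negPf kl) mulr0.
have g_free : row_free g.
  apply: inj_row_free => v vg; apply/rowP => l; by rewrite -mulg vg !mxE.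
have g_span m (w : 'M[C]_(m, n)) : (forall i j, w i j != 0 -> up (d j)) -> (w <=
  g)%MS.
  move=> wup; apply/submxP; exists (\matrix_(i, l) w i (enum_val l)).
  apply/matrixP => i j; have [jH|jH] := boolP (j \in H).
    by rewrite -(enum_rankK_in jH jH) mulg mxE.
  have -> : w i j = 0 by apply: contraNeq jH => /wup; rewrite inE.
  rewrite mxE big1 // => l _; have [->|/gP[_ uj]] := eqVneq (g l j) 0;
    first by rewrite mulr0.
  by rewrite inE uj in jH.
have [C2 gR] : exists C2, g *m R = C2 *m g.
  by apply/submxP/g_span/(@mulR_supp _ _ up) => i j /gP[].
have gD : g^lc *m D = diag_mx (\row_i h i) *m g^lc.
  rewrite mul_diag_mx mul_mx_diag; apply/matrixP => i j; rewrite !mxE.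
  have [ij|ij] := eqVneq (enum_val i) j; last by rewrite raddf0 mulr0 mul0r.
  by rewrite /h ij mulrC.
have commut m (w : 'M[C]_(m, n)) (x : 'I_m -> L) (B : 'M[C]_m) : row_free w ->
    w^lc *m D = diag_mx (\row_i x i) *m w^lc -> w *m R = B *m w ->
    comm_mx (diag_mx (\row_i x i)) B^lc.
  move=> /lc_free wf wD wR; apply: (row_free_inj wf) => /=.
  have wR' : w^lc *m R^lc = B^lc *m w^lc by rewrite -!map_mxM wR.
  by rewrite -mulmxA -wR' mulmxA -wD -mulmxA DR mulmxA wR' -mulmxA wD mulmxA.
have solution m (w : 'M[C]_(m, n)) (x : 'I_m -> L) (B : 'M[C]_m) :
    w^lc *m D = diag_mx (\row_i x i) *m w^lc -> w *m R = B *m w ->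
    nabla G (w^lc *m P) = (diag_mx (\row_i x i) + lX ^ (-1) *: B^lc) *m (w^lc *m P).
  move=> wD wR; rewrite nabla_const PintD !mulmxA mulmxDr mulmxDl wD.
  by rewrite -scalemxAr -scalemxAl -!map_mxM wR map_mxM !mulmxDl -!scalemxAl.
pose S := col_mx f (col_mx g (g^cj *m U)).
have gcj : g^cj = g by apply/matrixP => i j; rewrite !mxE rmorph_nat.
have gUP l j : (g^cj *m U) l j != 0 -> ~~ re (d j) /\ ~~ up (d j).
  rewrite gcj mxE (bigD1 (enum_val l)) //= mxE eqxx mul1r big1 ?addr0 =>
    [/Ud <-|k kl].
    have := hP l; rewrite /h => ul; have /andP[nre _] := ul.
    by rewrite reJ upJ // ul.
  by rewrite mxE eq_sym (negPf kl) mul0r.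
have S_full : row_full S.
  rewrite -sub1mx; apply/row_subP => j; rewrite row1.
  have deltaP (i k : 'I_n) : (delta_mx (0 : 'I_1) i : 'rV[C]_n) 0 k != 0 -> k = i.
    by rewrite mxE eqxx /=; have [//|] := eqVneq k i; rewrite eqxx.
  have [rej|nrej] := boolP (re (d j)).
    apply: (submx_trans (f_span _ _ _)) => [i k|]; last by rewrite -addsmxE addsmxSl.
    by rewrite ord1 => /deltaP->.
  have S2 : (col_mx g (g^cj *m U) <= S)%MS by rewrite -(addsmxE f) addsmxSr.
  apply: submx_trans S2; have [upj|nupj] := boolP (up (d j)).
    apply: (submx_trans (g_span _ _ _)) => [i k|]; last by rewrite -addsmxE addsmxSl.
    by rewrite ord1 => /deltaP->.
  apply: (@submx_trans _ _ _ _ _ _ (g^cj *m U)); last by rewrite -addsmxE addsmxSr.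
  have /submxP[b eb] : ((delta_mx (0 : 'I_1) j : 'rV[C]_n) *m U <= g)%MS.
    by apply: g_span => i k; rewrite -rowE mxE => /Ud <-; rewrite upJ.
  apply/submxP; exists b^cj; rewrite mulmxA -map_mxM -eb map_mxM -mulmxA UU mulmx1.
  by apply/matrixP => i k; rewrite !mxE rmorph_nat.
have S_free : row_free S.
  apply: inj_row_free => v; rewrite -[v]hsubmxK; set a := lsubmx v.
  rewrite -[rsubmx v]hsubmxK; set b := lsubmx _; set c := rsubmx _.
  rewrite !mul_row_col => vS.
  have supp m (w : 'rV[C]_m) (M : 'M[C]_(m, n)) (T : L -> Prop) j :
      (forall i j, M i j != 0 -> T (d j)) -> ~ T (d j) -> (w *m M) 0 j = 0.
    move=> MT nT; rewrite mxE big1 // => k _.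
    by have [->|/MT//] := eqVneq (M k j) 0; rewrite mulr0.
  have vSj j : (a *m f) 0 j + ((b *m g) 0 j + (c *m (g^cj *m U)) 0 j) = 0.
    by have /rowP/(_ j) := vS; rewrite !mxE.
  have fs j := supp _ a f (fun x => re x) j (fun i j nz => proj1 (fP i j nz)).
  have gs j := supp _ b g (fun x => up x) j (fun i j nz => proj2 (gP i j nz)).
  have us j := supp _ c _ (fun x => ~~ re x /\ ~~ up x) j gUP.
  have upre x : up x -> ~~ re x by case/andP.
  have a0 : a = 0.
    apply: (row_free_inj f_free); rewrite /= mul0mx; apply/rowP => j;
      rewrite [RHS]mxE.
    have [rej|nrej] := boolP (re (d j)); last by apply: fs; apply/negP.
    rewrite -[RHS](vSj j) gs; last by move=> /upre; rewrite rej.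
    by rewrite us ?addr0 // rej => -[].
  have b0 : b = 0.
    apply: (row_free_inj g_free); rewrite /= mul0mx; apply/rowP => j;
      rewrite [RHS]mxE.
    have [upj|nupj] := boolP (up (d j)); last by apply: gs; apply/negP.
    rewrite -[RHS](vSj j) a0 mul0mx [(0 : 'rV_n) _ _]mxE add0r us ?addr0 //.
    by rewrite upj => -[].
  have c0 : c = 0.
    apply: (row_free_inj g_free); rewrite /= mul0mx -{1}gcj.
    apply: (can_inj (mulmxK Uu)); rewrite mul0mx -mulmxA; apply/rowP => j.
    rewrite [RHS]mxE -[RHS](vSj j) a0 b0 !mul0mx.
    by rewrite [X in _ = X + _]mxE [X in _ = _ + (X + _)]mxE !add0r.
  by rewrite a0 b0 c0 !row_mx0.
have dimS : (n1 + (n2 + n2))%N = n by rewrite -(eqP S_free) (eqP S_full).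
have YU : (g^lc *m P)^bar = (g^cj *m U)^lc *m P.
  by rewrite map_mxM PU bar_const map_mxM mulmxA.
exists n1, n2, (f^lc *m P), (g^lc *m P), e, h, C1, C2; split.
- split=> //.
  + rewrite YU -!mul_col_mx -!map_col_mx -/S.
    have /row_fullP[B BS] := S_full; apply/row_fullP; exists (invmx P *m B^lc).
    by rewrite -!mulmxA (mulmxA B^lc) -map_mxM BS map_mx1 mul1mx mulVmx.
  + by rewrite -[0]addr0; apply: mxvanishM (mxvanish_const _) P0.
  + by rewrite -[0]addr0; apply: mxvanishM (mxvanish_const _) P0.
- split=> //; rewrite map_mxM PU bar_const mulmxA -map_mxM fU //.
- by split; [exact: solution fD fR | exact: solution gD gR].
- split=> i; last by split; [exact: dpol | apply/eqP; case/andP: (hP i)].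
  by rewrite /e; case: ifP => [rei|_]; split; rewrite ?raddf0 //; exact/eqP.
by split; [exact: commut f_free fD fR | exact: commut g_free gD gR].
Qed.

End Descent.

(** * Factorization into elementary gauge transformations *)

Section Valuation.
Variable K : fieldType.
Local Notation L := (laurent K).

Lemma lval_ge (f : L) (a : int) : (a%:E <= lval f)%E <-> vanish_below a f.
Proof.
rewrite /lval; case: eqVneq => [->|f0]; first by rewrite leey.
have [b bP] := laurent_neq0 f0; rewrite lee_fin.
have [] := xgetI (P := [set n : int | f n != 0 /\ vanish_below n f]%classic) 0 bP.
set c := xget _ _ => fc0 fc; split=> [ac|fa]; first exact: vanish_le fc.
by rewrite leNgt; apply: contraNN fc0 => ca; apply/eqP/fa.
Qed.

Lemma mxval_ge n (X : 'M[L]_n) (a : int) : (a%:E <= mxval X)%E <-> mxvanish a X.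
Proof.
rewrite /mxval; split=> [h i j|h].
  apply/lval_ge; apply: le_trans h _.
  by apply: le_trans (bigmin_le _ i _) _; exact: bigmin_le.
apply: le_bigmin => [|i _]; first exact: leey.
by apply: le_bigmin => [|j _]; [exact: leey | apply/lval_ge].
Qed.

Lemma mxval_eq0 n (X : 'M[L]_n) : mxvanish 0 X -> lcoefmx 0 X != 0 ->
  mxval X = 0%:E.
Proof.
move=> /mxval_ge X0 nX; have : ~ (1%:E <= mxval X)%E.
  by move=> /mxval_ge/mxvanishP X1; rewrite X1 ?eqxx in nX.
case: (mxval X) X0 => [v||] //=; rewrite ?leey //; rewrite !lee_fin => v0 v1.
by congr (_%:E); move/negP: v1; lia.
Qed.

Lemma vanish_prod (I : Type) (r : seq I) (F : I -> L) :
  (forall i, vanish_below 0 (F i)) -> vanish_below 0 (\prod_(i <- r) F i).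
Proof.
move=> F0; elim/big_rec: _ => [|i x _ x0]; first by rewrite -(rmorph1 (@lconst K));
  apply: vanish_const.
by rewrite -[0]addr0; apply: vanishM.
Qed.

Lemma lcoef0_prod (I : Type) (r : seq I) (F : I -> L) :
  (forall i, vanish_below 0 (F i)) ->
  (\prod_(i <- r) F i) 0 = \prod_(i <- r) F i 0.
Proof.
move=> F0; elim: r => [|i r IH]; first by rewrite !big_nil.
rewrite !big_cons -IH -(lcoefM_lead (F0 i) (vanish_prod r F0)).
by [].
Qed.

Lemma detE n (X : 'M[L]_n) : \det X =
  \sum_s lconst ((-1) ^+ odd_perm s) * \prod_i X i (s i).
Proof. by apply: eq_bigr => s _; rewrite rmorphXn rmorphN1. Qed.

Lemma vanish_det n (X : 'M[L]_n) : mxvanish 0 X -> vanish_below 0 (\det X).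
Proof.
move=> X0; rewrite detE; apply: vanish_sum => s _; rewrite -[0]addr0.
by apply: vanishM; [exact: vanish_const | apply: vanish_prod].
Qed.

Lemma lcoef0_det n (X : 'M[L]_n) : mxvanish 0 X ->
  (\det X) 0 = \det (lcoefmx 0 X).
Proof.
move=> X0; rewrite detE lcoef_sum; apply: eq_bigr => s _.
rewrite lcoefCM lcoef0_prod //; congr (_ * _).
by apply: eq_bigr => i _; rewrite mxE.
Qed.

Lemma mxvanish_adj n (X : 'M[L]_n) : mxvanish 0 X -> mxvanish 0 (\adj X).
Proof.
move=> X0 i j; rewrite mxE /cofactor.
have -> : ((-1) ^+ (j + i) : L) = lconst ((-1) ^+ (j + i))
  by rewrite rmorphXn rmorphN1.
rewrite -[0]addr0; apply: vanishM; first exact: vanish_const.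
by apply: vanish_det => k l; rewrite !mxE.
Qed.

Lemma regular_unit n (X : 'M[L]_n) : mxvanish 0 X -> \det (lcoefmx 0 X) != 0 ->
  X \in unitmx /\ mxvanish 0 (invmx X).
Proof.
move=> X0 dX; have dX0 : (\det X) 0 != 0 by rewrite lcoef0_det.
have Xu : X \in unitmx by rewrite unitmxE unitfE; apply: contraNneq dX0 => ->.
split=> //; rewrite /invmx Xu -[0]addr0; apply: mxvanishZ; last exact: mxvanish_adj.
by have := vanish_inv (vanish_det X0) dX0; rewrite oppr0.
Qed.

End Valuation.

Lemma singular_column (K : fieldType) n (M : 'M[K]_n) : \det M = 0 ->
  exists2 Y : 'M[K]_n, Y \in unitmx
    & forall i (j : 'I_n), val j = 0%N -> (M *m Y) i j = 0.
Proof.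
case: n M => [|n]; last rewrite -[n.+1]/(1 + n)%N; move=> M dM.
  by exists 1%:M; [exact: unitmx1 | case].
have [v [vM v0]] : exists v : 'rV_(1 + n), v *m M^T = 0 /\ v != 0.
  apply: contrapT => nv; suff : M^T \in unitmx by rewrite unitmxE det_tr dM unitr0.
  apply: unitmx_inj => v vM; apply/eqP; apply: contrapT => /negP v0.
  by apply: nv; exists v.
have [Y vYu] := complete_row_free (row_free_rV v0).
exists (col_mx v Y)^T => [|i j j0]; first by rewrite unitmx_tr.
have -> : j = lshift n 0 by apply: val_inj.
rewrite -[M]trmxK -trmx_mul mul_col_mx vM mxE col_mxEu.
by rewrite mxE.
Qed.

Section Factorization.
Variables (K : fieldType) (n : nat) (n_gt0 : (0 < n)%N).
Local Notation L := (laurent K).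

Definition elementary_gauge (T : 'M[L]_n) : Prop :=
  (regular_gauge T /\ polynomial_gauge T) \/ diagonal_monomial_gauge T.

Definition elementary_product (W : 'M[L]_n) : Prop :=
  W \in unitmx /\ exists Ts : seq 'M[L]_n,
    (forall T, T \in Ts -> elementary_gauge T)
    /\ (forall A, gauge_composition Ts A = gauge W A).

Lemma elementary_productM W T : elementary_product W -> T \in unitmx ->
  elementary_gauge T -> elementary_product (W *m T).
Proof.
move=> [Wu [Ts [Tse TsW]]] Tu Te; split; first by rewrite unitmx_mul Wu.
exists (T :: Ts); split=> [T'|A]; first by rewrite inE => /predU1P[->|/Tse].
by rewrite /= TsW gauge_comp.
Qed.

Lemma elementary_regular (T : 'M[L]_n) : polynomial_gauge T ->
  \det (lcoefmx 0 T) != 0 -> elementary_gauge T.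
Proof.
move=> Tpoly dT; left; split=> //; split; last exact: dT.
have T0 : mxvanish 0 T by case: Tpoly => M -> i j l l0; rewrite mxE lpolyE leNgt l0.
apply: mxval_eq0 => //; apply: contraNneq dT => ->.
by case: n n_gt0 => // n' _; rewrite det0.
Qed.

Lemma elementary_const (Y : 'M[K]_n) : Y \in unitmx -> elementary_gauge Y^lc.
Proof.
move=> Yu; apply: elementary_regular.
  by exists (map_mx polyC Y); apply/matrixP => i j; rewrite !mxE.
by rewrite lcoefmx_const mulr1n -unitfE -unitmxE.
Qed.

Lemma unitmx_const (Y : 'M[K]_n) : Y \in unitmx -> Y^lc \in unitmx.
Proof. by rewrite map_unitmx. Qed.

(** As long as P(0) is singular, a constant column operation makes a column divisible
    by x, and dividing by x lowers the order of the determinant; once P(0) is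
    invertible, the truncation of P is a regular polynomial matrix. Moving the last
    factor Q past diag(x, 1, ..., 1) costs one order of precision, hence the N. *)
Lemma elementary_factorization (P : 'M[L]_n) (s N : nat) :
  mxvanish 0 P -> (\det P) s != 0 ->
  exists W Q, [/\ elementary_product W, P = W *m Q & mxvanish N.+1 (Q - 1%:M)].
Proof.
have base P' (N' : nat) : mxvanish 0 P' -> \det (lcoefmx 0 P') != 0 ->
  exists W Q, [/\ elementary_product W, P' = W *m Q & mxvanish N'.+1 (Q - 1%:M)].
  move=> P0 dP0; pose M := \matrix_(a, b) \poly_(i < N'.+1) P' a b i.
  pose T := map_mx (@lpoly K) M.
  have TE a b (i : int) : T a b i = if (0 <= i) && (i < N'.+1) then P' a b i else 0.
    rewrite !mxE lpolyE coef_poly; case: (lerP 0 i) => //= i0.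
    have -> : (absz i < N'.+1)%N = (i < N'.+1) by lia.
    by rewrite gez0_abs.
  have T0 : mxvanish 0 T by move=> a b i i0; rewrite TE leNgt i0.
  have lT : lcoefmx 0 T = lcoefmx 0 P' by apply/matrixP => a b; rewrite mxE TE mxE.
  have dT : \det (lcoefmx 0 T) != 0 by rewrite lT.
  have [Tu TV0] := regular_unit T0 dT.
  have Te : elementary_gauge T by apply: elementary_regular => //; exists M.
  exists T, (invmx T *m P'); split; last 1 first.
  - rewrite -(mulVmx Tu) -mulmxBr -[N'.+1%:Z]add0r; apply: mxvanishM => //.
    move=> a b i iN; rewrite [(P' - T) a b]mxE [(- T) a b]mxE lcoefB TE iN andbT.
    by case: ifP => [_|/negbT i0]; [rewrite subrr | rewrite subr0 P0 // ltNge].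
  - split=> //; exists [:: T]; split=> [T'|A //].
    by rewrite inE => /eqP->.
  by rewrite mulKVmx.
elim: s P N => [|s IH] P N P0 dP; have [dP0|dP0] := eqVneq (\det (lcoefmx 0 P)) 0.
- by rewrite lcoef0_det // dP0 eqxx in dP.
- exact: base.
- have [Y Yu Y0] := singular_column dP0.
  pose k (j : 'I_n) : nat := (val j == 0%N).
  pose E : 'M[L]_n := diag_mx (\row_j lX ^+ k j).
  pose E' : 'M[L]_n := diag_mx (\row_j lX ^ (- (k j)%:Z)).
  have EE' : E *m E' = 1%:M.
    rewrite mul_diag_mx; apply/matrixP => i j; rewrite !mxE.
    by case: eqP => [->|]; rewrite ?mulr0 // mulr1n exprnP lX_mulVz.
  have [Eu E'u] := mulmx1_unit EE'.
  have E'E : E' *m E = 1%:M by apply: mulmx1C.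
  have Ylu := unitmx_const Yu.
  have YVlu : (invmx Y)^lc \in unitmx by apply: unitmx_const; rewrite unitmx_inv.
  have YYV : Y^lc *m (invmx Y)^lc = 1%:M by rewrite -map_mxM mulmxV // map_mx1.
  have YVY : (invmx Y)^lc *m Y^lc = 1%:M by rewrite -map_mxM mulVmx // map_mx1.
  pose P' := P *m Y^lc *m E'.
  have PP' : P = P' *m (E *m (invmx Y)^lc).
    by rewrite /P' -!mulmxA (mulmxA E') E'E mul1mx YYV mulmx1.
  have P'0 : mxvanish 0 P'.
    move=> i j l l0; rewrite /P' mul_mx_diag mxE [X in _ * X]mxE mulrC lcoefXzM.
    have PY0 : mxvanish 0 (P *m Y^lc).
      by rewrite -[0]addr0; apply: mxvanishM P0 _; apply: mxvanish_const.
    rewrite /k; case: eqP => [j0|_]; last by rewrite PY0 //; lia.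
    have [l1|l1] := ltP (l - - 1%:Z) 0; first exact: PY0.
    have -> : l - - 1%:Z = 0 by lia.
    by have := Y0 i j j0; rewrite -lcoefmx_constr [LHS]mxE.
  have dP' : (\det P') s != 0.
    have dE : \det E' = lX ^ (-1).
      rewrite det_diag; have [j0 _] : exists j : 'I_n, val j =
        0%N by exists (Ordinal n_gt0).
      rewrite (bigD1 (Ordinal n_gt0)) //= mxE big1 ?mulr1 // => j jn0.
      rewrite mxE /k; case: eqP => // e; by case/eqP: jn0; apply: val_inj.
    have -> : \det P' = lX ^ (-1) * (lconst (\det Y) * \det P).
      by rewrite 2!det_mulmx dE det_map_mx [RHS]mulrC (mulrC (\det P)).
    rewrite lcoefXzM lcoefCM; have -> : s%:Z - -1 = s.+1%:Z by lia.
    by apply: mulf_neq0; rewrite // -unitfE -unitmxE.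
  have [W [Q [We eP' Q1]]] := IH _ N.+1 P'0 dP'.
  have Ee : elementary_gauge E by right; exists k.
  pose F := E *m (invmx Y)^lc; pose F' := Y^lc *m E'.
  have FF' : F *m F' = 1%:M by rewrite /F /F' mulmxA -(mulmxA E _ Y^lc) YVY mulmx1.
  have F'F : F' *m F = 1%:M by apply: mulmx1C.
  exists (W *m E *m (invmx Y)^lc), (F' *m Q *m F); split.
  + have WEe := elementary_productM We Eu Ee.
    have YVe : elementary_gauge (invmx Y)^lc by apply: elementary_const;
      rewrite unitmx_inv.
    exact: elementary_productM WEe YVlu YVe.
  + rewrite -(mulmxA W E) -/F -(mulmxA F' Q F) (mulmxA (W *m F)) -(mulmxA W F F').
    by rewrite FF' mulmx1 mulmxA -eP'.
  have -> : F' *m Q *m F - 1%:M = F' *m (Q - 1%:M) *m F.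
    by rewrite mulmxBr mulmxBl mulmx1 F'F.
  rewrite -[N.+1%:Z]addr0; apply: mxvanishM.
    have -> : N.+1%:Z = (0 - 1) + N.+2%:Z by lia.
    apply: mxvanishM => //; apply: mxvanishM; first exact: mxvanish_const.
    move=> i j l l0; rewrite !mxE; case: eqP => [_|//].
    rewrite mulr1n lcoefXz; case: eqP => // e; move: l0; rewrite e /k; lia.
  rewrite -[0]addr0; apply: mxvanishM; last exact: mxvanish_const.
  move=> i j l l0; rewrite !mxE; case: eqP => [_|//].
  rewrite mulr1n exprnP lcoefXz; case: eqP => // e; move: l0; rewrite e /k; lia.
exact: base.
Qed.

End Factorization.

(** * Real and imaginary parts *)

Section RealImaginary.
Variable K : rcfType.
Local Notation C := (K[i]).
Local Notation LK := (laurent K).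
Local Notation LC := (laurent C).
Local Notation toC := (lmap (real_complex K)).
Local Notation conjl := (lmap (@Num.conj C)).
Local Notation ReK := (@complex.Re K).
Local Notation ImK := (@complex.Im K).

Fact lreal_subproof (f : LC) : exists a, vanish_below a (fun l => ReK (f l)).
Proof. by have [a fa] := lcoefP f; exists a => l /fa->. Qed.
Definition lreal f : LK := Laurent (lreal_subproof f).

Fact limag_subproof (f : LC) : exists a, vanish_below a (fun l => ImK (f l)).
Proof. by have [a fa] := lcoefP f; exists a => l /fa->. Qed.
Definition limag f : LK := Laurent (limag_subproof f).

Fact lreal_is_zmod_morphism : zmod_morphism lreal.
Proof. by move=> f g; apply: laurentP => l /=; case: (f l) (g l) => [a b] [c d]. Qed.
Fact limag_is_zmod_morphism : zmod_morphism limag.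
Proof. by move=> f g; apply: laurentP => l /=; case: (f l) (g l) => [a b] [c d]. Qed.
HB.instance Definition _ :=
  GRing.isZmodMorphism.Build LC LK lreal lreal_is_zmod_morphism.
HB.instance Definition _ :=
  GRing.isZmodMorphism.Build LC LK limag limag_is_zmod_morphism.

Lemma lreimE f : f = toC (lreal f) + lconst 'i%C * toC (limag f).
Proof.
by apply: laurentP => l; rewrite lcoefD lcoefCM !lmapE [LHS]complexE.
Qed.

Lemma conj_lreimE f : conjl f = toC (lreal f) - lconst 'i%C * toC (limag f).
Proof.
apply: laurentP => l; rewrite lcoefB lcoefCM !lmapE /=.
by case: (f l) => a b; apply/eqP; rewrite eq_complex /= !(mul0r, mul1r, subr0, sub0r,
  add0r, addr0, oppr0) !eqxx.
Qed.

Lemma lreim_uniq a b :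
  lreal (toC a + lconst 'i%C * toC b) = a /\ limag (toC a + lconst 'i%C * toC b) = b.
Proof.
set f := _ + _; have fE l : f l = (a l)%:C%C + 'i%C * (b l)%:C%C
  by rewrite lcoefD lcoefCM.
split; apply: laurentP => l.
  by rewrite -[LHS]/(ReK (f l)) fE /= mulr0 mul0r subr0 addr0.
by rewrite -[LHS]/(ImK (f l)) fE /= mul0r mul1r !add0r.
Qed.

Lemma sqr_lconst_i : lconst 'i%C * lconst 'i%C = -1 :> LC.
Proof. by rewrite -rmorphM -expr2 sqr_i rmorphN1. Qed.

Lemma lreimM f g : lreal (f * g) = lreal f * lreal g - limag f * limag g
  /\ limag (f * g) = lreal f * limag g + limag f * lreal g.
Proof.
have -> : f * g = toC (lreal f * lreal g - limag f * limag g)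
    + lconst 'i%C * toC (lreal f * limag g + limag f * lreal g).
  rewrite {1}[f]lreimE {1}[g]lreimE rmorphB rmorphD !rmorphM /=.
  have e := sqr_lconst_i; set J := lconst _ in e *.
  rewrite -[X in _ = _ - X + _]mul1r -[1]opprK -e; ring.
exact: lreim_uniq.
Qed.

Lemma lreal_deriv f : lreal (lderiv f) = lderiv (lreal f).
Proof.
apply: laurentP => l; rewrite lderivE /= -[(l + 1)%:~R in LHS](rmorph_int
  (real_complex K)).
by case: (f _) => a b /=; rewrite mul0r subr0.
Qed.

Lemma limag_deriv f : limag (lderiv f) = lderiv (limag f).
Proof.
apply: laurentP => l; rewrite lderivE /= -[(l + 1)%:~R in LHS](rmorph_int
  (real_complex K)).
by case: (f _) => a b /=; rewrite mul0r addr0.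
Qed.

Lemma lreal_toC f : lreal (toC f) = f. Proof. exact: laurentP. Qed.
Lemma limag_toC f : limag (toC f) = 0. Proof. exact: laurentP. Qed.

Lemma toC_inj : injective toC.
Proof. by move=> f g fg; rewrite -[f]lreal_toC fg lreal_toC. Qed.

Lemma conjl_real f : conjl f = f -> f = toC (lreal f).
Proof.
move=> e; apply: laurentP => l; rewrite lmapE /= RRe_real //.
by apply/CrealP; have := congr1 (fun g : LC => g l) e.
Qed.

Lemma conjl_toC f : conjl (toC f) = toC f.
Proof.
apply: laurentP => l; rewrite !lmapE /=.
by have /CrealP : (f l)%:C%C \is Num.real by rewrite complex_real.
Qed.

Lemma toC_mxinj m n (X Y : 'M[LK]_(m, n)) : map_mx toC X = map_mx toC Y -> X = Y.
Proof.
by move=> /matrixP XY; apply/matrixP => i j; have := XY i j; rewrite !mxE => /toC_inj.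
Qed.

Lemma nabla_toC m n (G : 'M[LK]_n) (X : 'M[LK]_(m, n)) :
  nabla (map_mx toC G) (map_mx toC X) = map_mx toC (nabla G X).
Proof.
rewrite /nabla map_mxB map_mxM; congr (_ - _).
by apply/matrixP => i j; rewrite !mxE /= lmap_deriv.
Qed.

Lemma sum_mxtens (V : nmodType) m (F : 'I_(m * 2) -> V) :
  \sum_p F p = \sum_l (F (mxtens_index (l, ord0)) + F (mxtens_index (l, ord_max))).
Proof.
rewrite (reindex (@mxtens_index m 2)); last first.
  by exists (@mxtens_unindex m 2) => p _; rewrite ?mxtens_indexK ?mxtens_unindexK.
transitivity (\sum_(p : 'I_m * 'I_2) F (mxtens_index (p.1, p.2))).
  by apply: eq_bigr => -[l b].
rewrite -(pair_bigA _ (fun l b => F (mxtens_index (l, b)))) /=.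
apply: eq_bigr => l _; rewrite big_ord_recl big_ord1;
  congr (_ + F (mxtens_index (l, _))).
exact: val_inj.
Qed.

(** The coefficientwise extension of Lambda. *)
Definition Lambda_laurent (z : LC) (a b : 'I_2) : LK :=
  if a == b then lreal z else if (a < b)%N then - limag z else limag z.

Lemma lThetaE m (Z : 'M[LC]_m) i a j b :
  lTheta Z (mxtens_index (i, a)) (mxtens_index (j, b)) = Lambda_laurent (Z i j) a b.
Proof.
apply: laurentP => l; rewrite mxE /= !mxE !mxtens_indexK /= ?mxE /Lambda_laurent.
by case: (a == b); case: (a < b)%N.
Qed.

Lemma I2P (a : 'I_2) : a = ord0 \/ a = ord_max.
Proof. by case: a => [[|[|//]] ?]; [left | right]; apply: val_inj. Qed.

Lemma lThetaM m (Y Z : 'M[LC]_m) : lTheta (Y *m Z) = lTheta Y *m lTheta Z.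
Proof.
apply/matrixP => p q; case: (mxtens_indexP p) => i a; case: (mxtens_indexP q) => j b.
rewrite lThetaE [RHS]mxE sum_mxtens mxE /Lambda_laurent !raddf_sum /=.
have E k := lreimM (Y i k) (Z k j).
case: (I2P a) => ->; case: (I2P b) => -> /=; rewrite -?sumrN; apply: eq_bigr => k _;
  by rewrite !lThetaE /Lambda_laurent /= ?(proj1 (E k)) ?(proj2 (E k)); ring.
Qed.

Lemma lThetaD m (Y Z : 'M[LC]_m) : lTheta (Y + Z) = lTheta Y + lTheta Z.
Proof.
apply/matrixP => p q; case: (mxtens_indexP p) => i a; case: (mxtens_indexP q) => j b.
rewrite [RHS]mxE !lThetaE mxE /Lambda_laurent !raddfD.
by case: (I2P a) => ->; case: (I2P b) => -> /=; rewrite ?opprD.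
Qed.

Lemma lThetaXz m k (Z : 'M[LC]_m) : lTheta (lX ^ k *: Z) = lX ^ k *: lTheta Z.
Proof.
apply/matrixP => p q; case: (mxtens_indexP p) => i a; case: (mxtens_indexP q) => j b.
rewrite [RHS]mxE !lThetaE mxE /Lambda_laurent.
have eR : lreal (lX ^ k * Z i j) = lX ^ k * lreal (Z i j).
  by apply: laurentP => l; rewrite [RHS]lcoefXzM -[LHS]/(ReK ((lX ^ k * Z i j) l))
    lcoefXzM.
have eI : limag (lX ^ k * Z i j) = lX ^ k * limag (Z i j).
  by apply: laurentP => l; rewrite [RHS]lcoefXzM -[LHS]/(ImK ((lX ^ k * Z i j) l))
    lcoefXzM.
by rewrite eR eI; do 2!case: ifP => // _; rewrite mulrN.
Qed.

Lemma lreim_const (z : C) :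
  lreal (lconst z) = lconst (ReK z) /\ limag (lconst z) = lconst (ImK z).
Proof.
split; apply: laurentP => l.
  by rewrite -[LHS]/(ReK (lconst z l)) !lconstE; case: (l == 0).
by rewrite -[LHS]/(ImK (lconst z l)) !lconstE; case: (l == 0).
Qed.

Lemma lTheta_const m (B : 'M[C]_m) : lTheta B^lc = (Theta B)^lc.
Proof.
apply/matrixP => p q; case: (mxtens_indexP p) => i a; case: (mxtens_indexP q) => j b.
rewrite lThetaE /Lambda_laurent [RHS]mxE [X in lconst X]mxE !mxtens_indexK /=.
rewrite [B^lc i j]mxE [Lambda _ _ _]mxE; have [-> ->] := lreim_const (B i j).
by case: (a == b) => //; case: (a < b)%N => //; rewrite rmorphN.
Qed.

(** The sign of the imaginary part makes up for the transposition that the row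
    convention brings, see nabla_split_rows. *)
Definition split_rows m n (Y : 'M[LC]_(m, n)) : 'M[LK]_(m * 2, n) :=
  \matrix_(p, j) if (mxtens_unindex p).2 == ord0
                 then lreal (Y (mxtens_unindex p).1 j)
                 else - limag (Y (mxtens_unindex p).1 j).

Lemma split_rowsE m n (Y : 'M[LC]_(m, n)) i a j :
  split_rows Y (mxtens_index (i, a)) j =
    if a == ord0 then lreal (Y i j) else - limag (Y i j).
Proof. by rewrite mxE mxtens_indexK. Qed.

Lemma nabla_split_rows m n (G : 'M[LK]_n) (Y : 'M[LC]_(m, n)) (Z : 'M[LC]_m) :
  nabla (map_mx toC G) Y = Z *m Y ->
  nabla G (split_rows Y) = (lTheta Z^T)^T *m split_rows Y.
Proof.
move=> e; apply/matrixP => p j; case: (mxtens_indexP p) => i a.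
have /matrixP/(_ i j) := e; rewrite /nabla !mxE => eij.
have eRe : \sum_k lreal (Y i k) * G k j - lderiv (lreal (Y i j)) =
    \sum_k (lreal (Z i k) * lreal (Y k j) - limag (Z i k) * limag (Y k j)).
  have := congr1 lreal eij; rewrite raddfB /= !raddf_sum /= lreal_deriv => eq1.
  rewrite (eq_bigr (fun k => lreal (Y i k * map_mx toC G k j))) => [|k _]; last first.
    by have [-> _] := lreimM (Y i k) (map_mx toC G k j);
      rewrite mxE lreal_toC limag_toC mulr0 subr0.
  by rewrite eq1; apply: eq_bigr => k _; case: (lreimM (Z i k) (Y k j)).
have eIm : \sum_k limag (Y i k) * G k j - lderiv (limag (Y i j)) =
    \sum_k (lreal (Z i k) * limag (Y k j) + limag (Z i k) * lreal (Y k j)).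
  have := congr1 limag eij; rewrite raddfB /= !raddf_sum /= limag_deriv => eq1.
  rewrite (eq_bigr (fun k => limag (Y i k * map_mx toC G k j))) => [|k _]; last first.
    by have [_ ->] := lreimM (Y i k) (map_mx toC G k j);
      rewrite mxE lreal_toC limag_toC mulr0 add0r.
  by rewrite eq1; apply: eq_bigr => k _; case: (lreimM (Z i k) (Y k j)).
rewrite sum_mxtens [in lderiv _]mxtens_indexK /=.
under eq_bigr => k _ do rewrite split_rowsE.
under [in RHS]eq_bigr => k _ do rewrite !split_rowsE ![(_^T) _ _]mxE !lThetaE ![(_^T)
  _ _]mxE.
case: (I2P a) => -> /=; rewrite /Lambda_laurent /=.
  by rewrite eRe; apply: eq_bigr => k _; ring.
rewrite raddfN opprK (eq_bigr (fun k => - (limag (Y i k) * G k j))) => [|k _];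
  last by rewrite mulNr.
rewrite sumrN addrC -opprB eIm -sumrN; apply: eq_bigr => k _; ring.
Qed.

(** The matrices X and Y of real_structure, with Y replaced by its real and imaginary
    parts. These span as much as Y and its conjugate. *)
Lemma real_normal_form n (G : 'M[LK]_n) :
  exists (r n1 n2 : nat) (Q : 'M[LK]_(n1 + n2 * 2, n)) (e : 'I_n1 -> LK)
    (h : 'I_n2 -> LC) (C1 : 'M[K]_n1) (C2 : 'M[C]_n2),
  [/\ [/\ (0 < r)%N, (n1 + n2 * 2)%N = n, row_full Q & mxvanish 0 Q],
      nabla (ramification r G) Q =
        block_mx (diag_mx (\row_i e i) + lX ^ (-1) *: C1^lc) 0 0
          (lTheta (diag_mx (\row_i h i) + lX ^ (-1) *: C2^lc)^T)^T *m Q,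
      (forall i, polar (e i)) /\ (forall i, polar (h i) /\ conjl (h i) <> h i)
    & comm_mx (diag_mx (\row_i e i)) C1^lc /\ comm_mx (diag_mx (\row_i h i)) C2^lc].
Proof.
have [r [P [d [R [[r0 Pu P0] Pint [dpol Rd] Rtrig Rnorm]]]]] := complex_normal_form
  (map_mx toC G).
have G_ram : ramification r (map_mx toC G) = map_mx toC (ramification r G).
  apply/matrixP => i j; rewrite !mxE.
  by rewrite [RHS]rmorphM [in RHS]rmorphM rmorph_nat rmorphXn /= lmapX lmap_subst_pow.
rewrite G_ram in Pint.
have G_real : map_mx conjl (map_mx toC (ramification r G)) =
  map_mx toC (ramification r G).
  by apply/matrixP => i j; rewrite !mxE conjl_toC.
have [n1 [n2 [X [Y [e [h [C1 [C2 [[dimS full X0 Y0] [X_real C1_real] [eX eY]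
  [e_pol h_pol] [e_comm h_comm]]]]]]]]]] := real_structure G_real Pu Pint dpol Rd
    Rtrig Rnorm P0.
pose XK := map_mx lreal X; have XE : X = map_mx toC XK.
  apply/matrixP => i j; rewrite !mxE; apply: conjl_real.
  by have /matrixP/(_ i j) := X_real; rewrite mxE.
pose C1K := map_mx ReK C1; have C1E : C1^lc = map_mx toC C1K^lc.
  apply/matrixP => i j; rewrite !mxE /= lmap_const /= RRe_real //.
  by apply/CrealP; have /matrixP/(_ i j) := C1_real; rewrite mxE.
pose eK i := lreal (e i).
have eE : diag_mx (\row_i e i) = map_mx toC (diag_mx (\row_i eK i)).
  by rewrite map_diag_mx; congr diag_mx; apply/rowP => i; rewrite !mxE;
    apply: conjl_real; case: (e_pol i).
exists r, n1, n2, (col_mx XK (split_rows Y)), eK, h, C1K, C2; split.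
- split=> //; first by lia.
    rewrite -(row_full_map toC) -sub1mx;
      apply: submx_trans (_ : (col_mx X (col_mx Y (map_mx conjl Y)) <= _)%MS).
      by rewrite sub1mx.
    rewrite map_col_mx -XE; set Z := map_mx _ (split_rows Y).
    have ZS : (Z <= col_mx X Z)%MS by rewrite -addsmxE addsmxSr.
    have Zrow l a j : Z (mxtens_index (l, a)) j =
        if a == ord0 then toC (lreal (Y l j)) else - toC (limag (Y l j)).
      by rewrite mxE split_rowsE; case: ifP; rewrite ?rmorphN.
    have Ysub (s : LC) (Y' : 'M[LC]_(n2, n)) :
        (forall l j, Y' l j = toC (lreal (Y l j)) - s * toC (limag (Y l j))) -> (Y'
          <= Z)%MS.
      move=> Y'E; apply/row_subP => l.
      have -> : row l Y' = row (mxtens_index (l, ord0)) Z + s *: row (mxtens_index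
        (l, ord_max)) Z.
        apply/rowP => j; rewrite [LHS]mxE Y'E [RHS]mxE [X in _ = X + _]mxE [X in _ =
          _ + X]mxE.
        by rewrite [X in _ = _ + _ * X]mxE !Zrow /= mulrN.
      by rewrite addmx_sub ?scalemx_sub ?row_sub.
    rewrite !col_mx_sub -{1}addsmxE addsmxSl /=; apply/andP; split;
      apply: submx_trans ZS.
      apply: (Ysub (- lconst 'i%C)) => l j; rewrite mulNr opprK; exact: lreimE.
    by apply: (Ysub (lconst 'i%C)) => l j; rewrite mxE conj_lreimE.
  move=> p j; rewrite mxE; case: (split p) => p'; rewrite !mxE.
    by move=> l l0; rewrite /= X0.
  by case: ifP => _ l l0; rewrite ?lcoefN /= Y0 // oppr0.
- have eXK : nabla (ramification r G) XK =
      (diag_mx (\row_i eK i) + lX ^ (-1) *: C1K^lc) *m XK.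
    apply: toC_mxinj; rewrite -nabla_toC -XE eX map_mxM map_mxD map_mxZ -XE -eE -C1E.
    by rewrite /= lmapXz.
  rewrite mul_block_col !mul0mx addr0 add0r -eXK -(nabla_split_rows eY).
  by rewrite /nabla mul_col_mx map_col_mx opp_col_mx add_col_mx.
- split=> i; last exact: h_pol.
  by move=> l l1; case: (e_pol i) => ep _; rewrite /= ep.
split=> //; apply: toC_mxinj; rewrite !map_mxM -eE -C1E; exact: e_comm.
Qed.

End RealImaginary.

(** * The real Turrittin-Ramis-Sibuya form *)

Section PoincareRank.
Variables (K : fieldType) (n : nat).
Implicit Types F : 'M[laurent K]_n.

Lemma mxval_neqNoo F : mxval F != -oo%E.
Proof.
have [k /mxval_ge] := mxvanish_ex F; by case: (mxval F).
Qed.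

Lemma poincare_vanish F : mxvanish (- (poincare_rank F).+1%:Z) F.
Proof.
apply/mxval_ge; rewrite /poincare_rank; have := mxval_neqNoo F.
case: (mxval F) => [v _|_|/eqP//]; last exact: leey.
by rewrite lee_fin; lia.
Qed.

Lemma jet_poincare F : (forall i j l, 0 <= l -> F i j l = 0) ->
  F = jet (poincare_rank F) F.
Proof.
move=> Fneg; rewrite /jet /poincare_rank; have /eqP := mxval_neqNoo F.
case E : (mxval F) => [v||] nNoo; last by case: nNoo.
  apply/matrixP => i j; rewrite mxE; apply: laurentP => l /=; case: ifP =>
    // /negbT lv.
  by rewrite Fneg //; lia.
by apply: (@mxvanish_int _ _ _ 0) => k; apply/mxval_ge; rewrite E leey.
Qed.

End PoincareRank.

Section RealTRSForm.
Variable K : rcfType.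
Local Notation C := (K[i]).
Variables (n1 n2 : nat) (e : 'I_n1 -> laurent K) (h : 'I_n2 -> laurent C).
Variables (C1 : 'M[K]_n1) (C2 : 'M[C]_n2).

Definition real_normal_mx : 'M[laurent K]_(n1 + n2 * 2) :=
  block_mx (diag_mx (\row_i e i) + lX ^ (-1) *: C1^lc) 0 0
           (lTheta (diag_mx (\row_i h i) + lX ^ (-1) *: C2^lc)).
Let F := real_normal_mx.

Hypothesis e_pol : forall i, polar (e i).
Hypothesis h_pol : forall i, polar (h i) /\ lmap (@Num.conj C) (h i) <> h i.

Lemma real_normal_mx_neg i j l : 0 <= l -> F i j l = 0.
Proof.
move=> l0; have l1 : -1 <= l by lia.
have ent (k : fieldType) (m : nat) (x : 'I_m -> laurent k) (B : 'M[k]_m) a b :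
    (forall i, polar (x i)) -> (diag_mx (\row_i x i) + lX ^ (-1) *: B^lc) a b l = 0.
  move=> xp; rewrite !mxE lcoefD lcoefXzM lconstE.
  have -> : (l - -1 == 0) = false by apply/eqP; lia.
  by case: (a == b); rewrite ?mulr1n ?mulr0n ?addr0 ?xp.
rewrite /F /real_normal_mx mxE; case: (split i) => i'; rewrite mxE;
  case: (split j) => j'.
- exact: ent.
- by rewrite mxE.
- by rewrite mxE.
case: (mxtens_indexP i') => u a; case: (mxtens_indexP j') => v b.
rewrite lThetaE /Lambda_laurent; have := ent _ _ h C2 u v (fun i => proj1 (h_pol i)).
set z := fun_of_matrix _ u v => z0.
by case: (a == b); [|case: (a < b)%N]; rewrite ?lcoefN /= z0 ?oppr0.
Qed.

Lemma lpoly_clear (k : fieldType) (q : nat) (f : laurent k) : polar f ->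
  vanish_below (- q.+1%:Z) f ->
  lX ^ q.+1%:Z * f = lpoly (\poly_(i < q) f (i%:Z - q.+1%:Z)).
Proof.
move=> fp fv; apply: laurentP => l; rewrite lcoefXzM lpolyE coef_poly.
have [l0|l0] := lerP 0 l; last by rewrite fv //; lia.
have [lq|lq] := ltnP (absz l) q; first by congr (lcoef f _); lia.
by rewrite fp //; lia.
Qed.

(** The Poincare rank q bounds the poles of the entries, hence those of the exponents,
    which x^(q+1) therefore turns into polynomials of degree less than q. *)
Lemma real_normal_TRS : comm_mx (diag_mx (\row_i e i)) C1^lc ->
    comm_mx (diag_mx (\row_i h i)) C2^lc ->
  let q := poincare_rank F in
  exists (e' : 'I_n1 -> {poly K}) (d' : 'I_n2 -> {poly C}),
    TRS_conditions q e' d' C1 (Theta C2)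
    /\ F = lX ^- q.+1 *: TRS_part q e' d' C1 (Theta C2).
Proof.
move=> e_comm h_comm q; have Fv : mxvanish (- q.+1%:Z) F := @poincare_vanish _ _ F.
have ent (k : fieldType) (m : nat) (x : 'I_m -> laurent k) (B : 'M[k]_m) a l :
    l < -1 -> (diag_mx (\row_i x i) + lX ^ (-1) *: B^lc) a a l = x a l.
  move=> l1; rewrite !mxE lcoefD lcoefXzM lconstE eqxx mulr1n.
  have -> : (l - -1 == 0) = false by apply/eqP; lia.
  by rewrite mulr0n addr0.
have ev i : vanish_below (- q.+1%:Z) (e i).
  move=> l lq; rewrite -(ent _ _ e C1); last lia.
  by have := Fv (lshift _ i) (lshift _ i) l lq;
    rewrite /F /real_normal_mx block_mxEul.
have hv i : vanish_below (- q.+1%:Z) (h i).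
  move=> l lq; rewrite -(ent _ _ h C2); last lia.
  have := Fv (rshift n1 (mxtens_index (i, ord0))) (rshift n1 (mxtens_index (i,
    ord0))) l lq.
  have := Fv (rshift n1 (mxtens_index (i, ord_max))) (rshift n1 (mxtens_index (i,
    ord0))) l lq.
  rewrite /F /real_normal_mx !block_mxEdr !lThetaE /Lambda_laurent /=.
  by case: (_ l) => x y /= -> ->.
pose e' i := \poly_(k < q) e i (k%:Z - q.+1%:Z).
pose d' i := \poly_(k < q) h i (k%:Z - q.+1%:Z).
have hE i := lpoly_clear (proj1 (h_pol i)) (hv i);
  have eE i := lpoly_clear (e_pol i) (ev i).
have scale_diag (k : fieldType) m (x : 'I_m -> laurent k) (y : 'I_m -> {poly k}) :
    (forall i, lX ^ q.+1%:Z * x i = lpoly (y i)) ->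
    diag_mx (\row_i lpoly (y i)) = lX ^ q.+1%:Z *: diag_mx (\row_i x i).
  by move=> xy; apply/matrixP => i j; rewrite !mxE -xy mulrnAr.
have D1E : D1_mx e' = lX ^ q.+1%:Z *: diag_mx (\row_i e i) by apply: scale_diag.
have D2E : D2_mx d' = lX ^ q.+1%:Z *: lTheta (diag_mx (\row_i h i)).
  by rewrite -lThetaXz; congr lTheta; apply: scale_diag.
exists e', d'; split.
  split.
  - by move=> j; apply: size_poly.
  - move=> j; split=> [|q0]; first exact: size_poly.
    move=> [p dp]; case: (h_pol j) => hp; apply; apply: laurentP => l.
    have [l1|l1] := leP (-1) l; first by rewrite lmapE hp ?rmorph0.
    have [lq|lq] := ltP l (- q.+1%:Z); first by rewrite lmapE hv ?rmorph0.
    have -> : l = (absz (l + q.+1%:Z))%:Z - q.+1%:Z by lia.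
    have lt : (absz (l + q.+1%:Z)%R < q)%N by lia.
    have := congr1 (fun r : {poly C} => r`_(absz (l + q.+1%:Z))) dp.
    rewrite coef_poly lt coef_map /= => ->.
    by apply/CrealP; rewrite complex_real.
  - by exists C2.
  - rewrite /comm_mx D1E -scalemxAl -scalemxAr; congr (_ *: _); exact: e_comm.
  rewrite /comm_mx D2E -lTheta_const -scalemxAl -scalemxAr -!lThetaM.
  by congr (_ *: lTheta _); exact: h_comm.
have XV : lX ^- q.+1 * lX ^ q.+1%:Z = 1 :> laurent K.
  by rewrite -exprnP mulVf // expf_neq0 // lX_neq0.
have XV' : lX ^- q.+1 * lX ^+ q = lX ^ (-1) :> laurent K.
  by rewrite exprS invfM -mulrA mulVf ?mulr1 // expf_neq0 // lX_neq0.
rewrite /TRS_part scalerDr scalerA XV' D1E D2E !scale_block_mx !scalerA XV !scale1r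
  !scaler0.
by rewrite add_block_mx !addr0 /F /real_normal_mx lThetaD lThetaXz lTheta_const.
Qed.

End RealTRSForm.

Theorem theorem8 (K : rcfType) (n : nat) (A : 'M[laurent K]_n)
    (singular_A : singular A) :
  exists (P : 'M[laurent K]_n) (r : nat),
    let F := gauge P (ramification r A) in
    let q := poincare_rank F in
    [/\ P \in unitmx /\ (1 <= r)%N,
        exists (n1 n2 : nat) (eqn : (n1 + n2 * 2)%N = n)
               (e : 'I_n1 -> {poly K}) (d : 'I_n2 -> {poly K[i]})
               (C1 : 'M[K]_n1) (C2 : 'M[K]_(n2 * 2)),
          TRS_conditions q e d C1 C2 /\
          F = castmx (eqn, eqn) (lX ^- q.+1 *: TRS_part q e d C1 C2),
        (forall mu : nat, real_TRS_form mu F) /\ F = jet q F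
      & exists (Q : 'M[laurent K]_n) (Ts : seq 'M[laurent K]_n),
          [/\ power_series_mx Q, mxcoef 0 Q = 1%:M,
              forall T, T \in Ts ->
                (regular_gauge T /\ polynomial_gauge T)
                \/ diagonal_monomial_gauge T
            & gauge P =1 gauge Q \o gauge_composition Ts]].
Proof.
have n_gt0 : (0 < n)%N.
  case: n A singular_A => // A; rewrite /singular /mxval big_ord0.
  by rewrite ltNge leey.
have [r [n1 [n2 [Qr [e [h [C1 [C2 [[r0 eqn Qfull Q0] Qint [e_pol h_pol] [e_comm
  h_comm]]]]]]]]]] :=
  real_normal_form A^T.
subst n; set F := real_normal_mx e h C1^T C2^T.
have Qu : Qr^T \in unitmx by rewrite unitmx_tr -row_full_unit.
have ramT : ramification r A^T = (ramification r A)^T.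
  by apply/matrixP => i j; rewrite !mxE.
have FE : gauge Qr^T (ramification r A) = F.
  rewrite ramT -/(intertwines _ _ _) -[X in intertwines _ _ X]trmxK in Qint.
  rewrite (gauge_uniq Qu Qint) tr_block_mx !trmx0 trmxK /F /real_normal_mx !linearD
    !linearZ /= !tr_diag_mx.
  by rewrite !map_trmx.
have trcomm (k : fieldType) m (x : 'I_m -> laurent k) (B : 'M[k]_m) :
    comm_mx (diag_mx (\row_i x i)) B^lc -> comm_mx (diag_mx (\row_i x i)) B^T^lc.
  set D := diag_mx _ => c; have Dt : D^T = D by apply: tr_diag_mx.
  by rewrite /comm_mx -map_trmx -{1}Dt -trmx_mul -c trmx_mul Dt.
have [e' [d' [conds FTRS]]] := real_normal_TRS e_pol h_pol (trcomm _ _ _ _ e_comm)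
  (trcomm _ _ _ _ h_comm).
rewrite -/F in conds FTRS.
exists Qr^T, r; rewrite FE; set q := poincare_rank F; split=> //.
- exists n1, n2, erefl, e', d', C1^T, (Theta C2^T); split; first exact: conds.
  by rewrite castmx_id.
- split; last by apply: jet_poincare => i j l; apply: real_normal_mx_neg.
  move=> mu; exists n1, n2, erefl, e', d', C1^T, (Theta C2^T), 0; split.
  + exact: conds.
  + by apply/mxval_ge; apply: mxvanish0.
  by rewrite addr0 castmx_id.
have detQ : \det Qr^T != 0 by rewrite -unitfE -unitmxE.
have Qr0 : mxvanish 0 Qr^T by move=> i j; rewrite mxE; apply: Q0.
have [l [dl dv]] := laurent_neq0 detQ.
have l0 : 0 <= l by rewrite leNgt; apply: contraNN dl => l0; rewrite vanish_det.
have [s ls] : exists s : nat, l = s by exists (absz l); lia.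
rewrite ls in dl.
have [W [Q [[Wu [Ts [Tse TsW]]] QWQ Q1]]] := elementary_factorization n_gt0 0 Qr0 dl.
have Q00 : mxvanish 0 Q.
  rewrite -[Q](subrK 1%:M); apply: mxvanishD; last exact: mxvanish1.
  by apply: mxvanish_le Q1; lia.
exists Q, Ts; split; [exact: Q00 | | exact: Tse |].
  change (lcoefmx 0 Q = 1%:M); have : lcoefmx 0 (Q - 1%:M) = 0 by move/mxvanishP: Q1;
    apply; lia.
  rewrite lcoefmxB => /eqP; rewrite subr_eq0 => /eqP ->.
  by rewrite -(map_mx1 (@lconst K)) lcoefmx_const mulr1n.
move=> B; rewrite /= TsW QWQ gauge_comp //.
by move: Qu; rewrite QWQ unitmx_mul => /andP[].
Qed.
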